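(* Let $f_0:\mathbb{C}\to\hat{\mathbb{C}}$ be a transcendental meromorphic function of finite order $\rho>0$ satisfying: (KU1) $\infty$ is not an asymptotic value of $f_0$; (KU2) there exist a co-finite subset $\mathcal{P}^*$ of the set $\mathcal{P}$ of poles and $R^*>0$ with $\mathrm{dist}(\mathrm{Sing}(f_0^{-1}),a)>2R^*$ for all $a\in\mathcal{P}^*$; (KU3) there is $R^\dagger>0$ with $B(a_1,R^\dagger)\cap B(a_2,R^\dagger)=\emptyset$ for distinct poles; (KU4) there exist $M\in\mathbb{N}$, $\beta\geq0$ such that for each $a\in\mathcal{P}^*$, $1\leq m(a)\leq M$ and $|f_0(z)|\asymp|a|^{-\beta}|z-a|^{-m(a)}$, $|f_0'(z)|\asymp m(a)|a|^{-\beta}|z-a|^{-m(a)-1}$ for $z\in B(a,R^\dagger)$. Then there is $\varepsilon>0$ such that if $|c_n|<\varepsilon$ for all $n$, then $$\frac{\rho M^*}{\beta+M^*+1}\leq\mathrm{EHD}(F_+)\leq\mathrm{ED}(F_+)\leq\frac{\rho M}{\beta+M+1}.$$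
   Context: $m(a)$ is pole multiplicity; $\mathrm{Sing}(f^{-1})$ the finite critical and asymptotic values; $A\asymp B$ means $C^{-1}A\leq B\leq CA$, $C\geq1$ independent of $a,z$. $M^*$ is the largest integer $1\leq M^*\leq M$ such that $\sum_{a\in\mathcal{P},m(a)=M^*}|a|^{-t}$ converges for $t>\rho$ and diverges for $t<\rho$. $f_n=f_0+c_n$, $F_+^n=f_n\circ\dots\circ f_1$. $\mathcal{J}(F_+)$ is the complement of the set of points with a neighborhood on which all $F_+^n$ are defined and normal; $\mathcal{J}_r(F_+)$ is the set of $z\in\mathcal{J}(F_+)$ with all $F_+^n(z)$ defined and some $\delta>0$ such that for infinitely many $n$, $B(F_+^n(z),\delta)$ pulls back univalently along the orbit of $z$. $\mathrm{ED}(F)=\lim_{R\to\infty}\mathrm{HD}\{z\in\mathcal{J}(F):|F^n(z)|>R\ \forall n\geq1\}$, $\mathrm{EHD}(F)=\lim_{R\to\infty}\mathrm{HD}\{z\in\mathcal{J}_r(F):|F^n(z)|>R\ \forall n\geq1\}$. *)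

(* Defs.v *)
From HB Require Import structures.
From mathcomp Require Import all_boot all_order all_algebra.
From mathcomp Require Import all_classical all_reals all_analysis.
From mathcomp Require Import complex.
Import Order.TTheory GRing.Theory Num.Theory.
Import numFieldNormedType.Exports.

Set Implicit Arguments.
Unset Strict Implicit.
Unset Printing Implicit Defensive.

Local Open Scope classical_set_scope.
Local Open Scope ring_scope.

Section Defs.
Variable R : realType.
Local Notation C := (R[i]).

Definition cabs (z : C) : R := Num.sqrt (complex.Re z ^+ 2 + complex.Im z ^+ 2).
Definition cball (a : C) (r : R) : set C := [set z | cabs (z - a) < r].
Definition copen (U : set C) : Prop :=
  forall z, U z -> exists r, 0 < r /\ cball z r `<=` U.

(** ** Functions into the Riemann sphere  C^ = option C  (None = infinity) *)
(* finite part of a map into the sphere (value at infinity irrelevant) *)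
Definition fv (f : C -> option C) : C^o -> C^o := fun z => odflt 0 (f z).
Definition cderiv (g : C^o -> C^o) (z : C) : C := 'D_1 g z.
Definition holo_on (g : C^o -> C^o) (U : set C) : Prop :=
  forall z, U z -> derivable g z 1.

Definition pole_of_order (f : C -> option C) (a : C) (m : nat) : Prop :=
  (0 < m)%N /\ f a = None /\
  exists r, 0 < r /\ exists g : C^o -> C^o,
    holo_on g (cball a r) /\ g a != 0 /\
    forall z, cball a r z -> z != a -> f z = Some (g z / (z - a) ^+ m).

Definition meromorphic (f : C -> option C) : Prop :=
  forall a, (exists r, 0 < r /\ forall z, cball a r z ->
                 f z <> None /\ derivable (fv f) z 1)
            \/ (exists m, pole_of_order f a m).

Definition poles (f : C -> option C) : set C := [set a | f a = None].
Definition mult (f : C -> option C) (a : C) : nat := xget 0%N [set m | pole_of_order f a m].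

Definition rational_fun (f : C -> option C) : Prop :=
  exists p q : {poly C}, q != 0 /\ forall z, q.[z] != 0 -> f z = Some (p.[z] / q.[z]).
Definition transcendental (f : C -> option C) : Prop := ~ rational_fun f.

Definition npoles (f : C -> option C) (t : R) : nat :=
  (\sum_(a \in [set a | f a = None /\ (cabs a <= t)%R]) mult f a)%N.
Definition circ (r th : R) : C := Complex (r * cos th) (r * sin th).
Definition logplus (v : option C) : \bar R :=
  if v is Some w then (Num.max 0 (ln (cabs w)))%:E else +oo%E.
Definition prox (f : C -> option C) (r : R) : \bar R :=
  ((2 * pi)^-1)%:E * (\int[@lebesgue_measure R]_(th in `[0%R, (2 * pi)%R]%classic)
                         logplus (f (circ r th)))%E.
Definition count_fn (f : C -> option C) (r : R) : \bar R :=
  ((\int[@lebesgue_measure R]_(t in `[0%R, r]%classic)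
       (((npoles f t - npoles f 0)%N%:R / t)%:E))
   + ((npoles f 0)%:R * ln r)%:E)%E.
Definition nev_T (f : C -> option C) (r : R) : \bar R := (prox f r + count_fn f r)%E.
Definition has_order (f : C -> option C) (rho : R) : Prop :=
  limf_esup (fun r : R => (ln (fine (nev_T f r)) / ln r)%:E) (pinfty_nbhs R) = rho%:E.

Definition crit_values (f : C -> option C) : set C :=
  [set w | exists c, f c = Some w /\ cderiv (fv f) c = 0].
Definition path_to_inf (gam : R -> C) : Prop :=
  continuous (gam : R -> C^o) /\
  forall K : R, exists T : R, forall t, T < t -> K < cabs (gam t).
Definition asym_values (f : C -> option C) : set C :=
  [set w | exists gam, path_to_inf gam /\
     forall e : R, 0 < e -> exists T : R, forall t, T < t ->
        exists v, f (gam t) = Some v /\ cabs (v - w) < e].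
Definition inf_asymptotic_value (f : C -> option C) : Prop :=
  exists gam, path_to_inf gam /\
     forall K : R, exists T : R, forall t, T < t ->
        forall v, f (gam t) = Some v -> K < cabs v.
Definition sing_vals (f : C -> option C) : set C := crit_values f `|` asym_values f.
(* dist(A, a) in the extended reals (+oo for empty A) *)
Definition dist_to (A : set C) (a : C) : \bar R :=
  ereal_inf [set (cabs (w - a))%:E | w in A].

Definition conv_exp_class (f : C -> option C) (rho : R) (k : nat) : Prop :=
  (forall t, rho < t ->
     (\esum_(a in [set a | f a = None /\ mult f a = k]) (cabs a `^ (- t))%:E < +oo)%E) /\
  (forall t, t < rho ->
     (\esum_(a in [set a | f a = None /\ mult f a = k]) (cabs a `^ (- t))%:E = +oo)%E).
Definition is_Mstar (f : C -> option C) (rho : R) (M Ms : nat) : Prop :=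
  [/\ (1 <= Ms <= M)%N, conv_exp_class f rho Ms &
      forall k, (Ms < k <= M)%N -> ~ conv_exp_class f rho k].

Definition fn (f0 : C -> option C) (c : nat -> C) (n : nat) (z : C) : option C :=
  omap (fun w => w + c n) (f0 z).
(* Fit n z = F^n(z) in C^; once infinity is reached the orbit is undefined (None) *)
Fixpoint Fit (f0 : C -> option C) (c : nat -> C) (n : nat) (z : C) : option C :=
  match n with
  | 0%N => Some z
  | k.+1 => if Fit f0 c k z is Some w then fn f0 c k.+1 w else None
  end.
Definition chordal (u v : option C) : R :=
  match u, v with
  | Some z, Some w => 2 * cabs (z - w) / Num.sqrt ((1 + cabs z ^+ 2) * (1 + cabs w ^+ 2))
  | Some z, None | None, Some z => 2 / Num.sqrt (1 + cabs z ^+ 2)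
  | None, None => 0
  end.
Definition all_defined_on f0 c (U : set C) : Prop :=
  forall z, U z -> forall n, Fit f0 c n z <> None.
Definition normal_on f0 c (U : set C) : Prop :=
  forall s : nat -> nat, exists phi : nat -> nat,
    (forall k, (phi k < phi k.+1)%N) /\
    exists g : C -> option C,
      forall z, U z -> exists r, 0 < r /\ cball z r `<=` U /\
        forall e : R, 0 < e -> exists N, forall k, (N <= k)%N ->
          forall w, cball z r w ->
            chordal (Fit f0 c (s (phi k)) w) (g w) < e.
Definition fatou f0 c : set C :=
  [set z | exists r, 0 < r /\ all_defined_on f0 c (cball z r) /\ normal_on f0 c (cball z r)].
Definition julia f0 c : set C := ~` fatou f0 c.
Definition univ_pullback f0 c (z : C) (n : nat) (d : R) : Prop :=
  exists V : set C, [/\ copen V, V z,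
    (forall w, V w -> forall k, (k <= n)%N -> Fit f0 c k w <> None),
    {in V &, injective (fun w => odflt 0 (Fit f0 c n w))} &
    (fun w => odflt 0 (Fit f0 c n w)) @` V = cball (odflt 0 (Fit f0 c n z)) d].
Definition radial_julia f0 c : set C :=
  [set z | julia f0 c z /\ (forall n, Fit f0 c n z <> None) /\
     exists d, 0 < d /\ forall N, exists n, (N <= n)%N /\ univ_pullback f0 c z n d].

Definition cdiam (U : set C) : \bar R :=
  ereal_sup [set (cabs (x.1 - x.2))%:E | x in U `*` U].
Definition hterm (s : R) (U : set C) : \bar R :=
  if asbool (U = set0) then 0%E else ((fine (cdiam U)) `^ s)%:E.
Definition haus_delta (s d : R) (A : set C) : \bar R :=
  ereal_inf [set (\sum_(0 <= i <oo) hterm s (U i))%E | U in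
     [set U : nat -> set C | A `<=` \bigcup_i U i /\ forall i, (cdiam (U i) <= d%:E)%E]].
(* H^s = lim_{delta -> 0} H^s_delta = sup_{delta > 0} H^s_delta *)
Definition hausdorff (s : R) (A : set C) : \bar R :=
  ereal_sup [set haus_delta s d A | d in [set d : R | 0 < d]].
Definition HD (A : set C) : R := inf [set s : R | 0 <= s /\ hausdorff s A = 0%E].

Definition escaping_part (S : set C) f0 c (r : R) : set C :=
  [set z | S z /\ forall n, (0 < n)%N -> exists w, Fit f0 c n z = Some w /\ r < cabs w].
Definition ED f0 c : R := lim (HD (escaping_part (julia f0 c) f0 c r) @[r --> +oo]).
Definition EHD f0 c : R := lim (HD (escaping_part (radial_julia f0 c) f0 c r) @[r --> +oo]).

End Defs.

(* Main.v *)
Require Import Defs.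
From HB Require Import structures.
From mathcomp Require Import all_boot all_order all_algebra.
From mathcomp Require Import finmap.
From mathcomp Require Import all_classical all_reals all_analysis.
From mathcomp Require Import measurable_realfun complex ring lra.
Import Order.TTheory GRing.Theory Num.Theory.
Import numFieldNormedType.Exports.

Set Implicit Arguments.
Unset Strict Implicit.
Unset Printing Implicit Defensive.

Local Open Scope classical_set_scope.
Local Open Scope ring_scope.

(** Upper bound. By (KU1) and a Phragmen-Lindelof argument every point where |f| is
    large lies near a pole. Near a pole [a] of multiplicity [m] the points whose
    image is near a pole [a'] fall into boundedly many pieces, on each of which [f]
    expands by at least a constant times |a|^(beta/m) |a'|^(1+1/m). Finite order
    makes the sum of |a|^(-tau) over the poles converge for [tau > rho], so iterating
    these covers shows that the escaping set is null for [H^t] as soon as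
    [t (beta + M + 1) / M > rho].

    Lower bound. Take finitely many large poles of multiplicity [m] = M^* with
    sum_a (kappa |a|^(-(beta+m+1)/m))^s >= 1. The inverse branches of f_n between
    discs around these poles are contractions, and every word over the poles codes a
    point of the radial Julia set whose orbit stays large. Two coded points are
    separated by the product of the numbers kappa |a|^(-(beta+m+1)/m) along their
    common prefix, so comparison with the product measure of weights proportional to
    (kappa |a|^(-(beta+m+1)/m))^s shows that [H^s] of this set is not zero. *)

(** * Modulus, topology and derivative on the complex plane *)

Section ComplexModulus.
Variable R : realType.
Local Notation C := (R[i]).
Implicit Types (z w u : C) (x : R).

Lemma normc_cabs z : `|z| = (cabs z)%:C%C.
Proof. by rewrite normc_def. Qed.

Lemma cabs_ge0 z : 0 <= cabs z.
Proof. exact: sqrtr_ge0. Qed.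

Lemma cabsM z w : cabs (z * w) = cabs z * cabs w.
Proof. by apply: complexI; rewrite rmorphM /= -!normc_cabs normrM. Qed.

Lemma cabsD z w : cabs (z + w) <= cabs z + cabs w.
Proof. by rewrite -lecR rmorphD /= -!normc_cabs ler_normD. Qed.

Lemma cabsN z : cabs (- z) = cabs z.
Proof. by apply: complexI; rewrite -!normc_cabs normrN. Qed.

Lemma cabs_distC z w : cabs (z - w) = cabs (w - z).
Proof. by rewrite -cabsN opprB. Qed.

Lemma cabsV z : cabs z^-1 = (cabs z)^-1.
Proof. by apply: complexI; rewrite fmorphV /= -!normc_cabs normfV. Qed.

Lemma cabsX z n : cabs (z ^+ n) = cabs z ^+ n.
Proof. by apply: complexI; rewrite rmorphXn /= -!normc_cabs normrX. Qed.

Lemma cabs0 : cabs (0 : C) = 0.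
Proof. by apply: complexI; rewrite -normc_cabs normr0. Qed.

Lemma cabs_eq0 z : (cabs z == 0) = (z == 0).
Proof.
by rewrite -(normr_eq0 z) normc_cabs; apply/eqP/eqP => [->//|/complexI].
Qed.

Lemma cabs_gt0 z : (0 < cabs z) = (z != 0).
Proof. by rewrite lt_def cabs_ge0 andbT cabs_eq0. Qed.

Lemma cabs_subr_gt0 z w : (0 < cabs (z - w)) = (z != w).
Proof. by rewrite cabs_gt0 subr_eq0. Qed.

Lemma cabs_real x : cabs (x%:C%C : C) = `|x|.
Proof. by rewrite /cabs /= expr0n /= addr0 sqrtr_sqr. Qed.

Lemma cabs_i : cabs ('i%C : C) = 1.
Proof. by rewrite /cabs /= expr0n /= add0r expr1n sqrtr1. Qed.

Lemma cabs_distD w z u : cabs (z - u) <= cabs (z - w) + cabs (w - u).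
Proof. by rewrite (le_trans _ (cabsD _ _))// addrA subrK. Qed.

Lemma cabsB_ge z w : cabs z - cabs w <= cabs (z - w).
Proof. by rewrite lerBlDr (le_trans _ (cabsD _ _))// subrK. Qed.

Lemma cabsB_le z w : cabs (z - w) <= cabs z + cabs w.
Proof. by rewrite (le_trans (cabsD _ _))// cabsN. Qed.

Lemma sqr_cabs z : cabs z ^+ 2 = complex.Re z ^+ 2 + complex.Im z ^+ 2.
Proof. by rewrite sqr_sqrtr// addr_ge0 ?sqr_ge0. Qed.

Lemma Re_le_cabs z : `|complex.Re z| <= cabs z.
Proof.
by rewrite -(sqrtr_sqr (complex.Re z)) /cabs ler_wsqrtr// lerDl sqr_ge0.
Qed.

Lemma Im_le_cabs z : `|complex.Im z| <= cabs z.
Proof.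
by rewrite -(sqrtr_sqr (complex.Im z)) /cabs ler_wsqrtr// lerDr sqr_ge0.
Qed.

Lemma cabs_le_ReIm z : cabs z <= `|complex.Re z| + `|complex.Im z|.
Proof.
rewrite {1}[z]complexE (le_trans (cabsD _ _))// cabsM cabs_i mul1r.
by rewrite !cabs_real.
Qed.

Lemma cReD z w : complex.Re (z + w) = complex.Re z + complex.Re w.
Proof. by case: z w => [? ?] [? ?]. Qed.

Lemma cImD z w : complex.Im (z + w) = complex.Im z + complex.Im w.
Proof. by case: z w => [? ?] [? ?]. Qed.

Lemma cReB z w : complex.Re (z - w) = complex.Re z - complex.Re w.
Proof. by case: z w => [? ?] [? ?]. Qed.

Lemma cImB z w : complex.Im (z - w) = complex.Im z - complex.Im w.
Proof. by case: z w => [? ?] [? ?]. Qed.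

Lemma cReM z w : complex.Re (z * w) =
  complex.Re z * complex.Re w - complex.Im z * complex.Im w.
Proof. by case: z w => [? ?] [? ?]. Qed.

Lemma cImM z w : complex.Im (z * w) =
  complex.Re z * complex.Im w + complex.Im z * complex.Re w.
Proof. by case: z w => [? ?] [? ?]. Qed.

End ComplexModulus.

Section ComplexTopology.
Variable R : realType.
Local Notation C := (R[i]).
Implicit Types (z w : C) (W : set C).

Lemma gt0_complexE (e : C) : 0 < e -> exists2 r : R, 0 < r & e = r%:C%C.
Proof. by case: e => a b; rewrite ltcE /= => /andP[/eqP -> ?]; exists a. Qed.

Lemma exists_pos_le2 (x y : R) : 0 < x -> 0 < y ->
  exists r, [/\ 0 < r, r <= x & r <= y].
Proof.
move=> x0 y0; exists (Num.min x y).
by rewrite lt_min x0 y0 !ge_min !lexx ?orbT.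
Qed.

Lemma cball_center z (r : R) : 0 < r -> cball z r z.
Proof. by move=> r0; rewrite /cball /= subrr cabs0. Qed.

Lemma nbhs_cballP z W :
  nbhs (z : C^o) W <-> exists r, 0 < r /\ cball z r `<=` W.
Proof.
split=> [/nbhs_ballP[_ /gt0_complexE[r r0 ->] zW]|[r [r0 zW]]].
  exists r; split=> // w wz; apply: zW.
  by rewrite /ball /= normc_cabs ltcR cabs_distC.
apply/nbhs_ballP; exists r%:C%C => /=; first by rewrite ltcR.
by move=> w; rewrite /ball /= normc_cabs ltcR cabs_distC => /zW.
Qed.

Lemma nbhs_cball z (r : R) : 0 < r -> nbhs (z : C^o) (cball z r).
Proof. by move=> r0; apply/nbhs_cballP; exists r; split. Qed.

Lemma copenE W : copen W <-> open (W : set C^o).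
Proof.
rewrite openE; split=> oW z /oW; first by move/nbhs_cballP.
by move=> zW; apply/nbhs_cballP.
Qed.

Lemma cball_open z (r : R) : copen (cball z r).
Proof.
move=> w; rewrite /cball /= -subr_gt0 => wz.
exists (r - cabs (w - z)); split=> // v; rewrite /= ltrBrDr.
by apply: le_lt_trans; exact: cabs_distD.
Qed.

Lemma closure_cballP W z : closure (W : set C^o) z <->
  forall r, 0 < r -> exists w, W w /\ cabs (w - z) < r.
Proof.
split=> [clWz r /(nbhs_cball z)/clWz[w [Ww wz]]|Wz A /nbhs_cballP[r [r0 zA]]].
  by exists w.
by have [w [Ww /zA Aw]] := Wz r r0; exists w.
Qed.

Lemma closure_sub_preimage (u : C^o -> R) (D : set R) W : continuous u -> closed D ->
  W `<=` u @^-1` D -> closure (W : set C^o) `<=` u @^-1` D.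
Proof.
move=> cu Dcl WD z clWz; have := (continuous_closedP u).1 cu D Dcl; apply.
exact: (@closureS C^o W _ WD z clWz).
Qed.

Lemma cabs_dist_continuous (a : C) : continuous (fun z : C^o => cabs (z - a)).
Proof.
move=> z; apply/(@cvgrPdist_lt _ _ _ _ (nbhs_filter (z : C^o))) => e.
move=> /(nbhs_cball z); apply: filterS => w.
rewrite /cball /= cabs_distC; apply: le_lt_trans; rewrite ler_norml.
have := cabs_distD w z a; have := cabs_distD z w a.
by rewrite (cabs_distC w z); lra.
Qed.

Lemma cabs_continuous : continuous (@cabs R : C^o -> R).
Proof.
move=> z; have := @cabs_dist_continuous 0 z; congr continuous_at.
by apply/funext => w; rewrite subr0.
Qed.

Definition ccontinuous (g : C -> C) z := {for z, continuous (g : C^o -> C^o)}.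

Lemma ccontinuousP (g : C -> C) z : ccontinuous g z <-> forall e : R, 0 < e ->
  exists d, 0 < d /\ forall w, cabs (w - z) < d -> cabs (g w - g z) < e.
Proof.
split=> [cg e /(nbhs_cball (g z))/cg/nbhs_cballP//|cg A].
move=> /nbhs_cballP[e [e0 gzA]]; apply/nbhs_cballP.
have [d [d0 gd]] := cg e e0; exists d; split=> // w wz.
by apply: gzA; exact: gd.
Qed.

Lemma ccontinuous_cabs (g : C -> C) z : ccontinuous g z ->
  {for z, continuous (fun w : C^o => cabs (g w))}.
Proof.
by move=> cg; exact: (continuous_comp cg (@cabs_continuous (g z))).
Qed.

Lemma ccontinuous_cabs_lt (g : C -> C) z (B : R) : ccontinuous g z ->
  cabs (g z) < B -> exists d, 0 < d /\
    forall w, cabs (w - z) < d -> cabs (g w) < B.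
Proof.
move=> /ccontinuousP cg; rewrite -subr_gt0 => /cg[d [d0 gd]].
exists d; split=> // w /gd; have := cabsB_ge (g w) (g z); lra.
Qed.

Lemma ccontinuous_ext (g h : C -> C) z (r : R) : 0 < r ->
  (forall w, cabs (w - z) < r -> g w = h w) ->
  ccontinuous g z -> ccontinuous h z.
Proof.
move=> r0 gh /ccontinuousP cg; apply/ccontinuousP => e /cg[d [d0 gd]].
have [s [s0 sd sr]] := exists_pos_le2 d0 r0; exists s; split=> // w ws.
by rewrite -!gh ?subrr ?cabs0 ?(lt_le_trans ws)// gd// (lt_le_trans ws).
Qed.

Lemma ccontinuous_cst (a : C) z : ccontinuous (fun=> a) z.
Proof. exact: (@cst_continuous C^o C^o a z). Qed.

Lemma ccontinuous_id z : ccontinuous id z.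
Proof. by move=> A. Qed.

Lemma ccontinuousD (g h : C -> C) z : ccontinuous g z -> ccontinuous h z ->
  ccontinuous (fun w => g w + h w) z.
Proof. exact: (@continuousD _ C^o C^o g h z). Qed.

Lemma ccontinuousB (g h : C -> C) z : ccontinuous g z -> ccontinuous h z ->
  ccontinuous (fun w => g w - h w) z.
Proof. exact: (@continuousB _ C^o C^o g h z). Qed.

Lemma ccontinuousM (g h : C -> C) z : ccontinuous g z -> ccontinuous h z ->
  ccontinuous (fun w => g w * h w) z.
Proof. exact: (@continuousM C C^o g h z). Qed.

Lemma ccontinuousX (g : C -> C) z n : ccontinuous g z ->
  ccontinuous (fun w => g w ^+ n) z.
Proof.
move=> cg; elim: n => [|n IH]; first exact: ccontinuous_cst.
by have := ccontinuousM cg IH; congr ccontinuous; apply/funext => w; rewrite exprS.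
Qed.

Lemma ccontinuousV (g : C -> C) z : g z != 0 -> ccontinuous g z ->
  ccontinuous (fun w => (g w)^-1) z.
Proof. by move=> ? ?; exact: continuousV. Qed.

Lemma ccontinuous_subr (a : C) z : ccontinuous (fun w => w - a) z.
Proof.
by apply: (@ccontinuousB id (fun=> a)); [exact: ccontinuous_id|exact: ccontinuous_cst].
Qed.

Lemma ccontinuous_subrV (a : C) z : z != a ->
  ccontinuous (fun w => (w - a)^-1) z.
Proof.
move=> za; apply: (@ccontinuousV (fun w => w - a)); first by rewrite subr_eq0.
exact: ccontinuous_subr.
Qed.

End ComplexTopology.

Section ComplexDerivative.
Variable R : realType.
Local Notation C := (R[i]).
Implicit Types (g h : C -> C) (z l k : C).

Definition has_cderiv g z l := is_derive (z : C^o) (1 : C^o) (g : C^o -> C^o) l.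

Let slope_remainder g z v l : v != 0 ->
  v * (v^-1 *: ((g (v *: (1 : C^o) + z) : C^o) - g z) - l) =
  g (v + z) - g z - l * v :> C.
Proof.
move=> v0; rewrite mulrBr; congr (_ - _); last by rewrite mulrC.
by rewrite /GRing.scale /= mulrA mulfV// mul1r mulr1.
Qed.

Lemma has_cderivP g z l : has_cderiv g z l <-> forall e : R, 0 < e ->
  exists d, 0 < d /\ forall w, cabs (w - z) < d ->
    cabs (g w - g z - l * (w - z)) <= e * cabs (w - z).
Proof.
split=> [[+ <-] e e0|gz].
  move=> /(@cvgrPdist_lt _ C^o)/(_ e%:C%C); rewrite ltcR => /(_ e0).
  move=> /nbhs_ballP[_ /gt0_complexE[d d0 ->]] gd; exists d; split=> // w wz.
  have [->|] := eqVneq w z; first by rewrite !subrr mulr0 subr0 cabs0 mulr0.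
  rewrite -subr_eq0 => wz0; have := gd (w - z).
  rewrite /ball /= sub0r normrN !normc_cabs !ltcR => /(_ wz wz0)/ltW.
  rewrite cabs_distC -(ler_pM2l (_ : 0 < cabs (w - z))) ?cabs_gt0//.
  by rewrite -cabsM slope_remainder// subrK [e * _]mulrC.
have slope_cvg : (fun v : C^o => v^-1 *: ((g (v *: (1 : C^o) + z) : C^o) - g z))
    @ (0 : C^o)^' --> (l : C^o).
  apply/(@cvgrPdist_lt _ C^o) => _ /gt0_complexE[r r0 ->].
  have [|d [d0 gd]] := gz (r / 2); first by rewrite divr_gt0.
  apply/nbhs_ballP; exists d%:C%C => /=; first by rewrite ltcR.
  move=> v; rewrite /ball /= sub0r normrN normc_cabs ltcR => vd v0.
  have := gd (v + z); rewrite addrK => /(_ vd).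
  rewrite -slope_remainder// cabsM mulrC ler_pM2r ?cabs_gt0// => le_half.
  by rewrite normc_cabs ltcR cabs_distC (le_lt_trans le_half)//; lra.
split; first by apply/cvg_ex; exists l.
by rewrite /derive; apply/cvg_lim => //; exact: norm_hausdorff.
Qed.

Lemma has_cderiv_unique g z l : has_cderiv g z l -> cderiv g z = l.
Proof. by case. Qed.

Lemma has_cderiv_ccontinuous g z l : has_cderiv g z l -> ccontinuous g z.
Proof. by case=> /derivable1_diffP/differentiable_continuous. Qed.

Lemma has_cderiv_cst (a : C) z : has_cderiv (fun=> a) z 0.
Proof. exact: is_derive_cst. Qed.

Lemma has_cderiv_id z : has_cderiv id z 1.
Proof. exact: is_derive_id. Qed.

Lemma has_cderivB g h z l k : has_cderiv g z l -> has_cderiv h z k ->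
  has_cderiv (fun w => g w - h w) z (l - k).
Proof. by move=> ? ?; exact: is_deriveB. Qed.

Lemma has_cderivM g h z l k : has_cderiv g z l -> has_cderiv h z k ->
  has_cderiv (fun w => g w * h w) z (l * h z + g z * k).
Proof.
move=> dg dh; apply: (is_derive_eq (is_deriveM dg dh)).
by rewrite addrC [l * _]mulrC.
Qed.

Lemma has_cderivX g z l n : has_cderiv g z l ->
  has_cderiv (fun w => g w ^+ n) z (n%:R * g z ^+ n.-1 * l).
Proof.
case: n => [_|n]; first by rewrite !mul0r; exact: has_cderiv_cst.
move=> dg; elim: n => [|n IH]; first by rewrite expr0 !mul1r.
have := has_cderivM dg IH.
rewrite (_ : l * _ + _ = n.+2%:R * g z ^+ n.+2.-1 * l) => [|/=]; last first.
  by rewrite -[n.+2%:R]natr1 exprS; ring.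
by congr has_cderiv; apply/funext => w; rewrite [RHS]exprS.
Qed.

Lemma has_cderiv_ext g h z l (r : R) : 0 < r ->
  (forall w, cabs (w - z) < r -> g w = h w) ->
  has_cderiv g z l -> has_cderiv h z l.
Proof.
move=> r0 gh /has_cderivP dg; apply/has_cderivP => e /dg[d [d0 gd]].
have [s [s0 sd sr]] := exists_pos_le2 d0 r0; exists s; split=> // w ws.
by rewrite -!gh ?subrr ?cabs0 ?(lt_le_trans ws)// gd// (lt_le_trans ws).
Qed.

Lemma has_cderiv_subr (a : C) z : has_cderiv (fun w => w - a) z 1.
Proof. by have := has_cderivB (has_cderiv_id z) (has_cderiv_cst a z); rewrite subr0. Qed.

Lemma has_cderiv_mul_root g p : ccontinuous g p ->
  has_cderiv (fun z => g z * (z - p)) p (g p).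
Proof.
move=> /ccontinuousP cg; apply/has_cderivP => e /cg[d [d0 gd]].
exists d; split=> // w /gd/ltW gw.
rewrite subrr mulr0 subr0 -mulrBl cabsM.
by rewrite ler_wpM2r ?cabs_ge0.
Qed.

Definition cderivable g z := derivable (g : C^o -> C^o) z 1.

Lemma cderivableP g z : cderivable g z -> has_cderiv g z (cderiv g z).
Proof. exact: derivableP. Qed.

Lemma has_cderiv_cderivable g z l : has_cderiv g z l -> cderivable g z.
Proof. by case. Qed.

Lemma cderivable_ccontinuous g z : cderivable g z -> ccontinuous g z.
Proof. by move=> /cderivableP/has_cderiv_ccontinuous. Qed.

Lemma cderivable_cst (a : C) z : cderivable (fun=> a) z.
Proof. exact: derivable_cst. Qed.

Lemma cderivable_id z : cderivable id z.
Proof. exact: derivable_id. Qed.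

Lemma cderivable_subr (a : C) z : cderivable (fun w => w - a) z.
Proof. exact: has_cderiv_cderivable (has_cderiv_subr a z). Qed.

Lemma cderivableD g h z : cderivable g z -> cderivable h z ->
  cderivable (fun w => g w + h w) z.
Proof. exact: derivableD. Qed.

Lemma cderivableB g h z : cderivable g z -> cderivable h z ->
  cderivable (fun w => g w - h w) z.
Proof. exact: derivableB. Qed.

Lemma cderivableM g h z : cderivable g z -> cderivable h z ->
  cderivable (fun w => g w * h w) z.
Proof. exact: derivableM. Qed.

Lemma cderivableX g z n : cderivable g z -> cderivable (fun w => g w ^+ n) z.
Proof. by move=> /cderivableP/(has_cderivX n)/has_cderiv_cderivable. Qed.

Lemma cderivableV g z : g z != 0 -> cderivable g z ->
  cderivable (fun w => (g w)^-1) z.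
Proof. exact: derivableV. Qed.

Lemma cderivable_subrV (a : C) z : z != a -> cderivable (fun w => (w - a)^-1) z.
Proof.
move=> za; apply: (@cderivableV (fun w => w - a)); first by rewrite subr_eq0.
exact: cderivable_subr.
Qed.

Lemma cderivable_ext g h z (r : R) : 0 < r ->
  (forall w, cabs (w - z) < r -> g w = h w) -> cderivable g z -> cderivable h z.
Proof.
by move=> r0 gh /cderivableP/(has_cderiv_ext r0 gh)/has_cderiv_cderivable.
Qed.

Lemma cderivable_mul_root g p : ccontinuous g p ->
  cderivable (fun z => g z * (z - p)) p.
Proof. by move=> /has_cderiv_mul_root/has_cderiv_cderivable. Qed.

End ComplexDerivative.

Lemma nat_dependent_choice (T : Type) (P : nat -> T -> Prop)
    (Q : nat -> T -> T -> Prop) (x0 : T) : P 0%N x0 ->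
  (forall n x, P n x -> exists y, P n.+1 y /\ Q n x y) ->
  exists s : nat -> T, s 0%N = x0 /\ forall n, P n (s n) /\ Q n (s n) (s n.+1).
Proof.
move=> P0 PQ; have /choice[F FP] (nx : nat * T) : exists y, P nx.1 nx.2 ->
    P nx.1.+1 y /\ Q nx.1 nx.2 y.
  by have [/PQ[y]|] := pselect (P nx.1 nx.2); [exists y|exists x0].
pose fix s n := if n is k.+1 then F (k, s k) else x0.
have Ps n : P n (s n) by elim: n => // n /(FP (n, s n))[].
by exists s; split=> // n; split=> //; have [] := FP (n, s n) (Ps n).
Qed.

(** * Compactness *)

Lemma compact_induction (T : topologicalType) (K : set T) (Q : set T -> Prop) :
  compact K -> Q set0 ->
  (forall A B, A `<=` B -> Q B -> Q A) ->
  (forall A B, Q A -> Q B -> Q (A `|` B)) ->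
  (forall x, K x -> exists2 U, nbhs x U & Q U) ->
  Q K.
Proof.
move=> cK Q0 Qsub QU Qloc; apply: contrapT => nQK.
pose F : set_system T := [set A | Q (K `\` A)].
have FF : ProperFilter F.
  split; first by rewrite /F /= setD0.
  split; first by rewrite /F /= setDT.
    by move=> A B FA FB; rewrite /F /= setDIr; exact: QU.
  by move=> A B AB; apply: Qsub => x [Kx nBx]; split=> // /AB.
have [x [Kx clFx]] : K `&` cluster F !=set0 by apply: cK; rewrite /F /= setDv.
have [U xU QofU] := Qloc x Kx.
have [|y [nUy /nUy]//] := clFx (~` U) U _ xU.
by apply: Qsub QofU => y [_ /contrapT].
Qed.

Section ComplexCompactness.
Variable R : realType.
Local Notation C := (R[i]).

Definition rect (x y w v : R) : set C :=
  [set z | x <= complex.Re z <= x + w /\ y <= complex.Im z <= y + v].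

Lemma rect_compact x y w v : compact (rect x y w v : set C^o).
Proof.
pose point (q : R * R) : C^o := (q.1 +i* q.2)%C.
have point_continuous : continuous point.
  move=> q; apply/(@cvgrPdist_lt _ C^o) => _ /gt0_complexE[e e0 ->].
  apply/(@nbhs_ballP R (R * R)%type); exists (e / 2) => /=; first by rewrite divr_gt0.
  move=> p [dRe dIm]; rewrite normc_cabs ltcR (le_lt_trans (cabs_le_ReIm _))//.
  by rewrite [ltRHS]splitr cReB cImB ltrD.
have -> : rect x y w v = point @` (`[x, x + w] `*` `[y, y + v]).
  apply/seteqP; split=> [[s t] st|_ [[s t] /= [+ +] <-]].
    by exists (s, t) => //; rewrite /= !in_itv.
  by rewrite !in_itv.
apply: continuous_compact; first exact: continuous_subspaceT.
by apply: compact_setX; exact: segment_compact.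
Qed.

Lemma closed_bounded_compact (K : set C) B : closed (K : set C^o) ->
  (forall z, K z -> cabs z <= B) -> compact (K : set C^o).
Proof.
move=> Kcl KB; have sub : K `<=` rect (- B) (- B) (B + B) (B + B).
  move=> z /KB zB; rewrite /rect /= !addrA !addNr !add0r -!ler_norml.
  by rewrite !(le_trans _ zB) ?Re_le_cabs ?Im_le_cabs.
exact: (@subclosed_compact C^o _ _ Kcl (@rect_compact _ _ _ _) sub).
Qed.

Lemma closed_bounded_max (K : set C) (u : C^o -> R) B : K !=set0 ->
  closed (K : set C^o) -> (forall z, K z -> cabs z <= B) ->
  (forall z, K z -> {for z, continuous u}) ->
  exists2 z, K z & forall w, K w -> u w <= u z.
Proof.
move=> K0 Kcl KB cu.
have [|c /set_mem Kc umax] := compact_EVT_max (f := u) K0 (closed_bounded_compact Kcl KB).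
  by apply: continuous_in_subspaceT => z /set_mem/cu.
by exists c => // w /mem_set/umax.
Qed.

End ComplexCompactness.

(** * Bisection *)

Section Bisection.
Variable R : realType.
Local Notation C := (R[i]).

Lemma nested_segments_point (s w : nat -> R) : (forall n, 0 <= w n) ->
  (forall n, s n <= s n.+1 /\ s n.+1 + w n.+1 <= s n + w n) ->
  exists p, forall n, s n <= p <= s n + w n.
Proof.
move=> w0 nested.
have left_mono : {homo s : m n / (m <= n)%N >-> m <= n}.
  by apply: homo_leq => [//|? ? ?|n]; [exact: le_trans|case: (nested n)].
have right_mono : {homo (fun n => s n + w n) : m n / (m <= n)%N >-> n <= m}.
  by apply: homo_leq => [//|b a c ab cb|n]; [exact: le_trans ab|case: (nested n)].
have left_le_right m n : s m <= s n + w n.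
  have : s (maxn m n) <= s (maxn m n) + w (maxn m n) by rewrite lerDl.
  move=> /(le_trans (left_mono _ _ (leq_maxl m n)))/le_trans; apply.
  exact: right_mono (leq_maxr m n).
exists (sup (range s)) => n; rewrite ub_le_sup ?ge_sup//=.
- by exists (s n), n.
- by move=> _ [m _ <-].
- by exists (s 0%N + w 0%N) => _ [m _ <-].
- by exists n.
Qed.

Lemma exists_half_powers_lt (x d : R) : 0 < d ->
  exists N, forall n, (N <= n)%N -> x / 2 ^+ n < d.
Proof.
move=> d0; exists (Num.bound (x / d)) => n /upper_nthrootP.
by rewrite ltr_pdivrMr// mulrC -ltr_pdivrMr ?exprn_gt0.
Qed.

Lemma rect_induction (P : R -> R -> R -> R -> Prop) x0 y0 w0 v0 :
  0 < w0 -> 0 < v0 ->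
  (forall x y w v, 0 < w -> 0 < v -> rect x y w v `<=` rect x0 y0 w0 v0 ->
    (forall i j : bool,
       P (x + i%:R * (w / 2)) (y + j%:R * (v / 2)) (w / 2) (v / 2)) ->
    P x y w v) ->
  (forall p, rect x0 y0 w0 v0 p -> exists d, 0 < d /\ forall x y w v,
    0 < w -> 0 < v -> rect x y w v `<=` rect x0 y0 w0 v0 ->
    w < d -> v < d -> v * w0 = w * v0 -> rect x y w v p -> P x y w v) ->
  P x0 y0 w0 v0.
Proof.
move=> w00 v00 quarters loc; apply: contrapT => nP.
pose w n : R := w0 / 2 ^+ n; pose v n : R := v0 / 2 ^+ n.
have w_gt0 n : 0 < w n by rewrite divr_gt0// exprn_gt0.
have v_gt0 n : 0 < v n by rewrite divr_gt0// exprn_gt0.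
have wS n : w n.+1 = w n / 2 by rewrite /w exprSr invfM mulrA.
have vS n : v n.+1 = v n / 2 by rewrite /v exprSr invfM mulrA.
pose bad n (q : R * R) := rect q.1 q.2 (w n) (v n) `<=` rect x0 y0 w0 v0 /\
  ~ P q.1 q.2 (w n) (v n).
pose nested n (q q' : R * R) := (q.1 <= q'.1 /\ q'.1 + w n.+1 <= q.1 + w n) /\
  (q.2 <= q'.2 /\ q'.2 + v n.+1 <= q.2 + v n).
have bad_quarter n q : bad n q -> exists q', bad n.+1 q' /\ nested n q q'.
  move=> [sub nPq]; apply: contrapT => /forallNP noq; apply: nPq.
  apply: quarters => // i j; apply: contrapT => nPij.
  have := w_gt0 n; have := v_gt0 n => vn wn.
  have ij : (0 <= i%:R * (w n / 2) <= w n / 2) /\ (0 <= j%:R * (v n / 2) <= v n / 2).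
    by case: (i) (j) => -[]; rewrite ?mul1r ?mul0r; split; lra.
  apply: (noq (q.1 + i%:R * (w n / 2), q.2 + j%:R * (v n / 2))).
  move: ij => [/andP[? ?] /andP[? ?]]; rewrite /bad /nested wS vS /=.
  split; [split=> // z|by split; split; lra].
  by move=> [/= /andP[? ?] /andP[? ?]]; apply: sub; split; lra.
have [|s [_ sP]] := @nat_dependent_choice _ bad nested (x0, y0) _ bad_quarter.
  by rewrite /bad /w /v !expr0 !divr1; split.
have [px pxP] := @nested_segments_point (fun n => (s n).1) w
  (fun n => ltW (w_gt0 n)) (fun n => (sP n).2.1).
have [py pyP] := @nested_segments_point (fun n => (s n).2) v
  (fun n => ltW (v_gt0 n)) (fun n => (sP n).2.2).
have in_rect n : rect (s n).1 (s n).2 (w n) (v n) (px +i* py)%C by split.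
have [|d [d0 small_P]] := loc (px +i* py)%C; first exact: (sP 0%N).1.1.
have [Nw w_small] := exists_half_powers_lt w0 d0.
have [Nv v_small] := exists_half_powers_lt v0 d0.
have [sub] := (sP (maxn Nw Nv)).1; apply; apply: small_P => //.
- by rewrite w_small ?leq_maxl.
- by rewrite v_small ?leq_maxr.
- by rewrite /w /v; ring.
Qed.

End Bisection.

(** * Contour integrals and Goursat's theorem *)

Section SegmentIntegral.
Variable R : realType.
Local Notation C := (R[i]).
Local Notation mu := (@lebesgue_measure R).
Implicit Types (u v : R -> R) (f g : R -> C) (a b : R).

Definition intR u a b : R := \int[mu]_(t in `[a, b]) u t.
Definition contR u a b := {in `[a, b], continuous u}.

Lemma contR_cst (k : R) a b : contR (fun=> k) a b.
Proof. by move=> t _; exact: cst_continuous. Qed.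

Lemma contR_id a b : contR id a b.
Proof. by move=> t _; exact: cvg_id. Qed.

Lemma contRZ (k : R) u a b : contR u a b -> contR (fun t => k * u t) a b.
Proof. by move=> cu t tab; apply: cvgM; [exact: cvg_cst|exact: cu]. Qed.

Lemma contR_integrable u a b : contR u a b ->
  mu.-integrable `[a, b] (EFin \o u).
Proof.
move=> cu; apply: continuous_compact_integrable; first exact: segment_compact.
by apply: continuous_in_subspaceT => t /set_mem; exact: cu.
Qed.

Lemma intRD u v a b : contR u a b -> contR v a b ->
  intR (fun t => u t + v t) a b = intR u a b + intR v a b.
Proof. by move=> /contR_integrable ? /contR_integrable ?; exact: RintegralD. Qed.

Lemma intRZ (k : R) u a b : contR u a b ->
  intR (fun t => k * u t) a b = k * intR u a b.
Proof. by move=> /contR_integrable ?; exact: RintegralZl. Qed.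

Lemma intR_split u a e b : a <= e -> e <= b -> contR u a b ->
  intR u a b = intR u a e + intR u e b.
Proof.
move=> ae eb /contR_integrable Iu; apply/eqP; rewrite addrC -subr_eq; apply/eqP.
rewrite /intR (Rintegral_itvB Iu) ?bnd_simp//.
rewrite Rintegral_itv_obnd_cbnd//; apply: integrableS Iu => //.
by apply: subset_itvr; rewrite bnd_simp.
Qed.

Lemma intR_cst (k : R) a b : a <= b -> intR (fun=> k) a b = k * (b - a).
Proof.
move=> ab; rewrite /intR Rintegral_cst//= lebesgue_measure_itv /= lte_fin.
by move: ab; rewrite le_eqVlt => /predU1P[->|->] //=; rewrite ltxx subrr.
Qed.

Lemma intR_ge u a b m : a <= b -> contR u a b ->
  (forall t, a <= t <= b -> m <= u t) -> m * (b - a) <= intR u a b.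
Proof.
move=> ab cu mu_le; rewrite -intR_cst//; apply: le_Rintegral => //.
- exact: contR_integrable (@contR_cst m a b).
- exact: contR_integrable.
Qed.

Lemma intR_norm_le u a b B : a <= b -> contR u a b ->
  (forall t, a <= t <= b -> `|u t| <= B) -> `|intR u a b| <= B * (b - a).
Proof.
move=> ab cu uB; have Iu := contR_integrable cu.
apply: (le_trans (le_normr_Rintegral _ Iu)) => //.
rewrite -intR_cst//; apply: le_Rintegral => //.
- exact: integrable_norm Iu.
- exact: contR_integrable (@contR_cst B a b).
Qed.

Lemma intR_id a b : a <= b -> intR id a b = (b ^+ 2 - a ^+ 2) / 2.
Proof.
rewrite le_eqVlt => /predU1P[->|ab].
  by rewrite subrr mul0r /intR set_itv1 Rintegral_set1.
pose F (t : R) := t ^+ 2 / 2.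
have dF (t : R) : is_derive t 1 F t.
  rewrite /F; apply: is_derive_eq; rewrite /GRing.scale /=.
  by rewrite !mulr0 add0r mulr1; field.
have cF : continuous F.
  by move=> t; apply/differentiable_continuous/derivable1_diffP; case: (dF t).
rewrite /intR /Rintegral (@continuous_FTC2 _ id F)//.
- by rewrite /= /F; ring.
- by apply: continuous_subspaceT => t; exact: cvg_id.
- split; first by move=> t _; case: (dF t).
  + by apply: cvg_at_right_filter; exact: cF.
  + by apply: cvg_at_left_filter; exact: cF.
- by move=> t _; rewrite derive1E; case: (dF t).
Qed.

Definition contC f a b :=
  contR (fun t => complex.Re (f t)) a b /\ contR (fun t => complex.Im (f t)) a b.

Definition intC f a b : C :=
  (intR (fun t => complex.Re (f t)) a b +i* intR (fun t => complex.Im (f t)) a b)%C.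

Lemma intCD f g a b : contC f a b -> contC g a b ->
  intC (fun t => f t + g t) a b = intC f a b + intC g a b.
Proof.
move=> [f1 f2] [g1 g2]; rewrite /intC.
under eq_fun do rewrite cReD.
by under [X in (_ +i* intR X _ _)%C]eq_fun do rewrite cImD; rewrite !intRD.
Qed.

Lemma intCZ k f a b : contC f a b ->
  intC (fun t => k * f t) a b = k * intC f a b.
Proof.
move=> [f1 f2]; rewrite /intC.
have -> : (fun t => complex.Re (k * f t)) =
    (fun t => complex.Re k * complex.Re (f t) + - complex.Im k * complex.Im (f t)).
  by apply/funext => t; rewrite cReM mulNr.
have -> : (fun t => complex.Im (k * f t)) =
    (fun t => complex.Re k * complex.Im (f t) + complex.Im k * complex.Re (f t)).
  by apply/funext => t; rewrite cImM.
rewrite !intRD ?intRZ//; try exact: contRZ.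
by apply/eqP; rewrite eq_complex /= cReM cImM /= mulNr !eqxx.
Qed.

Lemma intC_split f a e b : a <= e -> e <= b -> contC f a b ->
  intC f a b = intC f a e + intC f e b.
Proof.
by move=> ae eb [f1 f2]; rewrite /intC (intR_split ae eb f1) (intR_split ae eb f2).
Qed.

Lemma intC_cabs_le f a b B : a <= b -> contC f a b ->
  (forall t, a <= t <= b -> cabs (f t) <= B) ->
  cabs (intC f a b) <= 2 * B * (b - a).
Proof.
move=> ab [f1 f2] fB; rewrite (le_trans (cabs_le_ReIm _))//=.
rewrite -mulrA mulr2n mulrDl mul1r; apply: lerD; apply: intR_norm_le => // t /fB.
- by apply: le_trans; exact: Re_le_cabs.
- by apply: le_trans; exact: Im_le_cabs.
Qed.

Lemma intC_affine (p q : C) a b : a <= b ->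
  intC (fun t => p + q * t%:C%C) a b =
  p * (b - a)%:C%C + q * ((b ^+ 2 - a ^+ 2) / 2)%:C%C.
Proof.
move=> ab.
have affine (s r : R) : intR (fun t => s + r * t) a b =
    s * (b - a) + r * ((b ^+ 2 - a ^+ 2) / 2).
  rewrite intRD ?intRZ ?intR_cst ?intR_id//.
  - exact: contR_id.
  - exact: contR_cst.
  - exact: contRZ (@contR_id a b).
rewrite /intC.
have -> : (fun t : R => complex.Re (p + q * t%:C%C)) =
    (fun t => complex.Re p + complex.Re q * t).
  by apply/funext => t; rewrite cReD cReM /= mulr0 subr0.
have -> : (fun t : R => complex.Im (p + q * t%:C%C)) =
    (fun t => complex.Im p + complex.Im q * t).
  by apply/funext => t; rewrite cImD cImM /= mulr0 add0r.
rewrite !affine; apply/eqP; rewrite eq_complex /= cReD cImD !cReM !cImM /=.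
by rewrite !mulr0 !subr0 !add0r !eqxx.
Qed.

Lemma contC_comp (g : C -> C) (path : R -> C) a b :
  (forall s t, cabs (path s - path t) = `|s - t|) ->
  (forall t, a <= t <= b -> ccontinuous g (path t)) ->
  contC (fun t => g (path t)) a b.
Proof.
move=> path_isometric cg.
have near_path t e : t \in `[a, b] -> 0 < e ->
    \forall s \near t, cabs (g (path t) - g (path s)) < e.
  rewrite in_itv /= => /cg/ccontinuousP ct /ct[d [d0 gd]].
  apply/nbhs_ballP; exists d => //= s; rewrite /ball /= => st.
  by rewrite cabs_distC; apply: gd; rewrite path_isometric distrC.
split=> t tab; apply/cvgrPdist_lt => e /(near_path t e tab); apply: filterS => s.
- by rewrite -cReB; apply: le_lt_trans; exact: Re_le_cabs.
- by rewrite -cImB; apply: le_lt_trans; exact: Im_le_cabs.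
Qed.

End SegmentIntegral.

Ltac complex_ring :=
  apply/eqP; rewrite eq_complex /=; apply/andP; split; apply/eqP; ring.

Section Contour.
Variable R : realType.
Local Notation C := (R[i]).
Implicit Types (g h : C -> C) (x y w v B : R).

(* The rectangle is traversed counterclockwise from its lower left corner. *)
Definition contour g x y w v : C :=
  intC (fun t => g (t +i* y)%C) x (x + w) +
  'i%C * intC (fun t => g ((x + w) +i* t)%C) y (y + v) -
  intC (fun t => g (t +i* (y + v))%C) x (x + w) -
  'i%C * intC (fun t => g (x +i* t)%C) y (y + v).

Definition bdry x y w v : set C := [set z | rect x y w v z /\
  [\/ complex.Re z = x, complex.Re z = x + w, complex.Im z = y | complex.Im z = y + v]].

Lemma bdry_left x y w v t : 0 <= w -> y <= t <= y + v -> bdry x y w v (x +i* t)%C.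
Proof. by move=> ? ?; split; [split=> //=; lra|apply: Or41]. Qed.

Lemma bdry_right x y w v t : 0 <= w -> y <= t <= y + v ->
  bdry x y w v ((x + w) +i* t)%C.
Proof. by move=> ? ?; split; [split=> //=; lra|apply: Or42]. Qed.

Lemma bdry_bottom x y w v t : 0 <= v -> x <= t <= x + w -> bdry x y w v (t +i* y)%C.
Proof. by move=> ? ?; split; [split=> //=; lra|apply: Or43]. Qed.

Lemma bdry_top x y w v t : 0 <= v -> x <= t <= x + w ->
  bdry x y w v (t +i* (y + v))%C.
Proof. by move=> ? ?; split; [split=> //=; lra|apply: Or44]. Qed.

Definition bdry_continuous g x y w v :=
  forall z, bdry x y w v z -> ccontinuous g z.

Lemma contC_horizontal g y a b : (forall t, a <= t <= b -> ccontinuous g (t +i* y)%C) ->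
  contC (fun t => g (t +i* y)%C) a b.
Proof.
apply: (@contC_comp _ g (fun t => t +i* y)%C) => s t.
by rewrite (_ : _ - _ = (s - t)%:C%C) ?cabs_real//; complex_ring.
Qed.

Lemma contC_vertical g x a b : (forall t, a <= t <= b -> ccontinuous g (x +i* t)%C) ->
  contC (fun t => g (x +i* t)%C) a b.
Proof.
apply: (@contC_comp _ g (fun t => x +i* t)%C) => s t.
rewrite (_ : _ - _ = 'i%C * (s - t)%:C%C); last by complex_ring.
by rewrite cabsM cabs_i mul1r cabs_real.
Qed.

Lemma bdry_continuous_sides g x y w v : 0 <= w -> 0 <= v ->
  bdry_continuous g x y w v ->
  [/\ contC (fun t => g (t +i* y)%C) x (x + w),
      contC (fun t => g ((x + w) +i* t)%C) y (y + v),
      contC (fun t => g (t +i* (y + v))%C) x (x + w) &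
      contC (fun t => g (x +i* t)%C) y (y + v)].
Proof.
move=> w0 v0 cg; split.
- by apply: contC_horizontal => t xt; apply: cg; exact: bdry_bottom.
- by apply: contC_vertical => t yt; apply: cg; exact: bdry_right.
- by apply: contC_horizontal => t xt; apply: cg; exact: bdry_top.
- by apply: contC_vertical => t yt; apply: cg; exact: bdry_left.
Qed.

Lemma contour_hsplit g x y w1 w2 v : 0 <= w1 -> 0 <= w2 -> 0 <= v ->
  bdry_continuous g x y (w1 + w2) v ->
  contour g x y (w1 + w2) v = contour g x y w1 v + contour g (x + w1) y w2 v.
Proof.
move=> w10 w20 v0 cg; rewrite /contour.
have [bottom _ top _] := bdry_continuous_sides (addr_ge0 w10 w20) v0 cg.
have left_le : x <= x + w1 by lra.
have le_right : x + w1 <= x + (w1 + w2) by lra.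
rewrite (intC_split left_le le_right bottom) (intC_split left_le le_right top).
by rewrite addrA; ring.
Qed.

Lemma contour_vsplit g x y w v1 v2 : 0 <= w -> 0 <= v1 -> 0 <= v2 ->
  bdry_continuous g x y w (v1 + v2) ->
  contour g x y w (v1 + v2) = contour g x y w v1 + contour g x (y + v1) w v2.
Proof.
move=> w0 v10 v20 cg; rewrite /contour.
have [_ right _ left] := bdry_continuous_sides w0 (addr_ge0 v10 v20) cg.
have bottom_le : y <= y + v1 by lra.
have le_top : y + v1 <= y + (v1 + v2) by lra.
rewrite (intC_split bottom_le le_top right) (intC_split bottom_le le_top left).
by rewrite addrA; ring.
Qed.

Lemma contourD g h x y w v : 0 <= w -> 0 <= v ->
  bdry_continuous g x y w v -> bdry_continuous h x y w v ->
  contour (fun z => g z + h z) x y w v = contour g x y w v + contour h x y w v.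
Proof.
move=> w0 v0 /(bdry_continuous_sides w0 v0)[g_bottom g_right g_top g_left].
move=> /(bdry_continuous_sides w0 v0)[h_bottom h_right h_top h_left]; rewrite /contour.
by rewrite (intCD g_bottom h_bottom) (intCD g_right h_right) (intCD g_top h_top)
  (intCD g_left h_left); ring.
Qed.

Lemma contourZ k g x y w v : 0 <= w -> 0 <= v -> bdry_continuous g x y w v ->
  contour (fun z => k * g z) x y w v = k * contour g x y w v.
Proof.
move=> w0 v0 /(bdry_continuous_sides w0 v0)[g1 g2 g3 g4]; rewrite /contour.
by rewrite (intCZ k g1) (intCZ k g2) (intCZ k g3) (intCZ k g4); ring.
Qed.

Lemma contour_cabs_le g x y w v B : 0 <= w -> 0 <= v -> bdry_continuous g x y w v ->
  (forall z, bdry x y w v z -> cabs (g z) <= B) ->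
  cabs (contour g x y w v) <= 4 * B * (w + v).
Proof.
move=> w0 v0 /(bdry_continuous_sides w0 v0)[cb cr ct cl] gB.
have xw : x <= x + w by rewrite lerDl.
have yv : y <= y + v by rewrite lerDl.
have := intC_cabs_le xw cb (fun t xt => gB _ (bdry_bottom _ v0 xt)).
have := intC_cabs_le yv cr (fun t yt => gB _ (bdry_right _ w0 yt)).
have := intC_cabs_le xw ct (fun t xt => gB _ (bdry_top _ v0 xt)).
have := intC_cabs_le yv cl (fun t yt => gB _ (bdry_left _ w0 yt)).
rewrite [x + w - x]addrAC subrr add0r [y + v - y]addrAC subrr add0r.
move=> left top right bottom.
have triangle (p q r s : C) :
    cabs (p + 'i%C * q - r - 'i%C * s) <= cabs p + cabs q + cabs r + cabs s.
  rewrite (le_trans (cabsB_le _ _))// cabsM cabs_i mul1r lerD2r.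
  rewrite (le_trans (cabsB_le _ _))// lerD2r.
  by rewrite (le_trans (cabsD _ _))// cabsM cabs_i mul1r.
by rewrite /contour (le_trans (triangle _ _ _ _))//; lra.
Qed.

Lemma contour_affine (p q : C) x y w v : 0 <= w -> 0 <= v ->
  contour (fun z => p + q * z) x y w v = 0.
Proof.
move=> w0 v0; rewrite /contour.
have horizontal (s : R) : (fun t : R => p + q * (t +i* s)%C) =
    (fun t => (p + q * ('i%C * s%:C%C)) + q * t%:C%C).
  by apply/funext => t; rewrite -addrA -mulrDr; congr (_ + _ * _); complex_ring.
have vertical (s : R) : (fun t : R => p + q * (s +i* t)%C) =
    (fun t => (p + q * s%:C%C) + (q * 'i%C) * t%:C%C).
  apply/funext => t; rewrite -addrA -mulrA -mulrDr; congr (_ + _ * _).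
  by complex_ring.
have i2 : 'i%C * 'i%C = -1 :> C by rewrite -expr2 sqr_i.
rewrite !horizontal !vertical !intC_affine ?lerDl//.
rewrite (addrC x w) addrK (addrC y v) addrK (addrC v y) !rmorphD /= !mulrDr !mulrDl.
ring: i2.
Qed.

End Contour.

Section Goursat.
Variable R : realType.
Local Notation C := (R[i]).
Implicit Types (g : C -> C) (x y w v : R).

Lemma contour_quarters g x y w v : 0 < w -> 0 < v ->
  (forall z, rect x y w v z -> ccontinuous g z) ->
  contour g x y w v = \sum_(i : bool) \sum_(j : bool)
    contour g (x + i%:R * (w / 2)) (y + j%:R * (v / 2)) (w / 2) (v / 2).
Proof.
move=> w0 v0 cg; have w20 : 0 <= w / 2 by lra.
have v20 : 0 <= v / 2 by lra.
have sub x' w' : x <= x' -> x' + w' <= x + w -> bdry_continuous g x' y w' (v / 2 + v / 2).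
  move=> ? ? z [[/andP[? ?] /andP[? ?]] _]; apply: cg; split; lra.
rewrite !big_bool /= !mul0r !mul1r !addr0.
rewrite [RHS]addrC -[in RHS](addrC (contour g x y _ _)).
rewrite -[in RHS](addrC (contour g (x + w / 2) y _ _)).
rewrite -!contour_vsplit//; first last.
- by apply: sub; lra.
- by apply: sub; lra.
rewrite -splitr -contour_hsplit ?(ltW v0) -?splitr// => z [rz _].
exact: cg.
Qed.

Lemma contour_near_cderiv g p l e : has_cderiv g p l -> 0 < e ->
  exists d, 0 < d /\ forall x y w v, 0 < w -> 0 < v -> w < d -> v < d ->
    rect x y w v p -> (forall z, rect x y w v z -> ccontinuous g z) ->
    cabs (contour g x y w v) <= e * (w + v) ^+ 2.
Proof.
move=> /has_cderivP dg e0; have [|d [d0 taylor]] := dg (e / 4); first by lra.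
exists (d / 2); split=> [|x y w v w0 v0 wd vd rp cg]; first by lra.
pose affine z := (g p - l * p) + l * z.
pose remainder z := g z + (-1) * affine z.
have cont_affine z : ccontinuous affine z.
  apply: ccontinuousD; first exact: ccontinuous_cst.
  by apply: ccontinuousM; [exact: ccontinuous_cst|exact: ccontinuous_id].
have cont_remainder : bdry_continuous remainder x y w v.
  move=> z [rz _]; apply: ccontinuousD; first exact: cg.
  by apply: ccontinuousM; [exact: ccontinuous_cst|].
have -> : contour g x y w v = contour remainder x y w v.
  have -> : g = (fun z => remainder z + affine z).
    by apply/funext => z; rewrite /remainder; ring.
  rewrite (contourD (ltW w0) (ltW v0) cont_remainder (fun z _ => cont_affine z)).
  by rewrite [contour affine _ _ _ _]contour_affine ?addr0 ?ltW.
have -> : e * (w + v) ^+ 2 = 4 * (e / 4 * (w + v)) * (w + v) by field.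
apply: contour_cabs_le; rewrite ?(ltW w0) ?(ltW v0)// => z [rz _].
have zp : cabs (z - p) <= w + v.
  apply: (le_trans (cabs_le_ReIm _)); rewrite cReB cImB.
  move: rz rp => [/andP[? ?] /andP[? ?]] [/andP[? ?] /andP[? ?]].
  by apply: lerD; rewrite ler_norml; lra.
have -> : remainder z = g z - g p - l * (z - p) by rewrite /remainder /affine; ring.
apply: (le_trans (taylor z _)); first by rewrite (le_lt_trans zp)//; lra.
by rewrite ler_wpM2l//; lra.
Qed.

Lemma goursat g x0 y0 w0 v0 : 0 < w0 -> 0 < v0 ->
  (forall z, rect x0 y0 w0 v0 z -> cderivable g z) ->
  contour g x0 y0 w0 v0 = 0.
Proof.
move=> w00 v00 dg.
have cg z : rect x0 y0 w0 v0 z -> ccontinuous g z by move=> /dg/cderivable_ccontinuous.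
suff contour_le e : 0 < e -> cabs (contour g x0 y0 w0 v0) <= e * (w0 * v0).
  apply/eqP; rewrite -cabs_eq0 eq_le cabs_ge0 andbT.
  apply/ler_addgt0Pr => e e0; rewrite add0r.
  have wv0 : 0 < w0 * v0 by rewrite mulr_gt0.
  by rewrite (le_trans (contour_le _ (divr_gt0 e0 wv0)))// divfK// gt_eqF.
move=> e0; apply: (@rect_induction _ (fun x y w v =>
  cabs (contour g x y w v) <= e * (w * v))) => // [x y w v w_gt0 v_gt0 sub quarter|].
  rewrite contour_quarters// => [|z /sub/cg//].
  have := (quarter false false, quarter false true, quarter true false, quarter true true).
  rewrite !big_bool /=.
  set q00 := contour _ _ _ _ _; set q01 := contour _ _ _ _ _.
  set q10 := contour _ _ _ _ _; set q11 := contour _ _ _ _ _.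
  move=> [[[le_q00 le_q01] le_q10] le_q11]; apply: (le_trans (cabsD _ _)).
  have := cabsD q11 q10; have := cabsD q01 q00.
  by rewrite (_ : w / 2 * (v / 2) = w * v / 4) in le_q11 le_q10 le_q01 le_q00; [lra|field].
move=> p rp; pose ratio := v0 / w0.
have ratio0 : 0 < ratio by rewrite divr_gt0.
pose e' := e * ratio / (1 + ratio) ^+ 2.
have e'0 : 0 < e' by apply: divr_gt0; [exact: mulr_gt0|rewrite exprn_gt0// addr_gt0].
have [d [d0 small]] := contour_near_cderiv (cderivableP (dg p rp)) e'0.
exists d; split=> // x y w v w_gt0 v_gt0 sub wd vd aspect rxp.
apply: (le_trans (small _ _ _ _ w_gt0 v_gt0 wd vd rxp _)) => [z /sub/cg//|].
have -> : v = w * ratio by rewrite /ratio mulrA -aspect mulfK// gt_eqF.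
by rewrite le_eqVlt; apply/orP; left; apply/eqP; rewrite /e'; field; lra.
Qed.

End Goursat.

(** * Maximum principle *)

Lemma le_of_exprn_le (R : realType) (x y K : R) : 0 <= x -> 0 <= y -> 0 <= K ->
  (forall n, x ^+ n <= K * y ^+ n) -> x <= y.
Proof.
move=> x0 y0 K0 xyn; rewrite leNgt; apply/negP => yx.
have x_gt0 : 0 < x by exact: le_lt_trans yx.
have ratio_lt1 : `|y / x| < 1 by rewrite ger0_norm ?divr_ge0// ltr_pdivrMr// mul1r.
have K1 : 0 < (K + 1)^-1 by rewrite invr_gt0 ltr_wpDl.
have /cvgr_lt/(_ _ K1)[N _ /(_ N (leqnn N))/=] := cvg_expr ratio_lt1.
rewrite expr_div_n ltr_pdivrMr ?exprn_gt0// mulrC ltr_pdivlMr ?ltr_wpDl//.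
have := xyn N; have : 0 <= y ^+ N by rewrite exprn_ge0.
by lra.
Qed.

Section Square.
Variable R : realType.
Local Notation C := (R[i]).
Implicit Types (g : C -> C) (z w : C) (x y s v h k B : R).

Definition csquare z h : set C :=
  rect (complex.Re z - h) (complex.Im z - h) (h + h) (h + h).

Definition csquare_bdry z h : set C :=
  bdry (complex.Re z - h) (complex.Im z - h) (h + h) (h + h).

Definition csquare_contour g z h : C :=
  contour g (complex.Re z - h) (complex.Im z - h) (h + h) (h + h).

Lemma csquare_center z h : 0 <= h -> csquare z h z.
Proof. by move=> h0; split; lra. Qed.

Lemma csquare_le z h w : csquare z h w -> cabs (w - z) <= h + h.
Proof.
move=> [/andP[? ?] /andP[? ?]]; apply: (le_trans (cabs_le_ReIm _)).
by rewrite cReB cImB; apply: lerD; rewrite ler_norml; lra.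
Qed.

Lemma csquare_bdry_ge z h w : csquare_bdry z h w -> h <= cabs (w - z).
Proof.
have le_normP (t : R) : h <= - t \/ h <= t -> h <= `|t|.
  by case=> ht; rewrite (le_trans ht)// ?ler_norm// -normrN ler_norm.
case=> _ [] side.
- by apply: le_trans (Re_le_cabs _); apply: le_normP; rewrite cReB side; left; lra.
- by apply: le_trans (Re_le_cabs _); apply: le_normP; rewrite cReB side; right; lra.
- by apply: le_trans (Im_le_cabs _); apply: le_normP; rewrite cImB side; left; lra.
- by apply: le_trans (Im_le_cabs _); apply: le_normP; rewrite cImB side; right; lra.
Qed.

Lemma csquare_bdry_neq z h w : 0 < h -> csquare_bdry z h w -> w != z.
Proof. by move=> h0 /csquare_bdry_ge hw; rewrite -cabs_subr_gt0; lra. Qed.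

Lemma csquare_bdry_nonempty z h : 0 < h -> csquare_bdry z h !=set0.
Proof.
move=> h0; exists ((complex.Re z - h) +i* complex.Im z)%C.
by split; [split=> /=; lra|apply: Or41].
Qed.

Lemma contour_htrim g x y s1 (w : R) s2 v : 0 < s1 -> 0 < w -> 0 < s2 -> 0 < v ->
  (forall z, rect x y s1 v z -> cderivable g z) ->
  (forall z, rect (x + s1 + w) y s2 v z -> cderivable g z) ->
  bdry_continuous g x y (s1 + (w + s2)) v ->
  contour g x y (s1 + (w + s2)) v = contour g (x + s1) y w v.
Proof.
move=> s10 w0 s20 v0 dleft dright cg; rewrite contour_hsplit//; [|lra|lra|lra].
rewrite goursat// add0r contour_hsplit ?(ltW w0) ?(ltW s20) ?(ltW v0)//.
  by rewrite [X in _ + X]goursat// addr0.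
move=> z [[/andP[? ?] rIm] side]; have /andP[? ?] := rIm.
have [left|inner] := leP (complex.Re z) (x + s1).
  by apply/cderivable_ccontinuous/dleft; split=> //; lra.
apply: cg; split; first by split=> //; lra.
by case: side => side; [lra|apply: Or42; lra|exact: Or43|exact: Or44].
Qed.

Lemma contour_vtrim g x y (w : R) s1 v s2 : 0 < w -> 0 < s1 -> 0 < v -> 0 < s2 ->
  (forall z, rect x y w s1 z -> cderivable g z) ->
  (forall z, rect x (y + s1 + v) w s2 z -> cderivable g z) ->
  bdry_continuous g x y w (s1 + (v + s2)) ->
  contour g x y w (s1 + (v + s2)) = contour g x (y + s1) w v.
Proof.
move=> w0 s10 v0 s20 dbottom dtop cg; rewrite contour_vsplit//; [|lra|lra|lra].
rewrite goursat// add0r contour_vsplit ?(ltW v0) ?(ltW s20) ?(ltW w0)//.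
  by rewrite [X in _ + X]goursat// addr0.
move=> z [[rRe /andP[? ?]] side]; have /andP[? ?] := rRe.
have [bottom|inner] := leP (complex.Im z) (y + s1).
  by apply/cderivable_ccontinuous/dbottom; split=> //; lra.
apply: cg; split; first by split=> //; lra.
by case: side => side; [exact: Or41|exact: Or42|lra|apply: Or44; lra].
Qed.

Lemma csquare_contour_shrink g z h k : 0 < k -> k < h ->
  (forall w, csquare z h w -> w != z -> cderivable g w) ->
  csquare_contour g z h = csquare_contour g z k.
Proof.
move=> k0 kh dg; rewrite /csquare_contour.
set a := complex.Re z; set b := complex.Im z.
have off_center w : csquare z h w -> complex.Re w != a \/ complex.Im w != b ->
    cderivable g w.
  move=> zw neq; apply: dg => //; apply/eqP => wz; move: neq.
  by rewrite wz !eqxx; case.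
have recenter s : s - h + (h - k) = s - k by ring.
have trim : h + h = (h - k) + ((k + k) + (h - k)) by ring.
rewrite [in X in contour _ _ _ X _]trim contour_htrim; [|lra|lra|lra|lra| | |].
- rewrite [in X in contour _ _ _ _ X]trim contour_vtrim; [|lra|lra|lra|lra| | |].
  + by rewrite !recenter.
  + move=> w [/andP[? ?] /andP[? ?]]; apply: off_center; first by split; lra.
    by right; apply/eqP; lra.
  + move=> w [/andP[? ?] /andP[? ?]]; apply: off_center; first by split; lra.
    by right; apply/eqP; lra.
  + move=> w [[/andP[? ?] /andP[? ?]] side]; apply/cderivable_ccontinuous/off_center.
      by split; lra.
    by case: side => side; [left|left|right|right]; apply/eqP; lra.
- move=> w [/andP[? ?] rIm]; apply: off_center; first by split=> //; lra.
  by left; apply/eqP; lra.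
- move=> w [/andP[? ?] rIm]; apply: off_center; first by split=> //; lra.
  by left; apply/eqP; lra.
- move=> w [[/andP[? ?] /andP[? ?]] side]; apply/cderivable_ccontinuous/off_center.
    by split; lra.
  by case: side => side; [left|left|right|right]; apply/eqP; lra.
Qed.

Definition slope g z w : C := (g w - g z) * (w - z)^-1.

Lemma cderivable_slope g z w : w != z -> cderivable g w -> cderivable (slope g z) w.
Proof.
move=> wz dg; apply: cderivableM (cderivable_subrV wz).
by apply: cderivableB dg _; exact: cderivable_cst.
Qed.

Lemma slope_bounded_near g z : cderivable g z -> exists L d, [/\ 0 < L, 0 < d &
  forall w, w != z -> cabs (w - z) < d -> cabs (slope g z w) <= L].
Proof.
move=> /cderivableP/has_cderivP/(_ 1 ltr01)[d [d0 taylor]].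
exists (cabs (cderiv g z) + 1), d; split=> // [|w wz /taylor].
  by rewrite ltr_wpDl ?cabs_ge0.
have wz0 : 0 < cabs (w - z) by rewrite cabs_subr_gt0.
rewrite /slope cabsM cabsV ler_pdivrMr// mul1r => remainder_le.
have := cabsD (g w - g z - cderiv g z * (w - z)) (cderiv g z * (w - z)).
by rewrite subrK cabsM mulrDl mul1r; lra.
Qed.

Lemma csquare_contour_slope g z h : 0 < h ->
  (forall w, csquare z h w -> cderivable g w) ->
  csquare_contour (slope g z) z h = 0.
Proof.
move=> h0 dg; have dslope w : csquare z h w -> w != z -> cderivable (slope g z) w.
  by move=> /dg ? ?; exact: cderivable_slope.
have [L [d [L0 d0 slope_le]]] := slope_bounded_near (dg z (csquare_center z (ltW h0))).
apply/eqP; rewrite -cabs_eq0 eq_le cabs_ge0 andbT.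
apply/ler_addgt0Pr => e e0; rewrite add0r.
have [||r [r0 rh re]] := @exists_pos_le2 R (h / 2) (e / (16 * L)).
- by rewrite divr_gt0.
- by rewrite divr_gt0 ?mulr_gt0.
have [|k [k0 kr kd]] := @exists_pos_le2 R r (d / 3) r0; first by rewrite divr_gt0.
have kh : k < h by lra.
have sub w : csquare_bdry z k w -> csquare z h w.
  by move=> [[/andP[? ?] /andP[? ?]] _]; split; lra.
rewrite (csquare_contour_shrink k0 kh dslope).
apply: (@le_trans _ _ (4 * L * (k + k + (k + k)))).
  apply: contour_cabs_le => [|||w bw]; [lra|lra| |].
    move=> w bw; apply/cderivable_ccontinuous/dslope; first exact: sub.
    exact: csquare_bdry_neq bw.
  apply: slope_le; first exact: csquare_bdry_neq bw.
  by have := csquare_le bw.1; lra.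
by move: re; rewrite ler_pdivlMr ?mulr_gt0//; nra.
Qed.

Lemma contR_poisson a h c1 c2 : 0 < h -> contR (fun t => h / ((t - a) ^+ 2 + h ^+ 2)) c1 c2.
Proof.
move=> h0 t _; have hh0 : 0 < h ^+ 2 by rewrite exprn_gt0.
apply: cvgM; first exact: cvg_cst.
apply: cvgV; first by rewrite gt_eqF// ltr_wpDl ?sqr_ge0.
apply: cvgD; last exact: cvg_cst.
by apply: cvgM; apply: cvgB (cvg_cst _); exact: cvg_id.
Qed.

Lemma intR_poisson_ge a h : 0 < h ->
  1 <= intR (fun t => h / ((t - a) ^+ 2 + h ^+ 2)) (a - h) (a + h).
Proof.
move=> h0; have hh0 : 0 < h ^+ 2 by rewrite exprn_gt0.
have -> : 1 = (h + h)^-1 * (a + h - (a - h)).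
  by rewrite (_ : a + h - (a - h) = h + h) ?mulVf ?gt_eqF ?addr_gt0//; ring.
apply: intR_ge => [||t tah]; first by lra.
  exact: contR_poisson.
rewrite -[leLHS]mul1r ler_pdivlMr ?ltr_wpDl ?sqr_ge0//.
by rewrite mulrAC mul1r ler_pdivrMr; nra.
Qed.

Lemma Im_csquare_contour_subrV z h : 0 < h ->
  4 <= complex.Im (csquare_contour (fun w => (w - z)^-1) z h).
Proof.
case: z => a b h0; pose poisson m t := h / ((t - m) ^+ 2 + h ^+ 2).
have width c : c - h + (h + h) = c + h by ring.
have ReV (x y : R) : complex.Re ((x +i* y)%C : C)^-1 = x / (x ^+ 2 + y ^+ 2) by [].
have ImV (x y : R) : complex.Im ((x +i* y)%C : C)^-1 = - (y / (x ^+ 2 + y ^+ 2)) by [].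
have diff (x y : R) : ((x +i* y)%C - (a +i* b)%C : C) = ((x - a) +i* (y - b))%C.
  by complex_ring.
rewrite /csquare_contour /contour -[complex.Re (a +i* b)%C]/a -[complex.Im (a +i* b)%C]/b.
rewrite !width !cImB cImD !cImM /= !mul0r !add0r !mul1r.
have -> : (fun t => complex.Im ((t +i* (b - h))%C - (a +i* b)%C)^-1) = poisson a.
  by apply/funext => t; rewrite diff ImV addrAC subrr add0r mulNr opprK sqrrN.
have -> : (fun t => complex.Re (((a + h) +i* t)%C - (a +i* b)%C)^-1) = poisson b.
  by apply/funext => t; rewrite diff ReV addrAC subrr add0r [h ^+ 2 + _]addrC.
have -> : (fun t => complex.Im ((t +i* (b + h))%C - (a +i* b)%C)^-1) =
    (fun t => -1 * poisson a t).
  by apply/funext => t; rewrite diff ImV addrAC subrr add0r mulN1r.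
have -> : (fun t => complex.Re (((a - h) +i* t)%C - (a +i* b)%C)^-1) =
    (fun t => -1 * poisson b t).
  apply/funext => t; rewrite diff ReV addrAC subrr add0r mulN1r sqrrN mulNr.
  by rewrite [h ^+ 2 + _]addrC.
rewrite !(@intRZ _ (-1)); try exact: contR_poisson.
have : 1 <= intR (poisson a) (a - h) (a + h) := intR_poisson_ge a h0.
have : 1 <= intR (poisson b) (b - h) (b + h) := intR_poisson_ge b h0.
by lra.
Qed.

Lemma csquare_cauchy_le g z h B : 0 < h ->
  (forall w, csquare z h w -> cderivable g w) ->
  (forall w, csquare_bdry z h w -> cabs (g w) <= B) ->
  cabs (g z) <= 4 * B.
Proof.
move=> h0 dg gB; pose kernel w : C := (w - z)^-1.
have hh0 : 0 <= h + h by lra.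
have B0 : 0 <= B.
  by have [w /gB] := csquare_bdry_nonempty z h0; apply: le_trans; exact: cabs_ge0.
have cg w : csquare_bdry z h w -> ccontinuous g w.
  by move=> [/dg/cderivable_ccontinuous].
have ckernel w : csquare_bdry z h w -> ccontinuous kernel w.
  by move=> /(csquare_bdry_neq h0)/ccontinuous_subrV.
have cslope w : csquare_bdry z h w -> ccontinuous (slope g z) w.
  move=> bw; apply/cderivable_ccontinuous/cderivable_slope; last exact: dg bw.1.
  exact: csquare_bdry_neq bw.
have splitting : csquare_contour (fun w => g w * kernel w) z h =
    g z * csquare_contour kernel z h.
  have -> : (fun w => g w * kernel w) = (fun w => slope g z w + g z * kernel w).
    by apply/funext => w; rewrite /slope /kernel; ring.
  have cscaled w : csquare_bdry z h w -> ccontinuous (fun w => g z * kernel w) w.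
    by move=> bw; apply: ccontinuousM; [exact: ccontinuous_cst|exact: ckernel].
  rewrite /csquare_contour (contourD hh0 hh0 cslope cscaled) (contourZ _ hh0 hh0 ckernel).
  by rewrite -/(csquare_contour _ z h) csquare_contour_slope// add0r.
have : cabs (csquare_contour (fun w => g w * kernel w) z h) <=
    4 * (B / h) * (h + h + (h + h)).
  apply: (contour_cabs_le hh0 hh0) => w bw.
    by apply: ccontinuousM; [exact: cg|exact: ckernel].
  rewrite cabsM cabsV; apply: ler_pM; rewrite ?invr_ge0 ?cabs_ge0 ?gB//.
  by rewrite lef_pV2 ?posrE ?(csquare_bdry_ge bw)// cabs_subr_gt0 (csquare_bdry_neq h0 bw).
rewrite splitting cabsM (_ : 4 * (B / h) * (h + h + (h + h)) = 16 * B); last by field; lra.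
have := Im_csquare_contour_subrV z h0; rewrite -/kernel => Im_ge.
have := le_trans (ler_norm _) (Im_le_cabs (csquare_contour kernel z h)).
by have := cabs_ge0 (g z); nra.
Qed.

Lemma csquare_max g z h B : 0 < h ->
  (forall w, csquare z h w -> cderivable g w) ->
  (forall w, csquare_bdry z h w -> cabs (g w) <= B) ->
  cabs (g z) <= B.
Proof.
move=> h0 dg gB.
have B0 : 0 <= B.
  by have [w /gB] := csquare_bdry_nonempty z h0; apply: le_trans; exact: cabs_ge0.
apply: (@le_of_exprn_le _ _ _ 4); rewrite ?cabs_ge0// => n.
rewrite -cabsX; apply: (@csquare_cauchy_le (fun w => g w ^+ n) _ h _ h0) => w.
  by move=> /dg; exact: cderivableX.
by move=> /gB gwB; rewrite cabsX lerXn2r ?nnegrE ?cabs_ge0.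
Qed.

End Square.

Section MaxPrinciple.
Variable R : realType.
Local Notation C := (R[i]).
Implicit Types (W : set C) (g : C -> C) (c B D : R).

(* Lagrange's identity, i.e. the equality case of the Cauchy-Schwarz inequality
   for the vectors (sqrt c, z0) and (sqrt c, z). *)
Lemma sqr_cabs_weight c (z0 z : C) :
  cabs (c%:C%C + (z0^*)%C * z) ^+ 2 =
  (c + cabs z0 ^+ 2) * (c + cabs z ^+ 2) - c * cabs (z - z0) ^+ 2.
Proof. by case: z0 z => [a b] [x y]; rewrite !sqr_cabs /=; ring. Qed.

(* At a nonzero weighted maximum z0, multiplying g by c + conj z0 * z would turn
   z0 into a strict maximum on the square. *)
Lemma weighted_max_eq0 g (z0 : C) h c : 0 < h -> 0 < c ->
  (forall z, csquare z0 h z -> cderivable g z) ->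
  (forall z, csquare z0 h z ->
    cabs (g z) ^+ 2 * (c + cabs z ^+ 2) <= cabs (g z0) ^+ 2 * (c + cabs z0 ^+ 2)) ->
  g z0 = 0.
Proof.
move=> h0 c0 dg gmax; set weight := c + cabs z0 ^+ 2 in gmax.
pose twist z := c%:C%C + (z0^*)%C * z.
pose D := cabs z0 + (h + h); pose gap := c * h ^+ 2 / (c + D ^+ 2).
have weight0 : 0 < weight by rewrite ltr_wpDr ?sqr_ge0.
have gap0 : 0 < gap by rewrite divr_gt0 ?mulr_gt0 ?exprn_gt0// ltr_wpDr ?sqr_ge0.
have cD0 : 0 < c + D ^+ 2 by rewrite ltr_wpDr ?sqr_ge0.
have gap_c : gap <= c.
  have hD : h <= D by rewrite /D; have := cabs_ge0 z0; lra.
  rewrite /gap ler_pdivrMr// ler_pM2l//.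
  have : h ^+ 2 <= D ^+ 2 by rewrite lerXn2r ?nnegrE ?(le_trans _ hD) ?(ltW h0).
  lra.
have gap_le z : csquare z0 h z -> h <= cabs (z - z0) ->
    gap * (c + cabs z ^+ 2) <= c * cabs (z - z0) ^+ 2.
  move=> /csquare_le zz0 zh.
  have zD : cabs z <= D by have := cabsB_ge z z0; rewrite /D; lra.
  apply: (@le_trans _ _ (gap * (c + D ^+ 2))).
    rewrite ler_pM2l// lerD2l lerXn2r ?nnegrE ?cabs_ge0//.
    by rewrite (le_trans (cabs_ge0 z)).
  rewrite /gap divfK ?gt_eqF// ler_pM2l// lerXn2r ?nnegrE ?cabs_ge0//.
  exact: ltW.
have := @csquare_max _ (fun z => (g z * twist z) ^+ 2) z0 h
  (cabs (g z0) ^+ 2 * weight * (weight - gap)) h0.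
rewrite cabsX cabsM exprMn sqr_cabs_weight subrr cabs0 expr0n mulr0 subr0 -/weight.
move=> /(_ _ _)le_center; apply/eqP; rewrite -cabs_eq0 -sqrf_eq0 eq_le sqr_ge0 andbT.
have : cabs (g z0) ^+ 2 * (weight * weight) <= cabs (g z0) ^+ 2 * weight * (weight - gap).
  apply: le_center => z zsq.
    apply: cderivableX; apply: cderivableM; first exact: dg.
    apply: cderivableD; first exact: cderivable_cst.
    by apply: cderivableM; [exact: cderivable_cst|exact: cderivable_id].
  have [/gmax le_max zh] := (zsq.1, csquare_bdry_ge zsq).
  rewrite cabsX cabsM exprMn sqr_cabs_weight -/weight.
  apply: (@le_trans _ _ (cabs (g z) ^+ 2 * (c + cabs z ^+ 2) * (weight - gap))).
    rewrite -mulrA ler_wpM2l ?sqr_ge0//; have := gap_le z zsq.1 zh; lra.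
  by rewrite ler_wpM2r// subr_ge0 (le_trans gap_c)// lerDl sqr_ge0.
have [//|g0] := leP (cabs (g z0) ^+ 2) 0; have := mulr_gt0 g0 (mulr_gt0 weight0 gap0).
lra.
Qed.

Lemma closure_bounded W D : (forall z, W z -> cabs z <= D) ->
  forall z, closure (W : set C^o) z -> cabs z <= D.
Proof.
move=> WD z.
exact: (@closure_sub_preimage R _ _ W (@cabs_continuous R) (@closed_le R D) WD z).
Qed.

Lemma max_principle_regular W g B D :
  copen W -> (forall z, W z -> cabs z <= D) ->
  (forall z, closure (W : set C^o) z -> ccontinuous g z) ->
  (forall z, W z -> cderivable g z) -> 0 <= B ->
  (forall z, closure (W : set C^o) z -> ~ W z -> cabs (g z) <= B) ->
  forall z, W z -> cabs (g z) <= B.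
Proof.
move=> Wo WD cg dg B0 gB z1 Wz1; rewrite leNgt; apply/negP => Bgz1.
have clD := closure_bounded WD; have clz1 := @subset_closure C^o W z1 Wz1.
have gap0 : 0 < cabs (g z1) ^+ 2 - B ^+ 2.
  by rewrite subr_gt0 ltrXn2r ?nnegrE ?cabs_ge0.
pose c := (B * D) ^+ 2 / (cabs (g z1) ^+ 2 - B ^+ 2) + 1.
have c0 : 0 < c by rewrite ltr_wpDl ?divr_ge0 ?sqr_ge0// ltW.
have c_large : B ^+ 2 * (c + D ^+ 2) < c * cabs (g z1) ^+ 2.
  have : c * (cabs (g z1) ^+ 2 - B ^+ 2) = (B * D) ^+ 2 + (cabs (g z1) ^+ 2 - B ^+ 2).
    by rewrite /c mulrDl divfK ?gt_eqF// mul1r.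
  by move: gap0; rewrite exprMn; lra.
have [|z0 clz0 z0max] := closed_bounded_max (u := fun z => cabs (g z) ^+ 2 * (c + cabs z ^+ 2))
    (ex_intro _ z1 clz1) (@closed_closure C^o W) clD.
  move=> z /cg/ccontinuous_cabs cgz; have cz := @cabs_continuous R z.
  have continuous_sqr (v : C^o -> R) : {for z, continuous v} ->
      {for z, continuous (fun w => v w ^+ 2)} by move=> cv; exact: (@continuousM R C^o v v z).
  apply: (@continuousM R C^o (fun w => cabs (g w) ^+ 2)); first exact: continuous_sqr.
  apply: (@continuousD R R C^o (fun=> c) (fun w => cabs w ^+ 2)).
    exact: (@cst_continuous C^o R c z).
  exact: continuous_sqr.
have Wz0 : W z0.
  apply: contrapT => /(gB _ clz0) gz0; have := z0max z1 clz1; apply/negP; rewrite -ltNge.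
  apply: (@le_lt_trans _ _ (B ^+ 2 * (c + D ^+ 2))).
    apply: ler_pM; rewrite ?sqr_ge0 ?lerD2l//; first by rewrite addr_ge0 ?sqr_ge0// ltW.
      by rewrite lerXn2r ?nnegrE ?cabs_ge0.
    by rewrite lerXn2r ?nnegrE ?cabs_ge0 ?clD// (le_trans _ (clD _ clz0)) ?cabs_ge0.
  by rewrite (lt_le_trans c_large)// mulrC ler_wpM2l ?sqr_ge0// lerDl sqr_ge0.
have [r [r0 rW]] := Wo z0 Wz0.
have in_W z : csquare z0 (r / 4) z -> W z.
  by move=> /csquare_le zz0; apply: rW; rewrite /cball /=; lra.
have gz0 : g z0 = 0.
  apply: (@weighted_max_eq0 g z0 (r / 4) c _ c0); first by rewrite divr_gt0.
    by move=> z /in_W/dg.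
  by move=> z /in_W/(@subset_closure C^o); exact: z0max.
have := z0max z1 clz1; apply/negP; rewrite -ltNge gz0 cabs0 expr0n mul0r.
by rewrite mulr_gt0 ?exprn_gt0 ?(le_lt_trans B0 Bgz1)// ltr_wpDr ?sqr_ge0.
Qed.

(* Points where g is merely continuous are harmless: g^n * (z - p) is
   differentiable at p, and the factor z - p disappears as n grows. *)
Lemma max_principle (S : seq C) W g B D :
  copen W -> (forall z, W z -> cabs z <= D) ->
  (forall z, closure (W : set C^o) z -> ccontinuous g z) ->
  (forall z, W z -> z \notin S -> cderivable g z) -> 0 <= B ->
  (forall z, closure (W : set C^o) z -> ~ W z -> cabs (g z) <= B) ->
  forall z, W z -> cabs (g z) <= B.
Proof.
move=> Wo WD; have clD := closure_bounded WD.
elim: S g B => [|p S IH] g B cg dg B0 gB.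
  by apply: (max_principle_regular Wo WD cg _ B0 gB) => z Wz; exact: dg.
have off_p z : W z -> z != p -> cabs (g z) <= B.
  move=> Wz zp; have zp0 : 0 < cabs (z - p) by rewrite cabs_subr_gt0.
  have D0 : 0 <= D by exact: le_trans (cabs_ge0 z) (WD z Wz).
  have Dp0 : 0 <= D + cabs p by rewrite addr_ge0 ?cabs_ge0.
  apply: (@le_of_exprn_le _ _ _ ((D + cabs p) / cabs (z - p))); rewrite ?cabs_ge0//.
    by rewrite divr_ge0 ?cabs_ge0.
  move=> n; rewrite mulrAC ler_pdivlMr// -cabsX -cabsM.
  apply: (IH (fun z => g z ^+ n * (z - p))) Wz.
  - move=> v clv; apply: ccontinuousM; last exact: ccontinuous_subr.
    by apply: ccontinuousX; exact: cg.
  - move=> v Wv vS; have [vp|vp] := eqVneq v p.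
      rewrite vp; apply: (@cderivable_mul_root _ (fun z => g z ^+ n)).
      by apply/ccontinuousX/cg; rewrite -vp; exact: (@subset_closure C^o W v Wv).
    apply: cderivableM; last exact: cderivable_subr.
    by apply/cderivableX/dg => //; rewrite inE negb_or vp.
  - by rewrite mulr_ge0// exprn_ge0.
  - move=> v clv nWv; rewrite cabsM cabsX mulrC ler_pM ?exprn_ge0 ?cabs_ge0//.
      by rewrite (le_trans (cabsB_le _ _))// lerD2r clD.
    by rewrite lerXn2r ?nnegrE ?cabs_ge0 ?gB.
move=> z Wz; have [zp|] := eqVneq z p; last exact: off_p.
rewrite leNgt; apply/negP => Bz.
have /ccontinuousP/(_ (cabs (g z) - B)) := cg z (@subset_closure C^o W z Wz).
rewrite subr_gt0 => /(_ Bz)[d [d0 gd]].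
have [r [r0 Wr]] := Wo z Wz.
have [h [h0 hd hr]] := exists_pos_le2 d0 r0.
pose v := z + (h / 2)%:C%C.
have vz : cabs (v - z) = h / 2 by rewrite /v addrAC subrr add0r cabs_real ger0_norm//; lra.
have Wv : W v by apply: Wr; rewrite /cball /= vz; lra.
have vp : v != p by rewrite -zp -cabs_subr_gt0 vz; lra.
have : cabs (g v - g z) < cabs (g z) - B by apply: gd; rewrite vz; lra.
have := off_p v Wv vp; have := cabsB_ge (g z) (g v); rewrite cabs_distC; lra.
Qed.

Lemma annulus_open (p : C) (r1 r2 : R) : copen [set z | r1 < cabs (z - p) < r2].
Proof.
apply/copenE; rewrite (_ : mkset _ = (fun z : C^o => cabs (z - p)) @^-1` `]r1, r2[).
  by apply: open_comp => [z _|]; [exact: cabs_dist_continuous|exact: interval_open].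
by apply/seteqP; split=> z; rewrite /= in_itv.
Qed.

Lemma closure_annulus (p : C) (r1 r2 : R) z :
  closure ([set z | r1 < cabs (z - p) < r2] : set C^o) z -> r1 <= cabs (z - p) <= r2.
Proof.
move=> clz; have dist_in w : r1 < cabs (w - p) < r2 -> cabs (w - p) \in `[r1, r2].
  by move=> /andP[/ltW r1w /ltW wr2]; rewrite in_itv /= r1w.
have itv_closed : closed [set` `[r1, r2]] by exact: interval_closed.
have := @closure_sub_preimage R _ _ _ (@cabs_dist_continuous R p) itv_closed dist_in z clz.
by rewrite /= in_itv.
Qed.

(* The part of U lying in a large annulus around p: on its outer circle g^n / (z - p)
   is small because of the division by z - p. *)
Lemma annulus_quotient_le (U : set C) g (p z1 : C) L B d r n :
  copen U -> 0 < L -> 0 < d -> B ^+ n * d / L ^+ n <= r ->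
  (forall z, closure (U : set C^o) z -> ccontinuous g z) ->
  (forall z, U z -> cderivable g z) ->
  (forall z, U z -> cabs (g z) <= B) ->
  (forall z, closure (U : set C^o) z -> ~ U z \/ cabs (z - p) = d -> cabs (g z) <= L) ->
  U z1 -> d < cabs (z1 - p) < r -> cabs (g z1 ^+ n * (z1 - p)^-1) <= L ^+ n / d.
Proof.
move=> Uo L0 d0 r_large cg dg gB gL Uz1 z1r; have Ln : 0 < L ^+ n by rewrite exprn_gt0.
pose W := U `&` [set z | d < cabs (z - p) < r].
have Wo : copen W.
  by apply/copenE; apply: openI; apply/copenE => //; exact: annulus_open.
have clW z : closure (W : set C^o) z -> closure (U : set C^o) z /\ d <= cabs (z - p) <= r.
  move=> /(@closureI C^o)[clUz clz]; split=> //; exact: closure_annulus.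
have neq_p z : d <= cabs (z - p) -> z != p by move=> dz; rewrite -cabs_subr_gt0; lra.
apply: (@max_principle_regular W (fun z => g z ^+ n * (z - p)^-1) _ (cabs p + r) Wo).
- by move=> z [_ /andP[_ zr]]; have := cabsB_ge z p; lra.
- move=> z /clW[clz /andP[/neq_p zp _]].
  by apply: ccontinuousM; [apply/ccontinuousX/cg|exact: ccontinuous_subrV].
- move=> z [Uz /andP[/ltW/neq_p zp _]].
  by apply: cderivableM; [apply/cderivableX/dg|exact: cderivable_subrV].
- by rewrite divr_ge0// ltW.
- move=> z /clW[clz /andP[dz zr]] nWz; rewrite cabsM cabsV cabsX.
  have zp0 : 0 < cabs (z - p) by lra.
  have gz_small : cabs (g z) <= L -> cabs (g z) ^+ n / cabs (z - p) <= L ^+ n / d.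
    move=> gz; apply: ler_pM; rewrite ?exprn_ge0 ?invr_ge0 ?cabs_ge0//.
      by rewrite lerXn2r ?nnegrE ?cabs_ge0// ltW.
    by rewrite lef_pV2.
  have [Uz|nUz] := pselect (U z); last by apply/gz_small/gL => //; left.
  have [zd|zd] := eqVneq (cabs (z - p)) d; first by apply/gz_small/gL => //; right.
  have zr_eq : cabs (z - p) = r.
    apply/eqP; rewrite eq_le zr leNgt; apply/negP => zr_lt.
    by apply: nWz; split=> //=; rewrite lt_neqAle eq_sym zd dz.
  have gB0 : 0 <= B by exact: le_trans (cabs_ge0 _) (gB z Uz).
  rewrite ler_pdivrMr// (@le_trans _ _ (B ^+ n))//.
    by rewrite lerXn2r ?nnegrE ?cabs_ge0 ?gB.
  by move: r_large; rewrite zr_eq ler_pdivrMr// mulrAC ler_pdivlMr// [r * _]mulrC.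
- by split.
Qed.

(* Near the boundary point p the bound holds by continuity; elsewhere let n grow in
   the bound for g^n / (z - p). *)
Lemma phragmen_lindelof (U : set C) g K B (p : C) :
  copen U -> closure (U : set C^o) p -> ~ U p ->
  (forall z, closure (U : set C^o) z -> ccontinuous g z) ->
  (forall z, U z -> cderivable g z) ->
  (forall z, U z -> cabs (g z) <= B) -> 0 <= K ->
  (forall z, closure (U : set C^o) z -> ~ U z -> cabs (g z) <= K) ->
  forall z, U z -> cabs (g z) <= K.
Proof.
move=> Uo clp nUp cg dg gB K0 gK z1 Uz1; apply/ler_addgt0Pr => e e0.
have Ke0 : 0 < K + e by lra.
have B0 : 0 <= B by exact: le_trans (cabs_ge0 _) (gB z1 Uz1).
have [|d0 [d00 near_p]] := @ccontinuous_cabs_lt _ g p (K + e) (cg p clp).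
  by have := gK p clp nUp; lra.
have [/near_p/ltW//|far] := ltP (cabs (z1 - p)) d0.
pose d := d0 / 2; have d_gt0 : 0 < d by rewrite divr_gt0.
have dd0 : d < d0 by rewrite /d; lra.
apply: (@le_of_exprn_le _ _ _ (cabs (z1 - p) / d)); rewrite ?cabs_ge0 ?(ltW Ke0)//.
  by rewrite divr_ge0 ?cabs_ge0// ltW.
move=> n; pose r := cabs (z1 - p) + 1 + B ^+ n * d / (K + e) ^+ n.
have quot0 : 0 <= B ^+ n * d / (K + e) ^+ n.
  by rewrite divr_ge0 ?mulr_ge0 ?exprn_ge0// ltW.
have r_large : B ^+ n * d / (K + e) ^+ n <= r by rewrite lerDr addr_ge0 ?cabs_ge0.
have z1r : d < cabs (z1 - p) < r.
  by rewrite (lt_le_trans dd0 far) /r -addrA ltrDl ltr_wpDr.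
have gKe z : closure (U : set C^o) z -> ~ U z \/ cabs (z - p) = d -> cabs (g z) <= K + e.
  move=> clz [nUz|zd]; first by have := gK z clz nUz; lra.
  by apply/ltW/near_p; rewrite zd.
have := annulus_quotient_le Uo Ke0 d_gt0 r_large cg dg gB gKe Uz1 z1r.
rewrite cabsM cabsV cabsX ler_pdivrMr; last by lra.
by rewrite mulrAC [X in _ -> _ <= X]mulrC mulrA.
Qed.

End MaxPrinciple.

(** * Cauchy estimates on discs *)

Section DiscEstimates.
Variable R : realType.
Local Notation C := (R[i]).
Implicit Types (g : C -> C) (a x y z : C) (r s m B D : R).

Lemma min_principle (W : set C) g m D z0 :
  copen W -> (forall z, W z -> cabs z <= D) ->
  (forall z, closure (W : set C^o) z -> ccontinuous g z) ->
  (forall z, W z -> cderivable g z) -> 0 < m ->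
  (forall z, closure (W : set C^o) z -> ~ W z -> m <= cabs (g z)) ->
  W z0 -> cabs (g z0) < m -> exists z, W z /\ g z = 0.
Proof.
move=> Wo WD cg dg m0 gm Wz0 gz0; apply: contrapT => /forallNP no_zero.
have g_neq0 z : closure (W : set C^o) z -> g z != 0.
  move=> clz; have [Wz|/(gm _ clz)] := pselect (W z).
    by apply/eqP => gz; exact: (no_zero z).
  by rewrite -cabs_gt0; exact: lt_le_trans.
have sub := @subset_closure C^o W.
have : cabs (g z0)^-1 <= m^-1.
  apply: (@max_principle_regular _ W (fun z => (g z)^-1) m^-1 D Wo WD _ _ _ _ z0 Wz0).
  - by move=> z clz; apply: ccontinuousV; [exact: g_neq0|exact: cg].
  - by move=> z Wz; apply: cderivableV; [exact/g_neq0/sub|exact: dg].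
  - by rewrite invr_ge0 ltW.
  - by move=> z clz nWz; rewrite cabsV lef_pV2 ?posrE ?gm// cabs_gt0 g_neq0.
have gz0_gt0 : 0 < cabs (g z0) by rewrite cabs_gt0; exact/g_neq0/sub.
by rewrite cabsV lef_pV2 ?posrE// leNgt gz0.
Qed.

Lemma closure_cball a r z : closure (cball a r : set C^o) z -> cabs (z - a) <= r.
Proof.
have sub : cball a r `<=` (fun z : C^o => cabs (z - a)) @^-1` [set x | x <= r].
  by move=> w /ltW.
exact: (@closure_sub_preimage R _ _ _ (@cabs_dist_continuous R a) (@closed_le R r) sub z).
Qed.

Lemma cball_cabs_le a r z : cball a r z -> cabs z <= cabs a + r.
Proof. by rewrite /cball /= => zr; have := cabsB_ge z a; lra. Qed.

Lemma closure_cball_sphere a r z : closure (cball a r : set C^o) z ->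
  ~ cball a r z -> cabs (z - a) = r.
Proof.
move=> /closure_cball zr /negP; rewrite -leNgt => rz.
by apply/eqP; rewrite eq_le zr.
Qed.

Lemma disc_max (S : seq C) g a r B : 0 <= B ->
  (forall z, cabs (z - a) <= r -> ccontinuous g z) ->
  (forall z, cabs (z - a) < r -> z \notin S -> cderivable g z) ->
  (forall z, cabs (z - a) = r -> cabs (g z) <= B) ->
  forall z, cabs (z - a) <= r -> cabs (g z) <= B.
Proof.
move=> B0 cg dg gB z; rewrite le_eqVlt => /predU1P[|zr]; first exact: gB.
apply: (@max_principle _ S (cball a r) g B (cabs a + r) _ _ _ dg B0 _ _ zr).
- exact: cball_open.
- exact: cball_cabs_le.
- by move=> v /closure_cball; exact: cg.
- by move=> v clv /(closure_cball_sphere clv); exact: gB.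
Qed.

Lemma disc_zero g a r m z0 : 0 < m ->
  (forall z, cabs (z - a) <= r -> cderivable g z) ->
  (forall z, cabs (z - a) = r -> m <= cabs (g z)) ->
  cabs (z0 - a) < r -> cabs (g z0) < m -> exists z, cabs (z - a) < r /\ g z = 0.
Proof.
move=> m0 dg gm; apply: (@min_principle (cball a r) g m (cabs a + r)) m0 _.
- exact: cball_open.
- exact: cball_cabs_le.
- by move=> v /closure_cball/dg/cderivable_ccontinuous.
- by move=> v /ltW/dg.
- by move=> v clv /(closure_cball_sphere clv); exact: gm.
Qed.

Definition cslope g y x : C := if x == y then cderiv g y else slope g y x.

Lemma cslopexx g y : cslope g y y = cderiv g y.
Proof. by rewrite /cslope eqxx. Qed.

Lemma cslope_mul g y x : cslope g y x * (x - y) = g x - g y.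
Proof.
rewrite /cslope; case: eqVneq => [->|xy]; first by rewrite !subrr mulr0.
by rewrite mulfVK// subr_eq0.
Qed.

Lemma cslopeC g x y : cslope g x y = cslope g y x.
Proof.
rewrite /cslope eq_sym; case: eqVneq => [->//|_].
by rewrite /slope -(opprB (g x)) -(opprB x) invrN mulrNN.
Qed.

Lemma slope_cslope_near g y x : x != y -> exists r, 0 < r /\
  forall w, cabs (w - x) < r -> slope g y w = cslope g y w.
Proof.
move=> xy; exists (cabs (x - y)); rewrite cabs_subr_gt0; split=> // w.
by rewrite /cslope; case: eqVneq => // ->; rewrite cabs_distC ltxx.
Qed.

Lemma cderivable_cslope g y x : x != y -> cderivable g x -> cderivable (cslope g y) x.
Proof.
move=> xy dg; have [r [r0 near_x]] := slope_cslope_near g xy.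
exact: cderivable_ext r0 near_x (cderivable_slope xy dg).
Qed.

Lemma ccontinuous_cslopexx g y : cderivable g y -> ccontinuous (cslope g y) y.
Proof.
move=> /cderivableP/has_cderivP dg; apply/ccontinuousP => e e0.
have [|d [d0 taylor]] := dg (e / 2); first by rewrite divr_gt0.
exists d; split=> // w wd; rewrite cslopexx.
have [->|] := eqVneq w y; first by rewrite cslopexx subrr cabs0.
rewrite -cabs_subr_gt0 => wy; rewrite -(ltr_pM2r wy) -cabsM mulrBl cslope_mul.
by rewrite (le_lt_trans (taylor w wd))// ltr_pM2r//; lra.
Qed.

Lemma ccontinuous_cslope g y x : cderivable g y -> cderivable g x ->
  ccontinuous (cslope g y) x.
Proof.
move=> dy dx; have [->|xy] := eqVneq x y; first exact: ccontinuous_cslopexx.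
exact/cderivable_ccontinuous/cderivable_cslope.
Qed.

Section OnDisc.
Variables (g : C -> C) (a : C) (s B : R).
Hypotheses (s_gt0 : 0 < s) (B_ge0 : 0 <= B).
Hypothesis dg : forall z, cabs (z - a) <= s -> cderivable g z.
Hypothesis gB : forall z, cabs (z - a) <= s -> cabs (g z) <= B.

Let half_le y : cabs (y - a) <= s / 2 -> cabs (y - a) <= s.
Proof. by have := s_gt0; lra. Qed.

(* On the circle |z - a| = s the slope at a point y of the half disc is at most
   2 sup |h| / (s / 2); the maximum principle extends this to the disc. *)
Let disc_slope_le (S : seq C) (h : C -> C) (b : R) y x : 0 <= b ->
  cderivable h y -> (forall z, cabs (z - a) <= s -> ccontinuous h z) ->
  (forall z, cabs (z - a) < s -> z \notin S -> cderivable h z) ->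
  (forall z, cabs (z - a) <= s -> cabs (h z) <= b) ->
  cabs (y - a) <= s / 2 -> cabs (x - a) <= s -> cabs (cslope h y x) <= 4 * b / s.
Proof.
move: s_gt0 => s0 b0 dy ch dh hb ya.
apply: (@disc_max (y :: S) (cslope h y) a s).
- by rewrite divr_ge0 ?mulr_ge0// ltW.
- move=> z zs; have [->|zy] := eqVneq z y; first exact: ccontinuous_cslopexx.
  have [r [r0 near_z]] := slope_cslope_near h zy.
  apply: ccontinuous_ext r0 near_z _.
  apply: ccontinuousM; last exact: ccontinuous_subrV.
  by apply: ccontinuousB; [exact: ch|exact: ccontinuous_cst].
- by move=> z zs; rewrite inE negb_or => /andP[zy zS]; apply/cderivable_cslope/dh.
move=> z zs; have half : s / 2 <= cabs (z - y) by have := cabs_distD y z a; lra.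
have zy0 : 0 < cabs (z - y) by lra.
have /negbTE zy : z != y by rewrite -cabs_subr_gt0.
rewrite /cslope zy cabsM cabsV ler_pdivrMr// (@le_trans _ _ (2 * b))//.
  rewrite (le_trans (cabsB_le _ _))// mulr2n mulrDl !mul1r lerD ?hb ?zs//.
  exact: half_le.
by rewrite mulrAC ler_pdivlMr//; nra.
Qed.

Lemma disc_cslope_le y x : cabs (y - a) <= s / 2 -> cabs (x - a) <= s ->
  cabs (cslope g y x) <= 4 * B / s.
Proof.
move=> ya; have cg z : cabs (z - a) <= s -> ccontinuous g z.
  by move=> /dg/cderivable_ccontinuous.
apply: (disc_slope_le (S := [::]) B_ge0 (dg (half_le ya)) cg _ gB ya) => z /ltW zs _.
exact: dg.
Qed.

Lemma disc_lipschitz y x : cabs (y - a) <= s / 2 -> cabs (x - a) <= s ->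
  cabs (g x - g y) <= 4 * B / s * cabs (x - y).
Proof.
by move=> ya xa; rewrite -cslope_mul cabsM ler_wpM2r ?cabs_ge0// disc_cslope_le.
Qed.

Lemma disc_cderiv_le y : cabs (y - a) <= s / 2 -> cabs (cderiv g y) <= 4 * B / s.
Proof. by move=> ya; rewrite -cslopexx disc_cslope_le ?half_le. Qed.

Lemma disc_cslope_lipschitz y x x' : cabs (y - a) <= s / 2 ->
  cabs (x - a) <= s / 2 -> cabs (x' - a) <= s / 2 ->
  cabs (cslope g y x - cslope g y x') <= 16 * B / s ^+ 2 * cabs (x - x').
Proof.
move: s_gt0 => s0 ya; have yd := dg (half_le ya).
have bound0 : 0 <= 4 * B / s by rewrite divr_ge0 ?mulr_ge0// ltW.
have -> : 16 * B / s ^+ 2 = 4 * (4 * B / s) / s by field; rewrite gt_eqF.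
have lipschitz_off u v : u != y -> cabs (u - a) <= s / 2 -> cabs (v - a) <= s / 2 ->
    cabs (cslope g y v - cslope g y u) <= 4 * (4 * B / s) / s * cabs (v - u).
  move=> uy ua va; rewrite -cslope_mul cabsM ler_wpM2r ?cabs_ge0//.
  apply: (disc_slope_le (S := [:: y]) bound0 _ _ _ _ ua (half_le va)).
  - exact/cderivable_cslope/dg/half_le.
  - by move=> z /dg; exact: ccontinuous_cslope.
  - by move=> z /ltW/dg dz; rewrite inE => zy; exact: cderivable_cslope.
  - by move=> z; exact: disc_cslope_le.
move=> xa x'a; have [xy|xy] := eqVneq x' y; last exact: lipschitz_off.
have [->|xx'] := eqVneq x x'; first by rewrite !subrr cabs0 mulr0.
by rewrite cabs_distC (cabs_distC x); apply: lipschitz_off; rewrite // -xy.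
Qed.

Lemma disc_second_order x y : cabs (x - a) <= s / 2 -> cabs (y - a) <= s / 2 ->
  cabs (g x - g y - cderiv g a * (x - y)) <=
  16 * B / s ^+ 2 * (cabs (x - a) + cabs (y - a)) * cabs (x - y).
Proof.
move=> xa ya; rewrite -cslope_mul -mulrBl cabsM ler_wpM2r ?cabs_ge0//.
have aa : cabs (a - a) <= s / 2 by rewrite subrr cabs0 divr_ge0// ltW.
have -> : cslope g y x - cderiv g a =
    (cslope g y x - cslope g y a) + (cslope g a y - cslope g a a).
  by rewrite (cslopeC g a y) subrKA cslopexx.
rewrite (le_trans (cabsD _ _))// mulrDr lerD//; exact: disc_cslope_lipschitz.
Qed.

End OnDisc.

Lemma liouville g B : (forall z, cderivable g z) -> (forall z, cabs (g z) <= B) ->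
  forall z, g z = g 0.
Proof.
move=> dg gB z; have B0 : 0 <= B by exact: le_trans (cabs_ge0 _) (gB 0).
apply/eqP; rewrite -subr_eq0 -cabs_eq0 eq_le cabs_ge0 andbT.
apply/ler_addgt0Pr => e e0; rewrite add0r; have z0 := cabs_ge0 z.
have Bz0 : 0 <= 4 * B * cabs z by rewrite !mulr_ge0.
have Bze : 0 <= 4 * B * cabs z / e by rewrite divr_ge0// ltW.
pose s := 4 * B * cabs z / e + cabs z + 1; have s0 : 0 < s by rewrite /s; lra.
have := @disc_lipschitz g 0 s B s0 B0 (fun w _ => dg w) (fun w _ => gB w) 0 z.
rewrite subrr cabs0 !subr0 => lipschitz; apply: le_trans (lipschitz _ _) _.
- by rewrite divr_ge0// ltW.
- by rewrite /s; lra.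
rewrite mulrAC ler_pdivrMr// [leRHS]mulrC -ler_pdivrMr// /s; lra.
Qed.

Lemma cderiv_neq0_expanding g z r : 0 < r ->
  (forall w, cabs (w - z) < r -> cderivable g w) -> cderiv g z != 0 ->
  exists d L, [/\ 0 < d, 0 < L & forall x y, cabs (x - z) < d -> cabs (y - z) < d ->
    cabs (x - y) <= L * cabs (g x - g y)].
Proof.
move=> r0 dg; rewrite -cabs_gt0; set D := cabs (cderiv g z) => D0.
have cg : ccontinuous g z by apply/cderivable_ccontinuous/dg; rewrite subrr cabs0.
pose B := cabs (g z) + 1; have B0 : 0 < B by rewrite ltr_wpDl ?cabs_ge0.
have [|d [d0 g_near]] := ccontinuous_cabs_lt (B := B) cg; first by rewrite ltrDl.
have [r' [r'0 r'r r'd]] := exists_pos_le2 r0 d0.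
have [s [s0 sr sd]] : exists s, [/\ 0 < s, s < r & s < d].
  by exists (r' / 2); split; lra.
have [||e [e0 es eD]] := @exists_pos_le2 _ (s / 2) (D * s ^+ 2 / (64 * B)).
- by rewrite divr_gt0.
- by rewrite divr_gt0 ?mulr_gt0 ?exprn_gt0.
exists e, (2 / D); split=> // [|x y xe ye]; first by rewrite divr_gt0.
have : cabs (g x - g y - cderiv g z * (x - y)) <=
    16 * B / s ^+ 2 * (cabs (x - z) + cabs (y - z)) * cabs (x - y).
  apply: (disc_second_order s0 (ltW B0)); [| |lra|lra] => w ws.
    by apply: dg; lra.
  by apply/ltW/g_near; lra.
have half_D : 16 * B / s ^+ 2 * (cabs (x - z) + cabs (y - z)) <= D / 2.
  have -> : D / 2 = 16 * B / s ^+ 2 * (2 * (D * s ^+ 2 / (64 * B))).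
    by field; rewrite !gt_eqF.
  by rewrite ler_wpM2l ?divr_ge0 ?mulr_ge0 ?exprn_ge0 ?(ltW B0) ?(ltW s0)//; lra.
move=> /le_trans/(_ (ler_wpM2r (cabs_ge0 (x - y)) half_D)) taylor.
have := cabsB_ge (cderiv g z * (x - y)) (g x - g y).
rewrite cabsM -/D (cabs_distC (cderiv g z * (x - y))) => derivative_le.
by rewrite mulrAC ler_pdivlMr//; lra.
Qed.

End DiscEstimates.

(** * Large values occur only near poles *)

Section Meromorphic.
Variable R : realType.
Local Notation C := (R[i]).
Variable f : C -> option C.
Hypothesis merf : meromorphic f.
Implicit Types (a z w : C) (r K : R).

Lemma fv_some z w : f z = Some w -> fv f z = w.
Proof. by rewrite /fv => ->. Qed.

Lemma some_fv z : f z <> None -> f z = Some (fv f z).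
Proof. by rewrite /fv; case: (f z). Qed.

Lemma meromorphic_regular z : f z <> None -> exists r, 0 < r /\
  forall w, cabs (w - z) < r -> f w <> None /\ cderivable (fv f) w.
Proof. by move=> fz; have [//|[m [_ []]]] := merf z. Qed.

Lemma meromorphic_cderivable z : f z <> None -> cderivable (fv f) z.
Proof.
by move=> /meromorphic_regular[r [r0 reg]]; have [|] := reg z; rewrite ?subrr ?cabs0.
Qed.

Lemma meromorphic_ccontinuous z : f z <> None -> ccontinuous (fv f) z.
Proof. by move=> /meromorphic_cderivable/cderivable_ccontinuous. Qed.

Lemma meromorphic_pole a : f a = None -> exists m, pole_of_order f a m.
Proof.
move=> fa; have [[r [r0 reg]]|//] := merf a.
by have [] := reg a (cball_center a r0).
Qed.

Definition inv_fv z : C := if f z is Some w then w^-1 else 0.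

Lemma inv_fv_pole a : f a = None -> inv_fv a = 0.
Proof. by rewrite /inv_fv => ->. Qed.

Lemma inv_fv_regular z : f z <> None -> inv_fv z = (fv f z)^-1.
Proof. by move=> /some_fv fz; rewrite /inv_fv fz. Qed.

Lemma cderivable_inv_fv_regular z : f z <> None -> fv f z != 0 -> cderivable inv_fv z.
Proof.
move=> fz fz0; have [r [r0 reg]] := meromorphic_regular fz.
apply: (@cderivable_ext _ (fun w => (fv f w)^-1) _ _ r r0) => [w /reg[fw _]|].
  by rewrite inv_fv_regular.
by apply: cderivableV fz0 _; exact: meromorphic_cderivable.
Qed.

Lemma cderivable_inv_fv_pole a : f a = None -> cderivable inv_fv a.
Proof.
move=> /[dup] fa /meromorphic_pole[m [m0 [_ [r [r0 [g [dg [ga fE]]]]]]]].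
apply: (@cderivable_ext _ (fun z => (z - a) ^+ m * (g z)^-1) _ _ r r0) => [z za|].
  have [->|zna] := eqVneq z a; first by rewrite inv_fv_pole// subrr expr0n gtn_eqF// mul0r.
  by rewrite /inv_fv (fE z za zna) invfM invrK mulrC.
apply: cderivableM; first exact/cderivableX/cderivable_subr.
by apply: cderivableV ga _; exact: dg (cball_center a r0).
Qed.

Lemma pole_isolated a : f a = None -> exists r, 0 < r /\ forall z,
  cabs (z - a) < r -> z != a -> f z <> None /\ fv f z != 0.
Proof.
move=> /meromorphic_pole[m [m0 [_ [r [r0 [g [dg [ga fE]]]]]]]].
have /cderivable_ccontinuous/ccontinuousP cg : cderivable g a.
  exact: dg (cball_center a r0).
have [|d [d0 g_near]] := cg (cabs (g a)); first by rewrite cabs_gt0.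
have [s [s0 sr sd]] := exists_pos_le2 r0 d0.
exists s; split=> // z zs zna; have fz := fE z (lt_le_trans zs sr) zna.
split; first by rewrite fz.
rewrite (fv_some fz) mulf_neq0 ?invr_eq0 ?expf_neq0 ?subr_eq0//.
apply/eqP => gz0; have := g_near z (lt_le_trans zs sd).
by rewrite gz0 sub0r cabsN ltxx.
Qed.

Lemma pole_large a K : f a = None -> exists r, 0 < r /\ forall z,
  cabs (z - a) < r -> z != a -> f z <> None /\ K < cabs (fv f z).
Proof.
move=> fa; have [r [r0 iso]] := pole_isolated fa.
have K0 : 0 < `|K| + 1 by rewrite ltr_wpDl.
have /ccontinuousP cinv := cderivable_ccontinuous (cderivable_inv_fv_pole fa).
have [|d [d0 small]] := cinv (`|K| + 1)^-1; first by rewrite invr_gt0.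
have [s [s0 sr sd]] := exists_pos_le2 r0 d0.
exists s; split=> // z zs zna; have [fz fz0] := iso z (lt_le_trans zs sr) zna.
split=> //; have := small z (lt_le_trans zs sd).
rewrite (inv_fv_pole fa) subr0 inv_fv_regular// cabsV ltf_pV2 ?posrE ?cabs_gt0//.
by have := ler_norm K; lra.
Qed.

Lemma cderiv_pole_numerator (g : C -> C) a k r z :
  (forall w, cabs (w - a) < r -> w != a -> f w = Some (g w / (w - a) ^+ k)) ->
  cabs (z - a) < r -> z != a ->
  cderiv g z = cderiv (fv f) z * (z - a) ^+ k + fv f z * (k%:R * (z - a) ^+ k.-1).
Proof.
move=> fE zr zna; have fz : f z <> None by rewrite (fE z zr zna).
have near0 : 0 < Num.min (r - cabs (z - a)) (cabs (z - a)).
  by rewrite lt_min subr_gt0 zr cabs_subr_gt0.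
apply: (@has_cderiv_unique R).
apply: (@has_cderiv_ext R (fun w => fv f w * (w - a) ^+ k)) near0 _ _.
  move=> w; rewrite lt_min => /andP[wr wa].
  have wr' : cabs (w - a) < r by have := cabs_distD z w a; lra.
  have wna : w != a by apply/eqP => wE; move: wa; rewrite wE cabs_distC ltxx.
  by rewrite (fv_some (fE w wr' wna)) mulfVK// expf_neq0// subr_eq0.
apply: has_cderivM; first exact/cderivableP/meromorphic_cderivable.
by rewrite -[_ * _ ^+ _]mulr1; apply: has_cderivX; exact: has_cderiv_subr.
Qed.

(* Near a pole f = g / (z - a)^k, and f'(z) = 0 would force g'(z) (z - a) = k g(z),
   which fails close to a because g(a) != 0. *)
Lemma cderiv_neq0_near_pole a : f a = None -> exists d, 0 < d /\ forall z,
  cabs (z - a) < d -> z != a -> cderiv (fv f) z != 0.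
Proof.
move=> fa; have [k [k0 [_ [r [r0 [g [dg [ga fE]]]]]]]] := meromorphic_pole fa.
have cg : ccontinuous g a by apply: cderivable_ccontinuous; exact: dg (cball_center a r0).
have ga0 : 0 < cabs (g a) by rewrite cabs_gt0.
have [|e [e0 g_near]] := (ccontinuousP _ _).1 cg (cabs (g a) / 2); first by lra.
have [s' [s'0 s'r s'e]] := exists_pos_le2 r0 e0.
have [s [s0 sr se]] : exists s, [/\ 0 < s, s < r & s < e] by exists (s' / 2); split; lra.
have g_bounds z : cabs (z - a) <= s -> cabs (g z) <= 2 * cabs (g a) /\ cabs (g a) / 2 <= cabs (g z).
  move=> zs; have := g_near z (le_lt_trans zs se).
  by have := cabsB_ge (g a) (g z); have := cabsB_ge (g z) (g a); rewrite (cabs_distC (g a)); lra.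
exists (s / 32); split=> [|z zs zna]; first by lra.
have zs' : cabs (z - a) <= s by lra.
have zr : cabs (z - a) < r by lra.
apply/eqP => f'0; have := cderiv_pole_numerator fE zr zna.
rewrite f'0 mul0r add0r (fv_some (fE z zr zna)) => g'E {f'0}.
have /(congr1 (@cabs R)) : cderiv g z * (z - a) = k%:R * g z.
  rewrite g'E; case: (k) k0 => // j _ /=.
  by rewrite exprS; field; rewrite expf_neq0 ?subr_eq0// zna.
move=> {g'E}; have g'_le : cabs (cderiv g z) <= 4 * (2 * cabs (g a)) / s.
  have g_der w : cabs (w - a) <= s -> cderivable g w.
    by move=> ws; apply: dg; exact: le_lt_trans ws sr.
  have B0 : 0 <= 2 * cabs (g a) by lra.
  by apply: (disc_cderiv_le s0 B0 g_der (fun w ws => (g_bounds w ws).1)); lra.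
have : cabs (cderiv g z) * cabs (z - a) <= 4 * (2 * cabs (g a)) / s * (s / 32).
  by apply: ler_pM; rewrite ?cabs_ge0// ltW.
have -> : 4 * (2 * cabs (g a)) / s * (s / 32) = cabs (g a) / 4.
  by field; rewrite gt_eqF.
have k_norm : cabs (k%:R : C) = k%:R :> R.
  have -> : (k%:R : C) = (k%:R : R)%:C%C by rewrite rmorph_nat.
  by rewrite cabs_real ger0_norm.
have [_ ga_le] := g_bounds z zs'; rewrite !cabsM k_norm.
have : cabs (g z) <= k%:R * cabs (g z) by rewrite ler_peMl ?cabs_ge0// ler1n.
lra.
Qed.

Lemma fv_bounded_on_circle a r : 0 < r -> (forall z, cabs (z - a) = r -> f z <> None) ->
  exists B, forall z, cabs (z - a) = r -> cabs (fv f z) <= B.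
Proof.
move=> r0 regular; pose circle : set C := [set z | cabs (z - a) = r].
have circle0 : circle !=set0.
  by exists (a + r%:C%C); rewrite /circle /= addrAC subrr add0r cabs_real gtr0_norm.
have circle_closed : closed (circle : set C^o).
  exact: ((continuous_closedP _).1 (@cabs_dist_continuous R a) _ (@closed_eq R r)).
have [||z _ zmax] := @closed_bounded_max R circle (fun z => cabs (fv f z))
    (cabs a + r) circle0 circle_closed.
- by move=> z zr; have := cabsB_ge z a; rewrite zr lerBlDl.
- by move=> z /regular/meromorphic_ccontinuous/ccontinuous_cabs.
by exists (cabs (fv f z)).
Qed.

Lemma poles_in_disc_finite B : finite_set [set a | f a = None /\ cabs a <= B].
Proof.
pose disc : set C := rect (- B) (- B) (B + B) (B + B).
suff : finite_set (disc `&` [set a | f a = None]).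
  apply: sub_finite_set => z [fz zB]; split=> //.
  rewrite /disc /rect /= !addrA !addNr !add0r -!ler_norml.
  by rewrite !(le_trans _ zB) ?Re_le_cabs ?Im_le_cabs.
apply: (@compact_induction C^o disc (fun A => finite_set (A `&` [set a | f a = None]))).
- exact: rect_compact.
- by rewrite set0I.
- by move=> A A' AA'; apply: sub_finite_set => z [/AA' ? ?].
- by move=> A A' ? ?; rewrite setIUl finite_setU.
move=> p _; have [fp|fp] := pselect (f p = None).
  have [r [r0 iso]] := pole_isolated fp; exists (cball p r); first exact: nbhs_cball.
  apply: (@sub_finite_set _ _ [set p]) => // z [zp fz].
  by apply: contrapT => /eqP zn; have [] := iso z zp zn.
have [r [r0 reg]] := meromorphic_regular fp; exists (cball p r); first exact: nbhs_cball.
by apply: (@sub_finite_set _ _ set0) => // z [/reg[]].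
Qed.

Definition superlevel K : set C := [set z | f z = None \/ K < cabs (fv f z)].

Lemma superlevel_mono K K' : K <= K' -> superlevel K' `<=` superlevel K.
Proof. by move=> KK' z [fz|fz]; [left|right; exact: le_lt_trans fz]. Qed.

Lemma superlevel_open K : copen (superlevel K).
Proof.
move=> z Kz; have [fz|fz] := pselect (f z = None).
  have [r [r0 large]] := pole_large K fz; exists r; split=> // w wz.
  have [->|wn] := eqVneq w z; first by left.
  by right; have [] := large w wz wn.
case: Kz => // Kz; have /ccontinuousP cf := meromorphic_ccontinuous fz.
have [|d [d0 near]] := cf (cabs (fv f z) - K); first by rewrite subr_gt0.
exists d; split=> // w /near fw; right.
by have := cabsB_ge (fv f z) (fv f w); rewrite cabs_distC; lra.
Qed.

Lemma bounded_entire_rational B :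
  (forall z, f z <> None /\ cabs (fv f z) <= B) -> rational_fun f.
Proof.
move=> bounded; exists (fv f 0)%:P, 1; rewrite oner_neq0; split=> // z _.
rewrite !hornerE divr1 (some_fv (bounded z).1); congr Some.
apply: (@liouville _ (fv f) B) => w; last exact: (bounded w).2.
exact/meromorphic_cderivable/(bounded w).1.
Qed.

End Meromorphic.

Section Paths.
Variable R : realType.
Local Notation C := (R[i]).
Implicit Types (u : R -> C^o) (O : set C) (z w : C) (s t : R).

Lemma line_continuous z w : continuous (fun t : R => z + t%:C%C * w : C^o).
Proof.
move=> t; apply/(@cvgrPdist_lt _ C^o) => _ /gt0_complexE[e e0 ->].
have w0 : 0 < cabs w + 1 by rewrite ltr_wpDl ?cabs_ge0.
apply/nbhs_ballP; exists (e / (cabs w + 1)) => [|s]; first exact: divr_gt0.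
rewrite /ball /= ltr_pdivlMr// normc_cabs ltcR => ts.
have -> : z + t%:C%C * w - (z + s%:C%C * w) = (t - s)%:C%C * w by rewrite rmorphB /=; ring.
by rewrite cabsM cabs_real; apply: le_lt_trans ts; rewrite ler_wpM2l// lerDl.
Qed.

Lemma line_preimage_open (U : set C) z w : copen U -> open [set t : R | U (z + t%:C%C * w)].
Proof.
move=> /copenE Uo; apply: (open_comp _ Uo) => t _; exact: line_continuous.
Qed.

Lemma boundary_point (U : set C) z w : copen U -> U z -> ~ U w ->
  exists2 p, ~ U p & closure (U : set C^o) p.
Proof.
move=> Uo Uz nUw; apply: contrapT => no_boundary.
have clU p : closure (U : set C^o) p -> U p.
  by move=> clp; apply: contrapT => nUp; apply: no_boundary; exists p.
pose line (t : R) : C^o := z + t%:C%C * (w - z); pose T := [set t : R | U (line t)].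
have : `[0, 1]%classic `&` T = `[0, 1]%classic :> set R.
  apply: segment_connected.
  - exists 0; split; first by rewrite /= in_itv /= lexx ler01.
    by rewrite /T /line /= mul0r addr0.
  - by exists T => //; exact: line_preimage_open.
  - exists T => //; rewrite (_ : T = line @^-1` closure (U : set C^o)).
      apply: (continuous_closedP line).1; last exact: closed_closure.
      exact: line_continuous.
    by apply/seteqP; split=> t; [exact: (@subset_closure C^o)|exact: clU].
move=> /seteqP[_ /(_ 1)[|_]]; first by rewrite /= in_itv /= ler01 lexx.
by rewrite /T /line /= mul1r addrC subrK.
Qed.

Definition clamp t : R := Num.max 0 (Num.min 1 t).

Lemma clamp_continuous : continuous clamp.
Proof.
move=> t; apply: (@continuous_max R R (fun=> 0)); first exact: cst_continuous.
by apply: (@continuous_min R R (fun=> 1)); [exact: cst_continuous|exact: cvg_id].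
Qed.

Lemma clamp_le0 t : t <= 0 -> clamp t = 0.
Proof. by move=> t0; rewrite /clamp max_l// ge_min t0 orbT. Qed.

Lemma clamp_ge1 t : 1 <= t -> clamp t = 1.
Proof. by move=> t0; rewrite /clamp min_l// max_r. Qed.

Lemma clamp_id t : 0 <= t <= 1 -> clamp t = t.
Proof. by move=> /andP[? ?]; rewrite /clamp min_r// max_r. Qed.

Lemma clamp_itv t : 0 <= clamp t <= 1.
Proof. by rewrite /clamp le_max lexx ge_max ler01 ge_min lexx. Qed.

Lemma continuous_path_affine u (b c : R) : continuous u ->
  continuous (fun t => u (clamp (b * t + c))).
Proof.
move=> cu t; apply: (@continuous_comp _ _ _ (fun t => clamp (b * t + c)) u _ _ (cu _)).
apply: (@continuous_comp _ _ _ (fun t => b * t + c) clamp); last exact: clamp_continuous.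
by apply: cvgD; [apply: cvgM; [exact: cvg_cst|exact: cvg_id]|exact: cvg_cst].
Qed.

Lemma continuous_pathD u (v : R -> C^o) : continuous u -> continuous v ->
  continuous (fun t => u t + v t : C^o).
Proof. by move=> cu cv t; exact: (@continuousD C C^o R u v t (cu t) (cv t)). Qed.

Definition joined O z w := exists u, [/\ continuous u, u 0 = z, u 1 = w &
  forall t, 0 <= t <= 1 -> O (u t)].

Lemma joined_refl O z : O z -> joined O z z.
Proof. by move=> Oz; exists (fun=> z); split=> // t; exact: cst_continuous. Qed.

Lemma joined_mono O O' z w : O `<=` O' -> joined O z w -> joined O' z w.
Proof. by move=> OO' [u [? ? ? Ou]]; exists u; split=> // t /Ou/OO'. Qed.

Lemma joined_sub O z : joined O z `<=` O.
Proof. by move=> w [u [_ _ <- Ou]]; apply: Ou; rewrite ler01 lexx. Qed.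

Lemma joined_trans O z w v : joined O z w -> joined O w v -> joined O z v.
Proof.
move=> [u [cu u0 u1 Ou]] [y [cy y0 y1 Oy]].
exists (fun t => u (clamp (2 * t + 0)) + (y (clamp (2 * t + -1)) - w)); split.
- apply: continuous_pathD; first exact: continuous_path_affine.
  apply: continuous_pathD; first exact: continuous_path_affine.
  by move=> t; exact: cst_continuous.
- by rewrite !clamp_le0 ?u0 ?y0 ?subrr ?addr0//; lra.
- by rewrite !clamp_ge1 ?u1 ?y1 ?[w + _]addrC ?subrK//; lra.
- move=> t ht; have [t2|t2] := leP (2 * t) 1.
    rewrite [clamp (_ + -1)]clamp_le0 ?y0 ?subrr ?addr0; last by lra.
    by apply: Ou; exact: clamp_itv.
  rewrite clamp_ge1 ?u1; last by lra.
  by rewrite addrC subrK; apply: Oy; exact: clamp_itv.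
Qed.

Lemma joined_ball O z r w : cball z r `<=` O -> cball z r w -> joined O z w.
Proof.
rewrite /cball /= => zO wr; exists (fun t => z + t%:C%C * (w - z)); split.
- exact: line_continuous.
- by rewrite mul0r addr0.
- by rewrite mul1r addrC subrK.
- move=> t /andP[t0 t1]; apply: zO; rewrite /= addrAC subrr add0r cabsM cabs_real ger0_norm//.
  by apply: le_lt_trans wr; rewrite ler_piMl ?cabs_ge0.
Qed.

Lemma joined_sym O z w : joined O z w -> joined O w z.
Proof.
move=> [u [cu u0 u1 Ou]]; exists (fun t => u (clamp (-1 * t + 1))); split.
- exact: continuous_path_affine.
- by rewrite clamp_ge1//; lra.
- by rewrite clamp_le0//; lra.
- by move=> t _; apply: Ou; exact: clamp_itv.
Qed.

Lemma joined_path O z u t : continuous u -> u 0 = z -> 0 <= t <= 1 ->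
  (forall s, 0 <= s <= 1 -> O (u s)) -> joined O z (u t).
Proof.
move=> cu u0 t01 Ou; exists (fun s => u (clamp (t * s + 0))); split.
- exact: continuous_path_affine.
- by rewrite mulr0 addr0 clamp_le0.
- by rewrite mulr1 addr0 clamp_id.
- by move=> s _; apply: Ou; exact: clamp_itv.
Qed.

Lemma joined_open O z : copen O -> copen (joined O z).
Proof.
move=> oO w zw; have [r [r0 rO]] := oO w (joined_sub zw).
by exists r; split=> // v wv; apply: joined_trans zw _; exact: joined_ball wv.
Qed.

Lemma closure_joined O z p : copen O -> closure (joined O z : set C^o) p -> O p ->
  joined O z p.
Proof.
move=> oO /closure_cballP clp /oO[r [/clp[w [zw wp]] rO]].
by apply: joined_trans zw _; apply: joined_sym; exact: joined_ball wp.
Qed.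

Lemma joined_sphere O z a r : joined O z a -> 0 < r -> r <= cabs (z - a) ->
  exists w, O w /\ cabs (w - a) = r.
Proof.
move=> [u [cu u0 u1 Ou]] r0 rz.
have [||t] := @IVT R (fun t => cabs (u t - a)) 0 1 r ler01.
- apply: continuous_subspaceT => t.
  exact: (continuous_comp (cu t) (@cabs_dist_continuous R a (u t))).
- by rewrite u0 u1 subrr cabs0 min_r ?cabs_ge0// max_l ?cabs_ge0// (ltW r0).
by rewrite in_itv /= => t01 <-; exists (u t); split=> //; exact: Ou.
Qed.

Lemma infinite_path (u : nat -> R -> C^o) (z : nat -> C) :
  (forall n, continuous (u n)) -> (forall n, u n 0 = z n) ->
  (forall n, u n 1 = z n.+1) ->
  exists gam : R -> C^o, continuous gam /\
    forall n t, n%:R <= t <= n.+1%:R -> gam t = u n (t - n%:R).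
Proof.
move=> cu u0 u1.
pose G N t : C^o := z 0%N + \sum_(n < N) (u n (clamp (1 * t + - n%:R)) - z n).
have GS N t : G N.+1 t = G N t + (u N (clamp (1 * t + - N%:R)) - z N).
  by rewrite /G big_ord_recr /= addrA.
have G_stable N N' t : t <= N%:R -> (N <= N')%N -> G N' t = G N t.
  move=> tN; elim: N' => [|N' IH]; first by rewrite leqn0 => /eqP ->.
  rewrite leq_eqVlt => /predU1P[->//|]; rewrite ltnS => NN'.
  rewrite GS IH// clamp_le0 ?u0 ?subrr ?addr0// mul1r subr_le0 (le_trans tN)//.
  by rewrite ler_nat.
have cG N : continuous (G N).
  elim: N => [|N IH].
    by rewrite (_ : G 0%N = fun=> z 0%N); [move=> t; exact: cst_continuous|
      apply/funext => t; rewrite /G big_ord0 addr0].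
  have -> : G N.+1 = (fun t => G N t + (u N (clamp (1 * t + - N%:R)) - z N)).
    by apply/funext => t; exact: GS.
  apply: (continuous_pathD IH); apply: continuous_pathD.
    exact: (@continuous_path_affine (u N) 1 (- N%:R) (cu N)).
  by move=> t; exact: cst_continuous.
have G_end n t : n%:R <= t -> G n t = z n.
  elim: n => [|n IH] nt; first by rewrite /G big_ord0 addr0.
  have {}nt : n%:R + 1 <= t by rewrite natr1.
  by rewrite GS IH ?clamp_ge1 ?u1 ?[z n + _]addrC ?subrK//; lra.
pose gam t := G (Num.truncn t).+1 t.
have gamE N t : t <= N%:R -> gam t = G N t.
  move=> tN; have t_lt : t <= (Num.truncn t).+1%:R by rewrite ltW// truncnS_gt.
  by have [/(G_stable _ _ _ t_lt)->//|/ltnW/(G_stable _ _ _ tN)] := leqP (Num.truncn t).+1 N.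
exists gam; split=> [t|n t /andP[nt tn]]; last first.
  by rewrite (gamE n.+1)// GS G_end// mul1r addrC subrK clamp_id//; move: tn; rewrite -natr1; lra.
have t_lt : t < (Num.truncn t).+1%:R by exact: truncnS_gt.
rewrite /continuous_at (gamE _ _ (ltW t_lt)); apply: cvg_trans (cG (Num.truncn t).+1 t).
apply: near_eq_cvg; near=> s; rewrite (gamE (Num.truncn t).+1)// ltW//.
by near: s; exact: lt_nbhsl.
Unshelve. all: by end_near. Qed.

End Paths.

Section Tracts.
Variable R : realType.
Local Notation C := (R[i]).
Variable f : C -> option C.
Hypothesis merf : meromorphic f.
Hypothesis tranf : transcendental f.
Implicit Types (K L B : R) (z w : C).

Definition tract K z := joined (superlevel f K) z.

Lemma tract_unbounded K z : 0 < K -> superlevel f K z ->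
  (forall w, tract K z w -> f w <> None) ->
  forall B, exists w, tract K z w /\ B < cabs (fv f w).
Proof.
move=> K0 Kz poleless B; apply: contrapT => /forallNP no_large.
have Ko := superlevel_open merf (K := K).
have le_B w : tract K z w -> cabs (fv f w) <= B.
  by move=> zw; rewrite leNgt; apply/negP => ?; apply: (no_large w).
have closure_poleless p : closure (tract K z : set C^o) p -> f p <> None.
  move=> clp fp; apply: (poleless p) => //; apply: closure_joined => //; by left.
have boundary_le p : closure (tract K z : set C^o) p -> ~ tract K z p -> cabs (fv f p) <= K.
  move=> clp nUp; rewrite leNgt; apply/negP => Kp; apply: nUp.
  by apply: closure_joined => //; right.
have [everywhere|/existsNP[w nzw]] := pselect (forall p, tract K z p).
  apply: tranf; apply: (@bounded_entire_rational _ _ merf B) => p.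
  by split; [exact: poleless|exact: le_B].
have [p nzp clp] := boundary_point (joined_open (z := z) Ko) (joined_refl Kz) nzw.
have : cabs (fv f z) <= K.
  apply: (phragmen_lindelof (joined_open (z := z) Ko) clp nzp _ _ le_B (ltW K0) boundary_le).
  - by move=> v /closure_poleless/(meromorphic_ccontinuous merf).
  - by move=> v /poleless/(meromorphic_cderivable merf).
  - exact: joined_refl.
case: Kz => [fz|]; last by lra.
by exfalso; apply: (poleless z) => //; apply: joined_refl; left.
Qed.

Lemma tract_bounded_on_disc K z L : (forall w, tract K z w -> f w <> None) ->
  exists B, forall w, cabs w <= L -> tract K z w -> cabs (fv f w) <= B.
Proof.
move=> poleless; pose disc : set C := rect (- L) (- L) (L + L) (L + L).
suff [B bounded] : exists B, forall w, disc w -> tract K z w -> cabs (fv f w) <= B.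
  exists B => w wL; apply: bounded; rewrite /disc /rect /= !addrA !addNr !add0r -!ler_norml.
  by rewrite !(le_trans _ wL) ?Re_le_cabs ?Im_le_cabs.
apply: (@compact_induction C^o disc (fun A => exists B, forall w, A w -> tract K z w ->
  cabs (fv f w) <= B)).
- exact: rect_compact.
- by exists 0.
- by move=> A A' AA' [B bounded]; exists B => w /AA'; exact: bounded.
- move=> A A' [B bounded] [B' bounded']; exists (Num.max B B') => w [Aw|Aw] zw.
    by rewrite le_max bounded.
  by rewrite le_max bounded' ?orbT.
move=> p _; have [fp|fp] := pselect (f p = None).
  have [|r [r0 rK]] := superlevel_open merf (_ : superlevel f K p); first by left.
  exists (cball p r); first exact: nbhs_cball.
  exists 0 => w wp zw; exfalso; apply: (poleless p) => //; apply: joined_trans zw _.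
  by apply: joined_sym; exact: joined_ball wp.
have [|d [d0 near]] := ccontinuous_cabs_lt (B := cabs (fv f p) + 1)
  (meromorphic_ccontinuous merf fp); first by rewrite ltrDl.
by exists (cball p d); [exact: nbhs_cball|exists (cabs (fv f p) + 1) => w /near/ltW].
Qed.

Lemma tract_path K z : 0 < K -> superlevel f K z ->
  (forall w, tract K z w -> f w <> None) ->
  exists gam : R -> C^o, continuous gam /\ forall n t, n%:R <= t ->
    superlevel f (K + n%:R) (gam t) /\ tract K z (gam t).
Proof.
move=> K0 Kz poleless; pose Kn (n : nat) := K + n%:R.
have sub n : superlevel f (Kn n) `<=` superlevel f K.
  by apply: superlevel_mono; rewrite lerDl.
pose climbs n w := tract K z w /\ superlevel f (Kn n) w.
have climb n w : climbs n w -> exists w', climbs n.+1 w' /\ tract (Kn n) w w'.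
  move=> [zw Kw]; have Kn0 : 0 < Kn n by rewrite (lt_le_trans K0)// lerDl.
  have tract_sub v : tract (Kn n) w v -> tract K z v.
    by move=> wv; apply: joined_trans zw _; exact: joined_mono (@sub n) wv.
  have [v /tract_sub/poleless//|w' [ww' large]] := tract_unbounded Kn0 Kw _ (Kn n.+1).
  by exists w'; split=> //; split; [exact: tract_sub|right].
have [|s [s0 sP]] := @nat_dependent_choice _ climbs (fun n => tract (Kn n)) z _ climb.
  by split; [exact: joined_refl|rewrite /Kn addr0].
have /choice[u uP] n : exists u : R -> C^o, [/\ continuous u, u 0 = s n, u 1 = s n.+1 &
    forall t, 0 <= t <= 1 -> superlevel f (Kn n) (u t)] by have [] := sP n.
have [gam [cgam gamE]] := @infinite_path R u s (fun n => let: And4 h _ _ _ := uP n in h)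
  (fun n => let: And4 _ h _ _ := uP n in h) (fun n => let: And4 _ _ h _ := uP n in h).
exists gam; split=> // n t nt; pose k := Num.truncn t.
have /truncn_itv/andP[kt tk] : 0 <= t by rewrite (le_trans _ nt).
have nk : (n <= k)%N by rewrite truncn_ge_nat// (le_trans _ nt).
have [cu u0 u1 Ku] := uP k.
have t01 : 0 <= t - k%:R <= 1 by move: tk; rewrite -natr1 -/k; lra.
rewrite (gamE k t); last by rewrite kt ltW.
split; first by apply: (superlevel_mono _ (Ku _ t01)); rewrite lerD2l ler_nat.
have [[zk _] _] := sP k; apply: joined_trans zk _.
exact: joined_mono (@sub k) (joined_path cu u0 t01 Ku).
Qed.

Lemma poleless_tract_asymptotic K z : 0 < K -> superlevel f K z ->
  (forall w, tract K z w -> f w <> None) -> inf_asymptotic_value f.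
Proof.
move=> K0 Kz poleless; have [gam [cgam gamP]] := tract_path K0 Kz poleless.
have eventually_large L : exists T : R, forall t, T < t ->
    [/\ f (gam t) <> None, L < cabs (fv f (gam t)) & tract K z (gam t)].
  pose n := (Num.truncn `|L|).+1; exists n%:R => t /ltW/(gamP n)[high zt].
  split=> //; first exact: poleless.
  have : `|L| < n%:R by exact: truncnS_gt.
  by case: high => [/(poleless _ zt)//|]; have := ler_norm L; lra.
exists gam; split; first split=> // L.
  have [B bounded] := tract_bounded_on_disc L poleless.
  have [T large] := eventually_large B; exists T => t /large[_ ft zt].
  by rewrite ltNge; apply/negP => /bounded/(_ zt); rewrite leNgt ft.
move=> L; have [T large] := eventually_large L.
by exists T => t /large[_ ft _] v /fv_some <-.
Qed.

Lemma superlevel_near_pole (rad : C -> R) K : ~ inf_asymptotic_value f -> 0 < K ->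
  (forall a, f a = None -> 0 < rad a /\ forall z, cabs (z - a) = rad a ->
     f z <> None /\ cabs (fv f z) <= K) ->
  forall z, superlevel f K z -> exists a, f a = None /\ cabs (z - a) < rad a.
Proof.
move=> noinf K0 circles z Kz; apply: contrapT => /forallNP far_from_poles.
apply: noinf; apply: (poleless_tract_asymptotic K0 Kz) => a za fa.
have [rad0 circle] := circles a fa.
have [|w [Kw wa]] := joined_sphere za rad0.
  by rewrite leNgt; apply/negP => near_a; apply: (far_from_poles a).
have [fw le_K] := circle w wa.
by case: Kw => // /lt_le_trans/(_ le_K); rewrite ltxx.
Qed.

End Tracts.

(** * Counting poles *)

Section Counting.
Variable R : realType.
Local Notation C := (R[i]).
Local Notation mu := (@lebesgue_measure R).
Variable f : C -> option C.
Hypothesis merf : meromorphic f.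
Implicit Types (a : C) (r s t x : R).

Lemma mult_pole a : f a = None -> pole_of_order f a (mult f a).
Proof. by move=> fa; apply: xgetPex; exact: meromorphic_pole. Qed.

Lemma mult_gt0 a : f a = None -> (0 < mult f a)%N.
Proof. by move=> /mult_pole[]. Qed.

Lemma npolesE r t : t <= r -> npoles f t =
  (\sum_(a <- fset_set [set a | f a = None /\ (cabs a <= r)%R] | (cabs a <= t)%R)
     mult f a)%N.
Proof.
move=> tr; have fin := poles_in_disc_finite merf.
rewrite /npoles fsbig_finite// -[RHS]big_filter; apply/perm_big/uniq_perm.
- exact: fset_uniq.
- by apply: filter_uniq; exact: fset_uniq.
move=> a; rewrite mem_filter !in_fset_set//.
apply/idP/andP => [/set_mem[fa at_]|[at_ /set_mem[fa _]]]; last exact/mem_set.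
by split=> //; apply/mem_set; split=> //; exact: le_trans at_ tr.
Qed.

Lemma npoles_mono s t : s <= t -> (npoles f s <= npoles f t)%N.
Proof.
move=> st; rewrite (npolesE st) (npolesE (lexx t)).
rewrite [leqLHS]big_mkcond [leqRHS]big_mkcond /=.
by apply: leq_sum => a _; case: ifPn => // as_; rewrite (le_trans as_ st).
Qed.

Lemma card_poles_le_npoles (A : seq C) t : uniq A ->
  (forall a, a \in A -> f a = None /\ cabs a <= t) -> (size A <= npoles f t)%N.
Proof.
move=> uA At; have fin := poles_in_disc_finite merf.
rewrite /npoles fsbig_finite//.
apply: (@leq_trans (size (fset_set [set a | f a = None /\ cabs a <= t]))).
  by apply: uniq_leq_size => // a /At At_a; rewrite in_fset_set//; exact: mem_set.
rewrite -sum1_size big_seq [leqRHS]big_seq; apply: leq_sum => a.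
by rewrite in_fset_set// => /set_mem[/mult_gt0].
Qed.

Lemma npoles_near0 : exists d, 0 < d /\ forall t, t < d -> (npoles f t <= npoles f 0)%N.
Proof.
have fin := poles_in_disc_finite merf.
have [d [d0 no_pole]] : exists d, 0 < d /\ forall z, cabs z < d -> z != 0 -> f z <> None.
  have [/(pole_isolated merf)[d [d0 iso]]|] := pselect (f 0 = None).
    by exists d; split=> // z zd z0; have [] := iso z; rewrite ?subr0.
  move=> /(meromorphic_regular merf)[d [d0 reg]].
  by exists d; split=> // z zd z0; have [] := reg z; rewrite ?subr0.
exists d; split=> // t td; have [t0|t0] := leP t 0; first exact: npoles_mono.
rewrite (npolesE (lexx t)) (npolesE (ltW t0)).
rewrite big_seq_cond [leqRHS]big_seq_cond big_mkcond [leqRHS]big_mkcond /=.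
apply: leq_sum => a _; case: ifPn => // /andP[aF at_]; rewrite aF /=.
move: aF; rewrite in_fset_set// => /set_mem[fa _].
case: ifPn => //; rewrite -ltNge cabs_gt0 => a0.
by exfalso; apply: (no_pole a) => //; exact: le_lt_trans at_ td.
Qed.

Lemma exists_between_notin (A : seq R) x y : x < y -> exists r, x < r < y /\ r \notin A.
Proof.
elim: A x y => [|c A IH] x y xy; first by exists ((x + y) / 2); split=> //; lra.
have [cxy|cxy] := leP c ((x + y) / 2).
  have [|r [rxy rA]] := IH ((x + y) / 2) y; first by lra.
  exists r; split; first by lra.
  by rewrite inE negb_or rA andbT gt_eqF//; lra.
have [|r [rxy rA]] := IH x ((x + y) / 2); first by lra.
exists r; split; first by lra.
by rewrite inE negb_or rA andbT lt_eqF//; lra.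
Qed.

Lemma cabs_circ r (th : R) : 0 <= r -> cabs (circ r th) = r.
Proof.
move=> r0; rewrite /cabs /circ /= !exprMn -mulrDr cos2Dsin2 mulr1.
by rewrite sqrtr_sqr ger0_norm.
Qed.

Lemma circ_continuous r : continuous (circ r : R -> C^o).
Proof.
move=> th; apply/(@cvgrPdist_lt _ C^o) => _ /gt0_complexE[e e0 ->].
have e20 : 0 < e / 2 by rewrite divr_gt0.
have /cvgrPdist_lt/(_ _ e20) cos_near : {for th, continuous (fun t : R => r * cos t)}.
  by apply: cvgM; [exact: cvg_cst|exact: continuous_cos].
have /cvgrPdist_lt/(_ _ e20) sin_near : {for th, continuous (fun t : R => r * sin t)}.
  by apply: cvgM; [exact: cvg_cst|exact: continuous_sin].
near=> s; rewrite normc_cabs ltcR (le_lt_trans (cabs_le_ReIm _))// cReB cImB /=.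
rewrite [ltRHS]splitr ltrD//; first by near: s.
by near: s.
Unshelve. all: by end_near. Qed.

Lemma ln_max1_continuous (u : R -> R) : continuous u ->
  continuous (fun t => ln (Num.max 1 (u t))).
Proof.
move=> cu t; have cmax : {for t, continuous ((fun=> 1 : R^o) \max u)}.
  by apply: continuous_max; [exact: cst_continuous|exact: cu].
have cln : {for Num.max 1 (u t), continuous (@ln R)}.
  by apply: continuous_ln; rewrite lt_max ltr01.
exact: (continuous_comp cmax cln).
Qed.

Lemma prox_fin_num r : 0 <= r -> (forall a, f a = None -> cabs a <> r) ->
  prox f r \is a fin_num /\ (0 <= prox f r)%E.
Proof.
move=> r0 no_pole; have fN th : f (circ r th) <> None.
  by move=> /no_pole; apply; exact: cabs_circ.
pose h th : R := ln (Num.max 1 (cabs (fv f (circ r th)))).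
have logplusE th : logplus (f (circ r th)) = (h th)%:E.
  rewrite (some_fv (fN th)) /logplus /h; congr EFin.
  have [le1|gt1] := leP (cabs (fv f (circ r th))) 1.
    by rewrite ln1 max_l// ln_le0.
  by rewrite max_r// ln_ge0// ltW.
have ch : continuous h.
  apply: ln_max1_continuous => th.
  apply: (@continuous_comp R C^o R (circ r) (fun z => cabs (fv f z))).
    exact: circ_continuous.
  exact/ccontinuous_cabs/meromorphic_ccontinuous/fN.
have Ih : mu.-integrable `[0, 2 * pi] (EFin \o h).
  apply: continuous_compact_integrable; first exact: segment_compact.
  exact: continuous_subspaceT.
have -> : prox f r = ((2 * pi)^-1%:E * \int[mu]_(th in `[0%R, (2 * pi)%R]) (h th)%:E)%E.
  by rewrite /prox; congr (_ * _)%E; apply: eq_integral => th _; exact: logplusE.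
split; first by rewrite fin_numM// integrable_fin_num.
apply: mule_ge0; first by rewrite lee_fin invr_ge0 mulr_ge0// pi_ge0.
by apply: integral_ge0 => th _; rewrite lee_fin ln_ge0// le_max lexx.
Qed.

Let excess t : R := (npoles f t - npoles f 0)%N%:R.

Let excess_mono s t : s <= t -> excess s <= excess t.
Proof. by move=> st; rewrite ler_nat leq_sub2r// npoles_mono. Qed.

Lemma excess_density_measurable D : measurable D -> measurable_fun D (fun t => excess t / t).
Proof.
move=> mD; have [d [d0 gap]] := npoles_near0.
have densityE t : excess t / t = excess t * (Num.max d t)^-1.
  have [td|//] := ltP t d; rewrite (_ : excess t = 0) ?mul0r//.
  by rewrite /excess; move: (gap t td); rewrite -subn_eq0 => /eqP ->.
rewrite (funext densityE); apply: measurable_funM.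
  by apply: nondecreasing_measurable => // s t; exact: excess_mono.
apply: nonincreasing_measurable => // s t st.
have max0 u : 0 < Num.max d u by rewrite lt_max d0.
by rewrite lef_pV2 ?posrE// ge_max le_max lexx /= le_max st orbT.
Qed.

Lemma excess_density_integrable r : 0 < r ->
  mu.-integrable `[0, r] (fun t => (excess t / t)%:E).
Proof.
move=> r0; have [d [d0 gap]] := npoles_near0.
apply: measurable_bounded_integrable => //.
- by rewrite /= lebesgue_measure_itv /= lte_fin r0 ltry.
- exact: excess_density_measurable.
exists (excess r / d); split=> [|B rB t /=]; first by rewrite num_real.
rewrite in_itv /= => /andP[t0 tr]; rewrite ger0_norm ?divr_ge0// (le_trans _ (ltW rB))//.
have [td|dt] := ltP t d.
  rewrite /excess (_ : (npoles f t - _)%N = 0%N) ?mul0r ?divr_ge0 ?(ltW d0)//.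
  by apply/eqP; rewrite subn_eq0 gap.
apply: ler_pM; rewrite ?invr_ge0//; first exact: excess_mono.
by rewrite lef_pV2 ?posrE// (lt_le_trans d0).
Qed.

Lemma count_fn_ge x r : 0 < x -> 1 <= r -> 2 * x <= r ->
  count_fn f r \is a fin_num /\ excess x / 2 <= fine (count_fn f r).
Proof.
move=> x0 r1 xr; have r0 : 0 < r by lra.
have fin_int : (\int[mu]_(t in `[0%R, r]) (excess t / t)%:E)%E \is a fin_num.
  exact/integrable_fin_num/excess_density_integrable.
have excess_le_int : ((excess x / 2)%:E <= \int[mu]_(t in `[0%R, r]) (excess t / t)%:E)%E.
  apply: (@le_trans _ _ (\int[mu]_(t in `[x, r]) (excess t / t)%:E)%E); last first.
    apply: ge0_subset_integral => //.
    - by apply/measurable_EFinP; exact: excess_density_measurable.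
    - by move=> t; rewrite /= in_itv /= => /andP[t0 _]; rewrite lee_fin divr_ge0.
    - by apply: subset_itv; rewrite bnd_simp// ltW.
  have xr_lt : x < r by lra.
  have -> : ((excess x / 2)%:E = \int[mu]_(t in `[x, r]) (excess x / 2 / (r - x))%:E)%E.
    rewrite integral_cst//= lebesgue_measure_itv /= lte_fin xr_lt -EFinB -EFinM.
    by congr EFin; field; lra.
  have rx : 0 < r - x by lra.
  apply: ge0_le_integral => //.
  - by move=> t _; rewrite lee_fin !divr_ge0// ltW.
  - by apply/measurable_EFinP; exact: excess_density_measurable.
  - move=> t /=; rewrite in_itv /= => /andP[xt tr]; rewrite lee_fin.
    have t0 : 0 < t by lra.
    rewrite -mulrA; apply: ler_pM => //; first by rewrite mulr_ge0 ?invr_ge0// ltW.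
      exact: excess_mono.
    by rewrite -invfM lef_pV2 ?posrE ?mulr_gt0//; lra.
rewrite /count_fn; split; first by rewrite fin_numD fin_int.
rewrite fineD//= -[leLHS]addr0 lerD//; last by rewrite mulr_ge0// ln_ge0.
by rewrite -lee_fin fineK.
Qed.

Lemma nev_T_le_powR (rho sigma : R) : has_order f rho -> rho < sigma ->
  exists r0, 1 <= r0 /\ forall r, r0 < r -> fine (nev_T f r) <= Num.max 1 (r `^ sigma).
Proof.
move=> ho rs.
have : (limf_esup (fun r : R => (ln (fine (nev_T f r)) / ln r)%:E) (pinfty_nbhs R) < sigma%:E)%E.
  by rewrite ho lte_fin.
rewrite limf_esupE => /ereal_inf_lt[_ [V [r0 [_ r0V]] <-] sup_lt].
exists (Num.max 1 r0); split=> [|r]; first by rewrite le_max lexx.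
rewrite gt_max => /andP[r1 /r0V Vr].
have : ln (fine (nev_T f r)) / ln r < sigma.
  by rewrite -lte_fin; apply: le_lt_trans sup_lt; apply: ereal_sup_ubound; exists r.
rewrite ltr_pdivrMr ?ln_gt0// le_max => lnT.
have [//|T1] := leP (fine (nev_T f r)) 1; have T0 := lt_trans ltr01 T1.
have r_gt0 := lt_trans ltr01 r1.
by rewrite -ler_ln ?posrE ?powR_gt0// ln_powR ltW.
Qed.

(* Jensen-type bound: n(x) log 2 <= N(2x) <= T(r) for a radius r in ]2x, 3x[ that
   carries no pole. *)
Lemma npoles_le_powR (rho sigma : R) : has_order f rho -> rho < sigma -> 0 < sigma ->
  exists x0, 1 <= x0 /\ forall x, x0 <= x ->
    (npoles f x)%:R <= (npoles f 0)%:R + 2 * (3 * x) `^ sigma.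
Proof.
move=> ho rs s0; have [x0 [x01 T_le]] := nev_T_le_powR ho rs.
exists x0; split=> // x xx; have x1 : 1 <= x by lra.
have fin := poles_in_disc_finite merf.
have [|r [/andP[xr rx] rL]] := @exists_between_notin [seq cabs a | a <-
    fset_set [set a | f a = None /\ cabs a <= 3 * x]] (2 * x) (3 * x); first by lra.
have no_pole a : f a = None -> cabs a <> r.
  move=> fa ar; move: rL => /negP; apply; rewrite -ar; apply: map_f.
  by rewrite in_fset_set//; apply/mem_set; split=> //; rewrite ar ltW.
have r1 : 1 < r by lra.
have [prox_fin prox_ge0] := prox_fin_num (ltW (lt_trans ltr01 r1)) no_pole.
have [|||count_fin count_ge] := @count_fn_ge x r; [lra|lra|lra|].
have excess_le : excess x / 2 <= fine (nev_T f r).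
  by rewrite /nev_T fineD// (le_trans count_ge)// lerDr fine_ge0.
have r1s : 1 <= r `^ sigma by rewrite -[leLHS](powRr0 r) ler_powR//; lra.
have r3s : r `^ sigma <= (3 * x) `^ sigma.
  by apply: ge0_ler_powR; rewrite ?nnegrE ?(ltW s0)//; lra.
have := T_le r; rewrite max_r// => /(_ _)le_r; have {}le_r := le_r (_ : x0 < r).
have : (npoles f x)%:R = excess x + (npoles f 0)%:R.
  by rewrite -natrD subnK// npoles_mono//; lra.
have {}le_r : fine (nev_T f r) <= r `^ sigma by apply: le_r; lra.
by lra.
Qed.

Lemma card_poles_le_powR (rho sigma : R) : has_order f rho -> rho < sigma -> 0 < sigma ->
  exists K, 0 < K /\ forall x (A : seq C), 1 <= x -> uniq A ->
    (forall a, a \in A -> f a = None /\ cabs a <= x) -> (size A)%:R <= K * x `^ sigma.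
Proof.
move=> ho rs s0; have [x0 [x01 n_le]] := npoles_le_powR ho rs s0.
have n0 := ler0n R (npoles f 0); have nx0 := ler0n R (npoles f x0).
have s3 : 0 <= (3 : R) `^ sigma by exact: powR_ge0.
exists ((npoles f 0)%:R + 2 * 3 `^ sigma + (npoles f x0)%:R + 1).
split=> [|x A x1 uA Ax]; first by lra.
have xs : 1 <= x `^ sigma by rewrite -[leLHS](powRr0 x) ler_powR// ltW.
apply: (@le_trans _ _ (npoles f x)%:R); first by rewrite ler_nat; exact: card_poles_le_npoles.
have [/n_le|/ltW/npoles_mono] := leP x0 x.
  by rewrite powRM//; [nra|lra].
by rewrite -(ler_nat R); nra.
Qed.

Definition far_poles r : set C := [set a | f a = None /\ r <= cabs a].

Lemma far_poles_countable r : countable (far_poles r).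
Proof.
apply: (@sub_countable _ _ _ (\bigcup_n [set a | f a = None /\ cabs a <= n%:R])).
  apply: subset_card_le => a [fa _]; exists (Num.truncn (cabs a)).+1 => //.
  by split=> //; rewrite ltW// truncnS_gt.
apply: bigcup_countable => // n _; exact/finite_set_countable/poles_in_disc_finite.
Qed.

Lemma exprn_powR x (u : R) n : 0 <= x -> (x ^+ n) `^ u = (x `^ u) ^+ n.
Proof. by move=> x0; rewrite -powR_mulrn// powRAC powR_mulrn// powR_ge0. Qed.

Lemma far_poles_shells (lam r : R) : 2 <= lam -> 0 < r -> far_poles r =
  \bigcup_j [set a | f a = None /\ lam ^+ j * r <= cabs a < lam ^+ j.+1 * r].
Proof.
move=> lam2 r0; apply/seteqP; split=> [a [fa ra]|a [j _ [fa /andP[ja _]]]]; last first.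
  by split=> //; apply: le_trans ja; rewrite ler_peMl ?(ltW r0)// exprn_ege1//; lra.
have ex_shell : exists n, cabs a < lam ^+ n * r.
  exists (Num.bound (cabs a / r)); rewrite -ltr_pdivrMr//.
  by apply: (lt_le_trans (upper_nthrootP (leqnn _))); rewrite lerXn2r ?nnegrE//; lra.
have [[|j] jP jmin] := ex_minnP ex_shell; first by move: jP; rewrite mul1r ltNge ra.
exists j => //; split=> //; rewrite jP andbT leNgt; apply/negP => /jmin.
by rewrite ltnn.
Qed.

Lemma shell_sum_le (sigma tau K X lam : R) : 0 < X -> 1 <= lam -> 1 <= lam * X -> 0 <= tau ->
  (forall x (A : seq C), 1 <= x -> uniq A ->
    (forall a, a \in A -> f a = None /\ cabs a <= x) -> (size A)%:R <= K * x `^ sigma) ->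
  (\esum_(a in [set a | f a = None /\ (X <= cabs a < lam * X)%R]) (cabs a `^ (- tau))%:E <=
   (K * lam `^ sigma * X `^ (sigma - tau))%:E)%E.
Proof.
move=> X0 lam1 lamX tau0 count; set shell := mkset _.
have fin : finite_set shell.
  apply: sub_finite_set (poles_in_disc_finite merf (lam * X)) => a [fa /andP[_ /ltW aX]].
  by split.
rewrite esum_fset// => [|a _]; last by rewrite lee_fin powR_ge0.
rewrite fsbig_finite// sumEFin lee_fin.
have shellP a : a \in fset_set shell -> [/\ f a = None, X <= cabs a & cabs a <= lam * X].
  by rewrite in_fset_set// => /set_mem[fa /andP[? /ltW ?]].
apply: (@le_trans _ _ (\sum_(a <- fset_set shell) X `^ (- tau))).
  rewrite big_seq [leRHS]big_seq; apply: ler_sum => a /shellP[_ Xa _].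
  rewrite !powRN lef_pV2 ?posrE ?powR_gt0 ?(lt_le_trans X0)//.
  by apply: ge0_ler_powR; rewrite ?nnegrE ?cabs_ge0 ?(ltW X0).
rewrite big_const_seq count_predT iter_addr_0 -[leLHS]mulr_natl.
rewrite powRD; last by apply/implyP => _; rewrite gt_eqF.
have -> : K * lam `^ sigma * (X `^ sigma * X `^ (- tau)) = K * (lam * X) `^ sigma * X `^ (- tau).
  by rewrite (powRM _ (le_trans ler01 lam1) (ltW X0)); ring.
rewrite ler_wpM2r ?powR_ge0//; apply: count => //; first exact: fset_uniq.
by move=> a /shellP[].
Qed.

Lemma exists_powR_le_half (u : R) : 0 < u -> exists lam : R, 2 <= lam /\ lam `^ (- u) <= 2^-1.
Proof.
move=> u0; exists (2 `^ (1 + u^-1)); split.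
  by rewrite -[leLHS](@powRr1 _ 2)// ler_powR ?ler1n// lerDl invr_ge0 ltW.
rewrite -powRrM -[leRHS]powR_inv1// ler_powR ?ler1n//.
by rewrite mulrN lerN2 mulrDl mul1r mulVf ?gt_eqF// lerDr ltW.
Qed.

(* Cut into shells lam^j r <= |a| < lam^(j+1) r, with lam so large that the shell
   sums decrease at least like 2^-j. *)
Lemma far_poles_sum_small (rho tau e : R) : has_order f rho -> 0 < rho -> rho < tau -> 0 < e ->
  exists r0, 1 <= r0 /\ forall r, r0 <= r ->
    (\esum_(a in far_poles r) (cabs a `^ (- tau))%:E <= e%:E)%E.
Proof.
move=> ho rho0 rt e0; pose sigma := (rho + tau) / 2; pose u := tau - sigma.
have s0 : 0 < sigma by rewrite /sigma; lra.
have rs : rho < sigma by rewrite /sigma; lra.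
have u0 : 0 < u by rewrite /u /sigma; lra.
have [K [K0 count]] := card_poles_le_powR ho rs s0.
have [lam [lam2 lamu]] := exists_powR_le_half u0; have lam0 : 0 < lam by lra.
pose D := 2 * K * lam `^ sigma / e.
have D0 : 0 < D by rewrite divr_gt0// !mulr_gt0// powR_gt0.
exists (Num.max 1 (D `^ u^-1)); split=> [|r]; first by rewrite le_max lexx.
rewrite ge_max => /andP[r1 rD]; have r0 : 0 < r by lra.
have first_shell : K * lam `^ sigma * r `^ (- u) <= e / 2.
  have Dr : D <= r `^ u.
    rewrite -[leLHS](@powRr1 _ D) ?(ltW D0)// -(@mulVf _ u) ?gt_eqF// powRrM.
    by apply: ge0_ler_powR; rewrite ?nnegrE ?powR_ge0 ?(ltW r0) ?(ltW u0).
  rewrite powRN ler_pdivrMr ?powR_gt0//; move: Dr; rewrite /D ler_pdivrMr//; lra.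
rewrite (far_poles_shells lam2 r0).
rewrite esum_bigcupT => [|i j _ _ [a [[_ /andP[ia ai]] [_ /andP[ja aj]]]]|a]; first last.
- by rewrite lee_fin powR_ge0.
- have lam1 : 1 < lam by lra.
  have ij : (i < j.+1)%N by rewrite -(@ltr_eXn2l _ lam)// -(ltr_pM2r r0) (le_lt_trans ia aj).
  have ji : (j < i.+1)%N by rewrite -(@ltr_eXn2l _ lam)// -(ltr_pM2r r0) (le_lt_trans ja ai).
  by apply/eqP; rewrite eqn_leq -ltnS ij -ltnS.
apply: (@le_trans _ _ (\esum_(j in [set: nat]) (e / (2 ^ j.+1)%:R)%:E)); last first.
  rewrite -nneseries_esumT => [|j]; last by rewrite lee_fin divr_ge0// ltW.
  by apply: epsilon_trick0; exact: ltW.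
apply: le_esum => j _; pose X := lam ^+ j * r.
have X0 : 0 < X by rewrite mulr_gt0// exprn_gt0.
have X1 : 1 <= lam * X.
  rewrite /X mulrA -exprS -[leLHS]mulr1 ler_pM// exprn_ege1//; lra.
have := shell_sum_le X0 (_ : 1 <= lam) X1 (_ : 0 <= tau) count.
rewrite /X mulrA -exprS => /(_ _ _)shell_le; apply: (le_trans (shell_le _ _)); [lra|lra|].
have -> : sigma - tau = - u by rewrite /u; ring.
rewrite lee_fin powRM ?exprn_ge0 ?(ltW lam0) ?(ltW r0)// exprn_powR ?(ltW lam0)//.
have -> : K * lam `^ sigma * ((lam `^ (- u)) ^+ j * r `^ (- u)) =
  (lam `^ (- u)) ^+ j * (K * lam `^ sigma * r `^ (- u)) by ring.
have -> : e / (2 ^ j.+1)%:R = (2^-1) ^+ j * (e / 2).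
  by rewrite natrX exprS exprVn; field; rewrite expf_neq0.
apply: ler_pM; rewrite ?exprn_ge0 ?powR_ge0//; first by rewrite !mulr_ge0 ?powR_ge0// ltW.
by rewrite lerXn2r ?nnegrE ?powR_ge0// invr_ge0.
Qed.

End Counting.

(** * Geometry of a pole *)

Section Roots.
Variable R : realType.
Implicit Types (x y : R) (m : nat).

Lemma exprn_rootK x m : (0 < m)%N -> 0 <= x -> (x ^+ m) `^ m%:R^-1 = x.
Proof.
move=> m0 x0; rewrite -powR_mulrn// -powRrM mulfV ?powRr1//.
by rewrite pnatr_eq0 -lt0n.
Qed.

Lemma ler_root x y m : (0 < m)%N -> 0 <= x -> x ^+ m <= y -> x <= y `^ m%:R^-1.
Proof.
move=> m0 x0 xy; have xm0 : 0 <= x ^+ m by exact: exprn_ge0.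
rewrite -[leLHS](exprn_rootK m0 x0); apply: ge0_ler_powR => //.
by rewrite nnegrE (le_trans xm0).
Qed.

Lemma root_le_self x m : (0 < m)%N -> 1 <= x -> x `^ m%:R^-1 <= x.
Proof.
move=> m0 x1; rewrite -[leRHS]powRr1 ?(le_trans ler01)//.
by rewrite ler_powR// invf_le1 ?ltr0n// ler1n.
Qed.

End Roots.

Section Cells.
Variable R : realType.
Local Notation C := (R[i]).
Implicit Types (z w : C) (s h t : R).

Lemma interval_cells s h N : 0 < h -> 2 * s / h < N%:R -> exists cell : R -> nat,
  (forall t, `|t| <= s -> (cell t < N)%N) /\
  (forall t t', `|t| <= s -> `|t'| <= s -> cell t = cell t' -> `|t - t'| <= h).
Proof.
move=> h0 shN; exists (fun t => Num.truncn ((t + s) / h)).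
split=> [t|t t']; rewrite !ler_norml.
  move=> ts; rewrite truncn_lt_nat ?divr_ge0//; [|lra|lra].
  by apply: le_lt_trans shN; rewrite ler_pM2r ?invr_gt0//; lra.
move=> ts t's cell_eq.
have /truncn_itv/andP[] : 0 <= (t + s) / h by rewrite divr_ge0//; lra.
have /truncn_itv/andP[] : 0 <= (t' + s) / h by rewrite divr_ge0//; lra.
by rewrite cell_eq -natr1 !ler_pdivlMr// !ltr_pdivrMr//; lra.
Qed.

Lemma square_cells s h N : 0 < h -> 2 * s / h < N%:R -> exists cell : C -> nat,
  (forall z, cabs z <= s -> (cell z < N * N)%N) /\
  (forall z w, cabs z <= s -> cabs w <= s -> cell z = cell w -> cabs (z - w) <= 2 * h).
Proof.
move=> h0 shN; have [cell [cellN cell_dist]] := interval_cells h0 shN.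
have inRe z : cabs z <= s -> `|complex.Re z| <= s by exact/le_trans/Re_le_cabs.
have inIm z : cabs z <= s -> `|complex.Im z| <= s by exact/le_trans/Im_le_cabs.
exists (fun z => cell (complex.Re z) * N + cell (complex.Im z))%N; split=> [z zs|z w zs ws].
  rewrite (@leq_trans ((cell (complex.Re z)).+1 * N)%N)//.
    by rewrite mulSn addnC ltn_add2r cellN ?inIm.
  by rewrite leq_mul2r cellN ?orbT ?inRe.
have [zN wN] := (cellN _ (inIm _ zs), cellN _ (inIm _ ws)).
have N0 : (0 < N)%N by apply: leq_ltn_trans zN.
move=> cell_eq; have Re_eq : cell (complex.Re z) = cell (complex.Re w).
  have := congr1 (fun n => n %/ N)%N cell_eq; rewrite /= !divnMDl//.
  by rewrite !divn_small// !addn0.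
have Im_eq : cell (complex.Im z) = cell (complex.Im w).
  by have := congr1 (fun n => n %% N)%N cell_eq; rewrite /= !modnMDl !modn_small.
rewrite (le_trans (cabs_le_ReIm _))// cReB cImB mulr2n mulrDl !mul1r.
by rewrite lerD ?cell_dist ?inRe ?inIm.
Qed.

Lemma countable_cells h : 0 < h -> exists cell : C -> nat,
  forall z w, cell z = cell w -> cabs (z - w) < h.
Proof.
move=> h0; pose q := 2 / h; have q0 : 0 < q by rewrite divr_gt0.
have floor_dist t t' : Num.floor (t * q) = Num.floor (t' * q) -> `|t - t'| < h / 2.
  move=> floor_eq; have /andP[] := floor_itv (t' * q); have /andP[] := floor_itv (t * q).
  rewrite floor_eq intrD => low up low' up'; have -> : h / 2 = q^-1 by rewrite invf_div.
  rewrite -[ltRHS]mul1r ltr_pdivlMr// -[X in _ * X](gtr0_norm q0) -normrM.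
  by rewrite mulrBl ltr_norml; lra.
exists (fun z => choice.pickle (Num.floor (complex.Re z * q), Num.floor (complex.Im z * q))).
move=> z w /(pcan_inj choice.pickleK)[/floor_dist Re_lt /floor_dist Im_lt].
by rewrite (le_lt_trans (cabs_le_ReIm _))// cReB cImB [ltRHS]splitr ltrD.
Qed.

End Cells.

Section PoleConstants.
Variables (R : realType) (K : R) (M : nat).

(* At relative distance affine_ratio from a point near the pole, f is affine up to
   half of its derivative. *)
Definition affine_ratio : R := (256 * K ^+ 2 * 2 ^+ M)^-1.

Definition pole_lipschitz_const : R := 2 * K ^+ 2 * M%:R + 2 / affine_ratio.

Definition pole_cell_count : nat := (Num.truncn (16 * K ^+ 2 / affine_ratio)).+1.

Definition pole_value_bound (r : R) : R := 2 * K * (1 + 2 / r) ^+ M + 1.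

Hypothesis K1 : 1 <= K.

Let K0 : 0 < K. Proof. exact: lt_le_trans ltr01 K1. Qed.

Let denominator_gt0 : 0 < 256 * K ^+ 2 * 2 ^+ M.
Proof. by apply: mulr_gt0; [apply: mulr_gt0; rewrite ?ltr0n ?exprn_gt0|rewrite exprn_gt0]. Qed.

Lemma affine_ratio_gt0 : 0 < affine_ratio.
Proof. by rewrite invr_gt0. Qed.

Lemma affine_ratio_le : affine_ratio <= 1 / 4.
Proof.
rewrite /affine_ratio -[leLHS]mul1r ler_pdivrMr//.
have : 1 <= K ^+ 2 by rewrite exprn_ege1.
have : 1 <= (2 : R) ^+ M by rewrite exprn_ege1// ler1n.
by move: (K ^+ 2) (2 ^+ M) => k t; nra.
Qed.

Lemma pole_lipschitz_const_gt0 : 0 < pole_lipschitz_const.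
Proof.
rewrite ltr_wpDl ?divr_gt0 ?affine_ratio_gt0//.
by rewrite mulr_ge0// mulr_ge0// exprn_ge0// ltW.
Qed.

Lemma pole_value_bound_gt0 (r : R) : 0 < r -> 0 < pole_value_bound r.
Proof.
move=> r0; rewrite ltr_wpDl//.
by rewrite !mulr_ge0 ?exprn_ge0 ?addr_ge0 ?divr_ge0// ltW.
Qed.

End PoleConstants.

Section PoleModel.
Variable R : realType.
Local Notation C := (R[i]).
Implicit Types (f : C -> option C) (a z w x y : C).

Definition pole_growth f a (m : nat) (b K r : R) := forall z,
  cabs (z - a) < r -> z != a ->
  [/\ K^-1 * (b / cabs (z - a) ^+ m) <= cabs (fv f z),
      cabs (fv f z) <= K * (b / cabs (z - a) ^+ m),
      K^-1 * (m%:R * b / cabs (z - a) ^+ m.+1) <= cabs (cderiv (fv f) z) &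
      cabs (cderiv (fv f) z) <= K * (m%:R * b / cabs (z - a) ^+ m.+1)].

Record pole_model f a (m M : nat) (b K r : R) : Prop := PoleModel {
  pole_model_meromorphic : meromorphic f;
  pole_model_pole : f a = None;
  pole_model_radius : 0 < r;
  pole_model_isolated : forall z, cabs (z - a) < r -> z != a -> f z <> None;
  pole_model_mult : (0 < m <= M)%N;
  pole_model_scale : 0 < b;
  pole_model_const : 1 <= K;
  pole_model_growth : pole_growth f a m b K r }.

Definition pole_layer f a (r V : R) : set C :=
  [set z | [/\ z != a, cabs (z - a) < r, V <= cabs (fv f z) & cabs (fv f z) <= 4 * V]].

Variables (f : C -> option C) (a : C) (m M : nat) (b K r : R).
Hypothesis model : pole_model f a m M b K r.

Local Notation eta := (affine_ratio K M).

Let merf : meromorphic f. Proof. exact: pole_model_meromorphic model. Qed.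
Let fa : f a = None. Proof. exact: pole_model_pole model. Qed.
Let r0 : 0 < r. Proof. exact: pole_model_radius model. Qed.
Let iso z : cabs (z - a) < r -> z != a -> f z <> None.
Proof. exact: pole_model_isolated model z. Qed.
Let m0 : (0 < m)%N. Proof. by have /andP[] := pole_model_mult model. Qed.
Let mM : (m <= M)%N. Proof. by have /andP[] := pole_model_mult model. Qed.
Let m1R : 1 <= m%:R :> R. Proof. by rewrite ler1n m0. Qed.
Let b0 : 0 < b. Proof. exact: pole_model_scale model. Qed.
Let K1 : 1 <= K. Proof. exact: pole_model_const model. Qed.
Let K0 : 0 < K. Proof. exact: lt_le_trans ltr01 K1. Qed.
Let growth : pole_growth f a m b K r. Proof. exact: pole_model_growth model. Qed.
Let eta0 : 0 < eta. Proof. exact: affine_ratio_gt0 K1. Qed.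
Let eta_le4 : eta <= 1 / 4. Proof. exact: affine_ratio_le K1. Qed.

Lemma pole_cderivable z : cabs (z - a) < r -> z != a -> cderivable (fv f) z.
Proof. by move=> za zna; exact/(meromorphic_cderivable merf)/iso. Qed.

Lemma pole_fv_neq0 z : cabs (z - a) < r -> z != a -> fv f z != 0.
Proof.
move=> zr zna; have [low _ _ _] := growth zr zna; rewrite -cabs_gt0.
by apply: lt_le_trans low; rewrite mulr_gt0 ?invr_gt0 ?divr_gt0 ?exprn_gt0 ?cabs_subr_gt0.
Qed.

Lemma pole_cderiv_ge z : cabs (z - a) < r -> z != a ->
  cabs (fv f z) / K ^+ 2 / cabs (z - a) <= cabs (cderiv (fv f) z).
Proof.
move=> zr zna; have [_ f_le f'_ge _] := growth zr zna; apply: le_trans f'_ge.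
have s0 : 0 < cabs (z - a) by rewrite cabs_subr_gt0.
move: f_le; set s := cabs (z - a) in s0 * => f_le.
have -> : K^-1 * (m%:R * b / s ^+ m.+1) = m%:R * (K * (b / s ^+ m) / K ^+ 2 / s).
  by rewrite exprSr; field; rewrite !gt_eqF ?exprn_gt0.
apply: (@le_trans _ _ (K * (b / s ^+ m) / K ^+ 2 / s)).
  by rewrite ler_pM2r ?invr_gt0// ler_pM2r ?invr_gt0 ?exprn_gt0.
by rewrite ler_peMl// !mulr_ge0 ?invr_ge0 ?exprn_ge0// ltW.
Qed.

Lemma pole_cderiv_neq0 z : cabs (z - a) < r -> z != a -> cderiv (fv f) z != 0.
Proof.
move=> zr zna; rewrite -cabs_gt0; apply: lt_le_trans (pole_cderiv_ge zr zna).
by rewrite !divr_gt0 ?exprn_gt0 ?cabs_subr_gt0// cabs_gt0 pole_fv_neq0.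
Qed.

Lemma pole_dist_le z V : cabs (z - a) < r -> z != a -> 0 < V -> V <= cabs (fv f z) ->
  cabs (z - a) ^+ m <= K * b / V /\ cabs (z - a) <= (K * b / V) `^ m%:R^-1.
Proof.
move=> zr zna V0 Vz; have [_ f_le _ _] := growth zr zna.
have dist_m : cabs (z - a) ^+ m <= K * b / V.
  rewrite ler_pdivlMr// mulrC -ler_pdivlMr ?exprn_gt0 ?cabs_subr_gt0//.
  by rewrite -mulrA; exact: le_trans Vz f_le.
by split=> //; apply: ler_root => //; exact: cabs_ge0.
Qed.

Lemma pole_dist_ge z W : cabs (z - a) < r -> z != a -> cabs (fv f z) <= W ->
  b / cabs (z - a) ^+ m <= K * W /\ (cabs (z - a))^-1 <= (K * W / b) `^ m%:R^-1.
Proof.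
move=> zr zna zW; have [f_ge _ _ _] := growth zr zna.
have inv_le : b / cabs (z - a) ^+ m <= K * W by rewrite -ler_pdivrMl// (le_trans f_ge).
split=> //; apply: ler_root; rewrite ?invr_ge0 ?cabs_ge0//.
by rewrite exprVn ler_pdivlMr// mulrC.
Qed.

Lemma near_off_pole z0 z : z0 != a -> cabs (z0 - a) <= r / 2 ->
  cabs (z - z0) <= cabs (z0 - a) / 2 ->
  [/\ cabs (z0 - a) / 2 <= cabs (z - a), cabs (z - a) < r & z != a].
Proof.
move: r0 => r_gt0; rewrite -cabs_subr_gt0 => z0a z0r zz0.
have := cabs_distD z0 z a; have := cabs_distD z z0 a; rewrite (cabs_distC z0 z) => low up.
by split; [lra|lra|rewrite -cabs_subr_gt0; lra].
Qed.

Lemma pole_curvature_le z0 : z0 != a -> cabs (z0 - a) <= r / 2 ->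
  16 * (K * (b / (cabs (z0 - a) / 2) ^+ m)) / (cabs (z0 - a) / 2) ^+ 2 *
    (2 * eta * cabs (z0 - a)) <= cabs (cderiv (fv f) z0) / 2.
Proof.
move: r0 => r_gt0 z0na z0r; have s0 : 0 < cabs (z0 - a) by rewrite cabs_subr_gt0.
have z0r' : cabs (z0 - a) < r by lra.
have [_ _ f'_ge _] := growth z0r' z0na.
move: f'_ge s0; set s := cabs (z0 - a) => f'_ge s0.
apply: (@le_trans _ _ (K^-1 * (m%:R * b / s ^+ m.+1) / 2)); last by lra.
have -> : 16 * (K * (b / (s / 2) ^+ m)) / (s / 2) ^+ 2 * (2 * eta * s) =
    128 * K * 2 ^+ m * eta * (b / (s ^+ m * s)).
  by rewrite expr_div_n; field; rewrite !gt_eqF ?exprn_gt0.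
have -> : K^-1 * (m%:R * b / s ^+ m.+1) / 2 = (2 * K)^-1 * m%:R * (b / (s ^+ m * s)).
  by rewrite exprSr; field; rewrite !gt_eqF ?exprn_gt0.
have -> : (2 * K)^-1 = 128 * K * 2 ^+ M * eta.
  by rewrite /affine_ratio; field; rewrite !gt_eqF ?exprn_gt0.
rewrite ler_wpM2r ?divr_ge0 ?mulr_ge0 ?exprn_ge0 ?(ltW b0) ?(ltW s0)//.
rewrite (@le_trans _ _ (128 * K * 2 ^+ M * eta))//.
  by rewrite ler_pM2r// ler_pM2l ?mulr_gt0// ler_weXn2l// ler1n.
by rewrite ler_peMr// !mulr_ge0 ?exprn_ge0// ltW.
Qed.

Lemma pole_nearly_affine z0 x y : z0 != a -> cabs (z0 - a) <= r / 2 ->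
  cabs (x - z0) <= eta * cabs (z0 - a) -> cabs (y - z0) <= eta * cabs (z0 - a) ->
  cabs (fv f x - fv f y - cderiv (fv f) z0 * (x - y)) <=
  cabs (cderiv (fv f) z0) / 2 * cabs (x - y).
Proof.
move: eta_le4 => eta4 z0na z0r xz0 yz0; have s0 : 0 < cabs (z0 - a) by rewrite cabs_subr_gt0.
have s20 : 0 < cabs (z0 - a) / 2 by lra.
pose B := K * (b / (cabs (z0 - a) / 2) ^+ m).
have B0 : 0 <= B by rewrite mulr_ge0 ?divr_ge0 ?exprn_ge0// ltW.
have le_B z : cabs (z - z0) <= cabs (z0 - a) / 2 -> cabs (fv f z) <= B.
  move=> /(near_off_pole z0na z0r)[sz zr zna]; have [_ f_le _ _] := growth zr zna.
  rewrite (le_trans f_le)// ler_pM2l// ler_pM2l// lef_pV2 ?posrE ?exprn_gt0//; last by lra.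
  by rewrite lerXn2r ?nnegrE ?cabs_ge0// ltW.
have half_eta : eta * cabs (z0 - a) <= cabs (z0 - a) / 2 / 2 by nra.
have der z : cabs (z - z0) <= cabs (z0 - a) / 2 -> cderivable (fv f) z.
  by move=> /(near_off_pole z0na z0r)[_ zr zna]; exact: pole_cderivable.
have := disc_second_order s20 B0 der le_B (le_trans xz0 half_eta) (le_trans yz0 half_eta).
move=> /le_trans; apply; rewrite ler_wpM2r ?cabs_ge0//.
apply: le_trans (pole_curvature_le z0na z0r).
have coef0 : 0 <= 16 * B / (cabs (z0 - a) / 2) ^+ 2 by rewrite divr_ge0 ?sqr_ge0// mulr_ge0.
by apply: ler_wpM2l => //; lra.
Qed.

Lemma pole_expanding z0 x y : z0 != a -> cabs (z0 - a) <= r / 2 ->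
  cabs (x - z0) <= eta * cabs (z0 - a) -> cabs (y - z0) <= eta * cabs (z0 - a) ->
  cabs (cderiv (fv f) z0) / 2 * cabs (x - y) <= cabs (fv f x - fv f y).
Proof.
move=> z0na z0r xz0 yz0; have := pole_nearly_affine z0na z0r xz0 yz0.
have := cabsB_ge (cderiv (fv f) z0 * (x - y)) (fv f x - fv f y).
by rewrite cabsM (cabs_distC (cderiv (fv f) z0 * (x - y))); lra.
Qed.

Lemma pole_distortion z0 x y : z0 != a -> cabs (z0 - a) <= r / 2 ->
  cabs (x - z0) <= eta * cabs (z0 - a) -> cabs (y - z0) <= eta * cabs (z0 - a) ->
  cabs (fv f x - fv f y) <= 2 * cabs (cderiv (fv f) z0) * cabs (x - y).
Proof.
move=> z0na z0r xz0 yz0; have := pole_nearly_affine z0na z0r xz0 yz0.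
have := cabsB_ge (fv f x - fv f y) (cderiv (fv f) z0 * (x - y)).
have : 0 <= cabs (cderiv (fv f) z0) * cabs (x - y) by rewrite mulr_ge0 ?cabs_ge0.
by rewrite cabsM; lra.
Qed.

Let radius_ge0 z : 0 <= eta * cabs (z - a).
Proof. by rewrite mulr_ge0 ?cabs_ge0// ltW. Qed.

Lemma pole_lipschitz_near x y W : x != a -> cabs (x - a) <= r / 2 -> 0 < W ->
  cabs (fv f x) <= W -> cabs (x - y) <= eta * cabs (x - a) ->
  cabs (fv f x - fv f y) <=
  2 * K ^+ 2 * M%:R * W * (K * W / b) `^ m%:R^-1 * cabs (x - y).
Proof.
move: r0 => r_gt0 xna xr W0 xW xy; have xr' : cabs (x - a) < r by lra.
have := pole_distortion (x := x) (y := y) xna xr.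
rewrite subrr cabs0 (cabs_distC y) => /(_ (radius_ge0 x) xy)/le_trans; apply.
rewrite ler_wpM2r ?cabs_ge0//; have [_ _ _ f'_le] := growth xr' xna.
have [] := pole_dist_ge xr' xna xW; set T := _ `^ _; move: f'_le.
have : 0 < cabs (x - a) by rewrite cabs_subr_gt0.
set s := cabs (x - a) => s0 f'_le bs_le s_ge.
have ratio_le : m%:R * b / s ^+ m.+1 <= M%:R * (K * W * T).
  have -> : m%:R * b / s ^+ m.+1 = m%:R * ((b / s ^+ m) * s^-1).
    by rewrite exprSr; field; rewrite !gt_eqF ?exprn_gt0.
  apply: ler_pM; rewrite ?ler_nat//.
    by rewrite mulr_ge0 ?divr_ge0 ?exprn_ge0 ?invr_ge0// ltW.
  by apply: ler_pM; rewrite ?divr_ge0 ?exprn_ge0 ?invr_ge0// ltW.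
have -> : 2 * K ^+ 2 * M%:R * W * T = 2 * (K * (M%:R * (K * W * T))) by ring.
by rewrite ler_pM2l// (le_trans f'_le)// ler_pM2l.
Qed.

Lemma pole_lipschitz_far x y W : x != a -> cabs (x - a) < r -> 0 < W ->
  cabs (fv f x) <= W -> cabs (fv f y) <= W -> eta * cabs (x - a) < cabs (x - y) ->
  cabs (fv f x - fv f y) <= 2 / eta * W * (K * W / b) `^ m%:R^-1 * cabs (x - y).
Proof.
move=> xna xr W0 xW yW far; have s0 : 0 < cabs (x - a) by rewrite cabs_subr_gt0.
have [_ s_ge] := pole_dist_ge xr xna xW; set T := _ `^ _ in s_ge *.
have T0 : 0 < T by apply: lt_le_trans s_ge; rewrite invr_gt0.
rewrite (le_trans (cabsB_le _ _))// (@le_trans _ _ (2 * W))//; first by lra.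
have -> : 2 / eta * W * T * cabs (x - y) = 2 * W * (T * (cabs (x - y) / eta)).
  by field; rewrite gt_eqF.
rewrite ler_peMr ?mulr_ge0 ?(ltW W0)//.
apply: (@le_trans _ _ (T * cabs (x - a))).
  by rewrite mulrC -ler_pdivrMl// mulr1.
by rewrite ler_pM2l// ler_pdivlMr// mulrC ltW.
Qed.

Lemma pole_lipschitz x y W : x != a -> cabs (x - a) <= r / 2 ->
  0 < W -> cabs (fv f x) <= W -> cabs (fv f y) <= W ->
  cabs (fv f x - fv f y) <=
  pole_lipschitz_const K M * W * (K * W / b) `^ m%:R^-1 * cabs (x - y).
Proof.
move: r0 => r_gt0 xna xr W0 xW yW; set T := _ `^ _.
have WT0 : 0 <= W * (T * cabs (x - y)) by rewrite !mulr_ge0 ?powR_ge0 ?cabs_ge0// ltW.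
rewrite /pole_lipschitz_const -2!mulrA mulrDl.
have [near|far] := leP (cabs (x - y)) (eta * cabs (x - a)).
  have := pole_lipschitz_near xna xr W0 xW near; rewrite -/T -2!mulrA => /le_trans; apply.
  by rewrite lerDl mulr_ge0// divr_ge0// ltW.
have xr' : cabs (x - a) < r by lra.
have := pole_lipschitz_far xna xr' W0 xW yW far; rewrite -/T -2!mulrA => /le_trans; apply.
by rewrite lerDr mulr_ge0// mulr_ge0// mulr_ge0// sqr_ge0.
Qed.

Lemma pole_inverse_lipschitz x y V : x != a -> cabs (x - a) <= r / 2 ->
  0 < V -> V <= cabs (fv f x) -> cabs (x - y) <= eta * cabs (x - a) ->
  cabs (x - y) <= 2 * K ^+ 2 / V * (K * b / V) `^ m%:R^-1 * cabs (fv f x - fv f y).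
Proof.
move: r0 => r_gt0 xna xr V0 xV xy; have xr' : cabs (x - a) < r by lra.
have := pole_expanding (x := x) (y := y) xna xr.
rewrite subrr cabs0 (cabs_distC y) => /(_ (radius_ge0 x) xy) expanding.
have [_ s_le] := pole_dist_le xr' xna V0 xV.
have s0 : 0 < cabs (x - a) by rewrite cabs_subr_gt0.
have T0 : 0 < (K * b / V) `^ m%:R^-1 by exact: lt_le_trans s_le.
move: s_le T0; set T := _ `^ _ => s_le T0.
have f'_ge : V / K ^+ 2 / T <= cabs (cderiv (fv f) x).
  apply: le_trans (pole_cderiv_ge xr' xna).
  apply: ler_pM; rewrite ?divr_ge0 ?invr_ge0 ?exprn_ge0 ?(ltW K0) ?(ltW V0) ?(ltW T0)//.
    by rewrite ler_pM2r// invr_gt0 exprn_gt0.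
  by rewrite lef_pV2.
have -> : 2 * K ^+ 2 / V * T * cabs (fv f x - fv f y) =
    2 * cabs (fv f x - fv f y) / (V / K ^+ 2 / T).
  by field; rewrite !gt_eqF.
rewrite ler_pdivlMr ?divr_gt0 ?exprn_gt0//.
apply: (@le_trans _ _ (cabs (x - y) * cabs (cderiv (fv f) x))); last by lra.
by rewrite ler_wpM2l ?cabs_ge0.
Qed.

Lemma pole_cells V : 0 < V -> exists cell : C -> nat,
  (forall x, pole_layer f a r V x -> (cell x < pole_cell_count K M * pole_cell_count K M)%N) /\
  (forall x y, pole_layer f a r V x -> pole_layer f a r V y -> cell x = cell y ->
     cabs (x - y) <= eta * cabs (x - a)).
Proof.
move=> V0; pose s := (K * b / V) `^ m%:R^-1; pose T := (K * (4 * V) / b) `^ m%:R^-1.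
have T0 : 0 < T by rewrite powR_gt0// !divr_gt0// !mulr_gt0.
have sT : s * T <= 4 * K ^+ 2.
  rewrite -powRM ?divr_ge0 ?mulr_ge0 ?(ltW K0) ?(ltW b0) ?(ltW V0)//.
  have -> : K * b / V * (K * (4 * V) / b) = 4 * K ^+ 2 by field; rewrite !gt_eqF.
  by apply: root_le_self => //; have : 1 <= K ^+ 2 by [rewrite exprn_ege1]; lra.
pose h := eta / T / 2; have h0 : 0 < h by rewrite !divr_gt0.
have [|cell [cellN cell_dist]] := @square_cells R s h (pole_cell_count K M) h0.
  apply: le_lt_trans (truncnS_gt _).
  have -> : 2 * s / h = 4 * (s * T) / eta by rewrite /h; field; rewrite !gt_eqF.
  have : 0 < eta^-1 by rewrite (invr_gt0 eta).
  by move=> /ler_pM2r ->; lra.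
have in_disc x : pole_layer f a r V x -> cabs (x - a) <= s.
  by move=> [xna xr xV _]; have [] := pole_dist_le xr xna V0 xV.
exists (fun x => cell (x - a)); split=> [x /in_disc/cellN//|x y Vx Vy same_cell].
have -> : x - y = (x - a) - (y - a) by ring.
apply: le_trans (cell_dist _ _ (in_disc x Vx) (in_disc y Vy) same_cell) _.
have [xna xr _ xV] := Vx; have [_ s_ge] := pole_dist_ge xr xna xV.
have -> : 2 * h = eta / T by rewrite /h; field; rewrite gt_eqF.
by rewrite ler_pM2l// invf_ple ?posrE ?cabs_subr_gt0.
Qed.

Hypothesis b1 : b <= 1.

Lemma pole_circle_le z : cabs (z - a) = r / 2 -> cabs (fv f z) <= K * (1 + 2 / r) ^+ M.
Proof.
move: r0 => r_gt0 zr; have zr' : cabs (z - a) < r by lra.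
have zna : z != a by rewrite -cabs_subr_gt0 zr; lra.
have q1 : 1 <= 1 + 2 / r by rewrite lerDl divr_ge0// ltW.
have [_ f_le _ _] := growth zr' zna.
rewrite (le_trans f_le)// ler_pM2l// zr -[leRHS]mul1r.
apply: ler_pM => //; [exact: ltW|by rewrite invr_ge0 exprn_ge0 ?divr_ge0// ltW|].
rewrite -exprVn invf_div (@le_trans _ _ ((1 + 2 / r) ^+ m))//.
  rewrite lerXn2r ?nnegrE ?lerDr ?divr_ge0 ?(ltW r0)//; exact: le_trans q1.
by rewrite ler_weXn2l.
Qed.

(* A zero of 1/f - 1/w in the half disc: at the pole 1/f vanishes, on the circle it
   is bounded below. *)
Lemma pole_value w : pole_value_bound K M r <= cabs w ->
  exists z, [/\ cabs (z - a) < r / 2, z != a & fv f z = w].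
Proof.
move: r0 => r_gt0 w_ge; have w0 : 0 < cabs w.
  by apply: lt_le_trans w_ge; exact: pole_value_bound_gt0.
pose q := K * (1 + 2 / r) ^+ M; have q0 : 0 < q.
  by rewrite mulr_gt0 ?exprn_gt0// ltr_pwDl// divr_ge0// ltW.
have w_inv : (cabs w)^-1 < q^-1 - (cabs w)^-1.
  have : (cabs w)^-1 < (2 * q)^-1.
    rewrite ltf_pV2 ?posrE//; last by lra.
    by apply: lt_le_trans w_ge; rewrite /pole_value_bound -mulrA -/q ltrDl.
  by rewrite invfM; lra.
have bound0 : 0 < q^-1 - (cabs w)^-1 by apply: lt_trans w_inv; rewrite invr_gt0.
have [||||z [zr /eqP]] := @disc_zero R (fun z => inv_fv f z - w^-1) a (r / 2) _ a bound0.
- move=> z zr; apply: cderivableB (@cderivable_cst R _ _).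
  have [->|zna] := eqVneq z a; first exact: cderivable_inv_fv_pole.
  have zr' : cabs (z - a) < r by lra.
  by apply: (cderivable_inv_fv_regular merf); [exact: iso|exact: pole_fv_neq0].
- move=> z zr; rewrite (le_trans _ (cabsB_ge _ _))// (cabsV w) lerD2r.
  have zr' : cabs (z - a) < r by lra.
  have zna : z != a by rewrite -cabs_subr_gt0 zr; lra.
  rewrite inv_fv_regular; last exact: iso.
  by rewrite cabsV lef_pV2 ?posrE ?cabs_gt0 ?pole_fv_neq0//; exact: pole_circle_le.
- by rewrite subrr cabs0; lra.
- by rewrite inv_fv_pole// sub0r cabsN cabsV.
rewrite subr_eq0 => /eqP inv_eq; have zna : z != a.
  apply/eqP => za; move: inv_eq; rewrite za inv_fv_pole// => /esym/eqP.
  by rewrite invr_eq0 -cabs_eq0 gt_eqF.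
exists z; split=> //; have zr' : cabs (z - a) < r by lra.
by apply: invr_inj; rewrite -inv_eq inv_fv_regular//; exact: iso.
Qed.

Lemma pole_covers_disc z0 : z0 != a -> cabs (z0 - a) <= r / 2 -> forall w,
  cabs (w - fv f z0) < eta / (4 * K ^+ 2) * cabs (fv f z0) ->
  exists z, cabs (z - z0) < eta * cabs (z0 - a) /\ fv f z = w.
Proof.
move: r0 eta_le4 => r_gt0 eta4 z0na z0r w w_near.
have z0r' : cabs (z0 - a) < r by lra.
have s0 : 0 < cabs (z0 - a) by rewrite cabs_subr_gt0.
have := pole_cderiv_ge z0r' z0na; set f' := cabs (cderiv _ _) => f'_ge.
pose D := f' / 2 * (eta * cabs (z0 - a)).
have w_near' : cabs (w - fv f z0) < D / 2.
  apply: (lt_le_trans w_near).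
  have -> : eta / (4 * K ^+ 2) * cabs (fv f z0) =
      cabs (fv f z0) / K ^+ 2 / cabs (z0 - a) / 2 * (eta * cabs (z0 - a)) / 2.
    by field; rewrite !gt_eqF.
  by rewrite ler_pM2r// ler_pM2r ?mulr_gt0// ler_pM2r.
have dist0 := cabs_ge0 (w - fv f z0); have es0 : 0 < eta * cabs (z0 - a) by rewrite mulr_gt0.
have [|||||z [zz0 /eqP]] := @disc_zero R (fun z => fv f z - w) z0 (eta * cabs (z0 - a))
    (D - cabs (w - fv f z0)) z0.
- by lra.
- move=> z zz0; apply: cderivableB (@cderivable_cst R _ _).
  have [|_ zr zna] := @near_off_pole z0 z z0na z0r; last exact: pole_cderivable.
  by rewrite (le_trans zz0)//; nra.
- move=> z zz0; have := pole_expanding (x := z) (y := z0) z0na z0r.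
  rewrite subrr cabs0 zz0 => /(_ (lexx _) (ltW es0)); rewrite -/f' -/D.
  by have := cabs_distD w (fv f z) (fv f z0); lra.
- by rewrite subrr cabs0.
- by rewrite cabs_distC; lra.
by rewrite subr_eq0 => /eqP; exists z.
Qed.

Lemma pole_value_close z d : z != a -> cabs (z - a) < r -> 0 < d <= 1 ->
  K < cabs (fv f z) * d ^+ M -> cabs (z - a) < d.
Proof.
move=> zna zr /andP[d0 d1] K_lt; have w0 : 0 < cabs (fv f z) by rewrite cabs_gt0 pole_fv_neq0.
have [dist_m _] := pole_dist_le zr zna w0 (lexx _).
rewrite ltNge; apply/negP => ds; suff : K < K by rewrite ltxx.
apply: (lt_le_trans K_lt); rewrite mulrC -ler_pdivlMr//.
apply: (@le_trans _ _ (d ^+ m)); first by apply: ler_wiXn2l; rewrite // ltW.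
apply: (@le_trans _ _ (cabs (z - a) ^+ m)); first by rewrite lerXn2r ?nnegrE ?cabs_ge0// ltW.
by rewrite (le_trans dist_m)// ler_pM2r ?invr_gt0// ler_piMr// ltW.
Qed.

Lemma copen_right_inverse (U V : set C) (g phi : C -> C) : copen U -> copen V ->
  (forall z z', U z -> U z' -> g z = g z' -> z = z') ->
  (forall y, V y -> [/\ U (phi y), g (phi y) = y & ccontinuous g (phi y)]) ->
  copen (phi @` V).
Proof.
move=> oU oV inj phiP _ [y Vy <-]; have [Uy gy cg] := phiP y Vy.
apply/nbhs_cballP.
have near_V : nbhs (phi y : C^o) (g @^-1` V) by apply: cg; rewrite gy; exact/nbhs_cballP/oV.
have near_U : nbhs (phi y : C^o) U by exact/nbhs_cballP/oU.
apply: (filterS _ (filterI near_V near_U)) => z [Vz Uz].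
by exists (g z) => //; have [Ugz ggz _] := phiP _ Vz; exact: inj.
Qed.

Lemma pole_univalent_branch w D d : pole_value_bound K M r <= cabs w ->
  4 * K ^+ 2 <= cabs w -> 0 < d <= 1 -> K < cabs w * d ^+ M ->
  D <= eta / (4 * K ^+ 2) * cabs w -> exists phi : C -> C,
   [/\ (forall y, cabs (y - w) < D ->
         [/\ cabs (phi y - a) < 2 * d, phi y != a & f (phi y) = Some y]),
       (forall y y', cabs (y - w) < D -> cabs (y' - w) < D ->
         cabs (phi y - phi y') <= cabs (y - y') / 2) &
       (forall V, copen V -> V `<=` cball w D -> copen (phi @` V))].
Proof.
move: r0 eta_le4 => r_gt0 eta4 w_ge w_ge4 d01 K_lt D_le; have /andP[d0 d1] := d01.
have [z0 [z0r z0na z0w]] := pole_value w_ge.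
have z0r' : cabs (z0 - a) < r by lra.
have z0d : cabs (z0 - a) < d by apply: pole_value_close; rewrite ?z0w.
have s0 : 0 < cabs (z0 - a) by rewrite cabs_subr_gt0.
have f'_ge4 : 4 <= cabs (cderiv (fv f) z0).
  apply: le_trans (pole_cderiv_ge z0r' z0na); rewrite z0w ler_pdivlMr// ler_pdivlMr ?exprn_gt0//.
  apply: le_trans w_ge4; rewrite -mulrA ler_pM2l// ler_piMl ?exprn_ge0 ?(ltW K0)//; lra.
pose U := cball z0 (eta * cabs (z0 - a)).
have UP z : U z -> [/\ cabs (z - a) < 2 * d, z != a & f z = Some (fv f z)].
  rewrite /U /cball /= => zz0; have [|_ zr zna] := @near_off_pole z0 z z0na (ltW z0r).
    by rewrite ltW// (lt_le_trans zz0)//; nra.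
  have := cabs_distD z0 z a; split=> //; [nra|exact/some_fv/iso].
have double x y : U x -> U y -> 2 * cabs (x - y) <= cabs (fv f x - fv f y).
  move=> /ltW Ux /ltW Uy; have := pole_expanding z0na (ltW z0r) Ux Uy.
  by have := cabs_ge0 (x - y); nra.
have /choice[phi phiP] : forall y, exists z, cabs (y - w) < D -> U z /\ fv f z = y.
  move=> y; have [yD|] := ltP (cabs (y - w)) D; last by exists 0.
  have [|z zP] := @pole_covers_disc z0 z0na (ltW z0r) y; last by exists z.
  by rewrite z0w (lt_le_trans yD).
exists phi; split=> [y /phiP[Uy fy]|y y' /phiP[Uy fy] /phiP[Uy' fy']|V oV VD].
- by have [? ? fE] := UP _ Uy; rewrite fE fy.
- by have := double _ _ Uy Uy'; rewrite fy fy'; lra.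
apply: (@copen_right_inverse U V (fv f)) oV _ _; first exact: cball_open.
  move=> z z' Uz Uz' fzz'; have := double _ _ Uz Uz'; rewrite fzz' subrr cabs0 => le0.
  by apply/eqP; rewrite -subr_eq0 -cabs_eq0 eq_le cabs_ge0 andbT; lra.
move=> y /VD/phiP[Uy fy]; split=> //; have [_ _ fE] := UP _ Uy.
by apply: (meromorphic_ccontinuous merf); rewrite fE.
Qed.

End PoleModel.

(** * Hausdorff measure *)

Lemma ge0_esumZl_le (R : realType) (T : choiceType) (S : set T) (k : R) (u : T -> \bar R) :
  0 <= k -> (forall x, 0 <= u x)%E ->
  (\esum_(x in S) (k%:E * u x) <= k%:E * \esum_(x in S) u x)%E.
Proof.
move=> k0 u0; apply: ge_ereal_sup => _ [F FS <-].
rewrite -ge0_mule_fsumr// lee_wpmul2l ?lee_fin//.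
by apply: ereal_sup_ubound; exists F.
Qed.

Section Hausdorff.
Variable R : realType.
Local Notation C := (R[i]).
Implicit Types (A B U : set C) (s t d : R) (v : \bar R).

Lemma cdiam_le U d : (forall x y, U x -> U y -> cabs (x - y) <= d) -> (cdiam U <= d%:E)%E.
Proof.
by move=> Ud; apply: ge_ereal_sup => _ [[x y] [/= Ux Uy] <-]; rewrite lee_fin Ud.
Qed.

Lemma cdiam_ge U x y : U x -> U y -> ((cabs (x - y))%:E <= cdiam U)%E.
Proof. by move=> Ux Uy; apply: ereal_sup_ubound; exists (x, y). Qed.

Lemma cdiam_fin U d x : U x -> (cdiam U <= d%:E)%E ->
  cdiam U = (fine (cdiam U))%:E /\ 0 <= fine (cdiam U).
Proof.
move=> Ux Ud; have := cdiam_ge Ux Ux; rewrite subrr cabs0 => diam_ge0.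
have fin : cdiam U \is a fin_num.
  by rewrite ge0_fin_numE// (le_lt_trans Ud) ?ltry.
by rewrite fineK// fine_ge0.
Qed.

Lemma hterm_ge0 s U : (0 <= hterm s U)%E.
Proof. by rewrite /hterm; case: ifP => // _; rewrite lee_fin powR_ge0. Qed.

Lemma hterm_set0 s : hterm s (set0 : set C) = 0%E.
Proof. by rewrite /hterm asboolT. Qed.

Lemma htermE s U x : U x -> hterm s U = (fine (cdiam U) `^ s)%:E.
Proof. by move=> Ux; rewrite /hterm asboolF// => U0; rewrite U0 in Ux. Qed.

Definition hcover s d A v := exists U : nat -> set C,
  [/\ A `<=` \bigcup_i U i, forall i, (cdiam (U i) <= d%:E)%E &
      (\sum_(0 <= i <oo) hterm s (U i) <= v)%E].

Lemma haus_delta_le s d A v : hcover s d A v -> (haus_delta s d A <= v)%E.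
Proof.
by move=> [U [AU Ud Uv]]; apply: le_trans Uv; apply: ereal_inf_lbound; exists U.
Qed.

Lemma haus_delta_ge0 s d A : (0 <= haus_delta s d A)%E.
Proof.
apply: le_ereal_inf_tmp => _ [U _ <-]; apply: nneseries_ge0 => n _ _.
exact: hterm_ge0.
Qed.

Lemma hausdorff0P s A : hausdorff s A = 0%E <->
  forall d e : R, 0 < d -> 0 < e -> hcover s d A e%:E.
Proof.
split=> [null d e d0 e0|covers].
  have : (haus_delta s d A < e%:E)%E.
    apply: (@le_lt_trans _ _ 0%E); last by rewrite lte_fin.
    by rewrite -null; apply: ereal_sup_ubound; exists d.
  by move=> /ereal_inf_lt[_ [U [AU Ud] <-]] /ltW ?; exists U.
apply/eqP; rewrite eq_le; apply/andP; split.
  apply: ge_ereal_sup => _ [d /= d0 <-]; apply/lee_addgt0Pr => e e0.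
  by rewrite add0e; apply: haus_delta_le; exact: covers.
apply: (@le_trans _ _ (haus_delta s 1 A)); first exact: haus_delta_ge0.
by apply: ereal_sup_ubound; exists 1 => //=.
Qed.

Lemma hcover_sub s d d' A B v v' : A `<=` B -> d <= d' -> (v <= v')%E ->
  hcover s d B v -> hcover s d' A v'.
Proof.
move=> AB dd vv [U [BU Ud Uv]]; exists U; split.
- exact: subset_trans BU.
- by move=> i; apply: le_trans (Ud i) _; rewrite lee_fin.
- exact: le_trans vv.
Qed.

Lemma hcover_set0 s d : hcover s d set0 0%E.
Proof.
exists (fun _ => set0); split=> //.
- by move=> i; apply: cdiam_le.
- by rewrite eseries0// => i _ _; rewrite hterm_set0.
Qed.

Lemma hcover_single s d A : A !=set0 -> 0 <= s -> 0 <= d ->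
  (forall x y, A x -> A y -> cabs (x - y) <= d) -> hcover s d A (d `^ s)%:E.
Proof.
move=> [x Ax] s0 d0 Ad.
exists (fun i => if i is 0%N then A else set0); split.
- by move=> z Az; exists 0%N.
- by case=> [|i]; apply: cdiam_le.
- rewrite (nneseries_split _ 1%N); last by move=> k _; exact: hterm_ge0.
  rewrite add0n big_nat1 eseries0 ?adde0; last by case=> // i _ _; rewrite hterm_set0.
  rewrite (htermE _ Ax) lee_fin.
  have Adiam := cdiam_le Ad; have [diamE diam0] := cdiam_fin Ax Adiam.
  by apply: ge0_ler_powR; rewrite ?nnegrE// -lee_fin -diamE.
Qed.

Lemma hcover_bigcup s d (A : nat -> set C) (v : nat -> \bar R) :
  (forall i, hcover s d (A i) (v i)) ->
  hcover s d (\bigcup_i A i) (\sum_(0 <= i <oo) v i)%E.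
Proof.
move=> /choice[U coverU].
have /card_esym/ppcard_eqP[e] := card_nat2.
pose W n := U (e n).1 (e n).2.
exists W; split.
- move=> z [i _ Az]; have [AU _ _] := coverU i; have [j _ Uz] := AU z Az.
  exists (e^-1%FUN (i, j)) => //; rewrite /W.
  have -> : e (e^-1%FUN (i, j)) = (i, j) by rewrite invK ?inE.
  exact: Uz.
- by move=> n; have [_ + _] := coverU (e n).1; exact.
rewrite nneseries_esumT; last by move=> n; exact: hterm_ge0.
rewrite -(@reindex_esum _ _ _ [set: nat] [set: nat * nat] e
    (fun k => hterm s (U k.1 k.2))); last first.
  exact: bij.
rewrite (_ : [set: nat * nat] = [set: nat] `*`` (fun _ => [set: nat])); last first.
  by apply/seteqP; split=> // k.
rewrite -(@esum_esum _ _ _ _ _ (fun i j => hterm s (U i j))); last by move=> *; exact: hterm_ge0.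
rewrite -nneseries_esumT; last by move=> n; apply: esum_ge0 => *; exact: hterm_ge0.
apply: lee_nneseries => [i _ _|i _]; first by apply: esum_ge0 => *; exact: hterm_ge0.
rewrite -nneseries_esumT; last by move=> n; exact: hterm_ge0.
by have [] := coverU i.
Qed.

Lemma hcoverU s d A B v v' : (0 <= v)%E -> (0 <= v')%E ->
  hcover s d A v -> hcover s d B v' -> hcover s d (A `|` B) (v + v')%E.
Proof.
move=> v0 v'0 coverA coverB.
pose AB i := if i is 0%N then A else if i is 1%N then B else set0.
pose vv i := if i is 0%N then v else if i is 1%N then v' else 0%E.
have coverAB i : hcover s d (AB i) (vv i).
  by case: i => [|[|i]] //=; exact: hcover_set0.
apply: hcover_sub (hcover_bigcup coverAB) => //.
  by move=> z [Az|Bz]; [exists 0%N|exists 1%N].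
rewrite (nneseries_split _ 2%N); last by case=> [|[]].
by rewrite add0n big_nat_recr//= big_nat1 eseries0 ?adde0//; case=> // -[].
Qed.

Lemma hcover_cells s d N (cell : C -> nat) A (x : R) : 0 <= x ->
  (forall y, A y -> (cell y < N)%N) ->
  (forall i, hcover s d [set y | A y /\ cell y = i] x%:E) -> hcover s d A (N%:R * x)%:E.
Proof.
move=> x0; elim: N A => [|N IH] A cellN cover.
  by apply: hcover_sub (hcover_set0 s d) => //; [move=> y /cellN|rewrite mul0r].
have below_N : hcover s d [set y | A y /\ (cell y < N)%N] (N%:R * x)%:E.
  apply: IH => [y []//|i]; apply: hcover_sub (cover i) => // y [[Ay _] yi].
  by split.
rewrite -natr1 mulrDl mul1r EFinD.
apply: hcover_sub (hcoverU _ _ below_N (cover N)); rewrite ?lee_fin ?mulr_ge0// => y Ay.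
have := cellN y Ay; rewrite ltnS leq_eqVlt => /orP[/eqP yN|yN]; first by right.
by left.
Qed.

Lemma hcover_countable (T : choiceType) (S : set T) s d (A : T -> set C) (v : T -> \bar R) :
  countable S -> (forall a, 0 <= v a)%E -> (forall a, S a -> hcover s d (A a) (v a)) ->
  hcover s d (\bigcup_(a in S) A a) (\esum_(a in S) v a)%E.
Proof.
move=> /countable_injP[e einj] v0 cover.
pose fiber i : set T := [set a | S a /\ e a = i].
have SE : S = \bigcup_i fiber i.
  by apply/seteqP; split=> [a Sa|a [i _ []//]]; exists (e a).
have cover_fiber i : hcover s d (\bigcup_(a in fiber i) A a) (\esum_(a in fiber i) v a)%E.
  have [[a [Sa ai]]|none] := pselect (exists a, fiber i a).
    have -> : fiber i = [set a].
      apply/seteqP; split=> [b [Sb bi]|_ -> //]; apply: einj; rewrite ?inE//.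
      by rewrite bi.
    by rewrite bigcup_set1 esum_set1//; exact: cover.
  have -> : fiber i = set0 by apply/seteqP; split=> // a ia; apply: none; exists a.
  by rewrite bigcup_set0 esum_set0; exact: hcover_set0.
have := hcover_bigcup cover_fiber; rewrite SE esum_bigcupT//; last first.
  by move=> i j _ _ [a [[_ <-] [_ <-]]].
rewrite nneseries_esumT; last by move=> i; exact: esum_ge0.
apply: hcover_sub => // z [a [i _ ia] Az]; by exists i => //; exists a.
Qed.

Lemma hcover_lipschitz s d L A B (phi : C -> C) v : 0 <= s -> 0 <= L -> 0 <= d ->
  (forall x, A x -> B (phi x)) ->
  (forall x y, A x -> A y -> cabs (x - y) <= L * cabs (phi x - phi y)) ->
  hcover s d B v -> hcover s (L * d) A ((L `^ s)%:E * v)%E.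
Proof.
move=> s0 L0 d0 AB lip [U [BU Ud Uv]].
have dU i x y : U i x -> U i y -> cabs (x - y) <= d.
  by move=> Ux Uy; rewrite -lee_fin; exact: le_trans (cdiam_ge Ux Uy) (Ud i).
exists (fun i => [set x | A x /\ U i (phi x)]); split.
- by move=> x Ax; have [i _ Ui] := BU _ (AB x Ax); exists i.
- move=> i; apply: cdiam_le => x y [Ax Ux] [Ay Uy]; apply: (le_trans (lip _ _ Ax Ay)).
  by rewrite ler_wpM2l// (dU i).
apply: (@le_trans _ _ (\sum_(0 <= i <oo) ((L `^ s)%:E * hterm s (U i)))%E); last first.
  rewrite nneseriesZl; last by move=> *; exact: hterm_ge0.
  by apply: lee_wpmul2l => //; rewrite lee_fin powR_ge0.
apply: lee_nneseries => [i _ _|i _]; first exact: hterm_ge0.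
have [[x [Ax Ux]]|/set0P/negP/negPn/eqP ->] := pselect ([set x | A x /\ U i (phi x)] !=set0);
  last by rewrite hterm_set0 mule_ge0 ?hterm_ge0// lee_fin powR_ge0.
have [diamE diam0] := cdiam_fin Ux (Ud i).
have preimage_diam : (cdiam [set x | A x /\ U i (phi x)] <= (L * fine (cdiam (U i)))%:E)%E.
  apply: cdiam_le => u w [Au Uu] [Aw Uw]; apply: (le_trans (lip _ _ Au Aw)).
  by rewrite ler_wpM2l// -lee_fin -diamE cdiam_ge.
have preimage_x : [set x | A x /\ U i (phi x)] x by split.
have [preimage_diamE preimage_diam0] := cdiam_fin preimage_x preimage_diam.
rewrite (htermE _ Ux) (htermE _ preimage_x) -EFinM lee_fin -powRM//.
apply: ge0_ler_powR; rewrite ?nnegrE ?mulr_ge0//.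
by rewrite -lee_fin -preimage_diamE.
Qed.

Lemma hausdorff0_sub s A B : A `<=` B -> hausdorff s B = 0%E -> hausdorff s A = 0%E.
Proof.
move=> AB /hausdorff0P nullB; apply/hausdorff0P => d e d0 e0.
exact: hcover_sub (nullB d e d0 e0).
Qed.

Lemma hausdorff0_bigcup s (A : nat -> set C) : (forall i, hausdorff s (A i) = 0%E) ->
  hausdorff s (\bigcup_i A i) = 0%E.
Proof.
move=> null; apply/hausdorff0P => d e d0 e0.
have cover i : hcover s d (A i) (e / (2 ^ i.+1)%:R)%:E.
  have /hausdorff0P := null i; apply=> //.
  by rewrite divr_gt0// ltr0n expn_gt0.
apply: hcover_sub (hcover_bigcup cover) => //.
by apply: epsilon_trick0; exact: ltW.
Qed.

Lemma hausdorff0_set0 s : hausdorff s (set0 : set C) = 0%E.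
Proof.
apply/hausdorff0P => d e _ e0; apply: hcover_sub (hcover_set0 s d) => //.
by rewrite lee_fin ltW.
Qed.

Lemma hausdorff0_countable (T : choiceType) (S : set T) s (A : T -> set C) :
  countable S -> (forall a, S a -> hausdorff s (A a) = 0%E) ->
  hausdorff s (\bigcup_(a in S) A a) = 0%E.
Proof.
move=> /countable_injP[e einj] null.
apply: (@hausdorff0_sub _ _ (\bigcup_i \bigcup_(a in [set a | S a /\ e a = i]) A a)).
  by move=> z [a Sa Az]; exists (e a) => //; exists a.
apply: hausdorff0_bigcup => i.
have [[a [Sa ai]]|none] := pselect (exists a, S a /\ e a = i).
  apply: hausdorff0_sub (null a Sa) => z [b [Sb bi] Az].
  by rewrite (_ : a = b)//; apply: einj; rewrite ?inE// ai.
by apply: hausdorff0_sub (hausdorff0_set0 s) => z [a ia]; case: none; exists a.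
Qed.

Lemma hausdorff0_lipschitz s L A B (phi : C -> C) : 0 <= s -> 0 < L ->
  (forall x, A x -> B (phi x)) ->
  (forall x y, A x -> A y -> cabs (x - y) <= L * cabs (phi x - phi y)) ->
  hausdorff s B = 0%E -> hausdorff s A = 0%E.
Proof.
move=> s0 L0 AB lip /hausdorff0P nullB; apply/hausdorff0P => d e d0 e0.
have Ls : 0 < L `^ s by rewrite powR_gt0.
have dL : 0 < d / L by rewrite divr_gt0.
have eL : 0 < e / L `^ s by rewrite divr_gt0.
have := hcover_lipschitz s0 (ltW L0) (ltW dL) AB lip (nullB _ _ dL eL).
by rewrite -EFinM mulrC mulrVK ?unitfE ?gt_eqF// mulrC mulrVK ?unitfE ?gt_eqF.
Qed.

Lemma hausdorff0_locally_expanding s (X Y : set C) (g : C -> C) : 0 <= s ->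
  (forall z, X z -> Y (g z)) ->
  (forall z, X z -> exists d L, [/\ 0 < d, 0 < L & forall x y,
     cabs (x - z) < d -> cabs (y - z) < d -> cabs (x - y) <= L * cabs (g x - g y)]) ->
  hausdorff s Y = 0%E -> hausdorff s X = 0%E.
Proof.
move=> s0 XY expanding nullY.
pose X_ (n : nat) := [set z | X z /\ forall y, cabs (y - z) < n.+1%:R^-1 ->
  cabs (z - y) <= n.+1%:R * cabs (g z - g y)].
have inv0 n : 0 < n.+1%:R^-1 :> R by rewrite invr_gt0.
have /choice[cell cellP] := fun n => countable_cells (inv0 n).
apply: (@hausdorff0_sub _ _ (\bigcup_n \bigcup_i [set z | X_ n z /\ cell n z = i])).
  move=> z Xz; have [d [L [d0 L0 exp_z]]] := expanding z Xz.
  pose n := (Num.truncn (d^-1 + L)).+1; have n_gt : d^-1 + L < n%:R by exact: truncnS_gt.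
  have di0 : 0 < d^-1 by rewrite invr_gt0.
  have n_le : n%:R <= n.+1%:R :> R by rewrite ler_nat.
  have nd : n.+1%:R^-1 <= d by rewrite invf_ple ?posrE//; lra.
  have nL : L <= n.+1%:R by lra.
  exists n => //; exists (cell n z) => //; split=> //; split=> // y yz.
  apply: (le_trans (exp_z z y _ _)); first by rewrite subrr cabs0.
    exact: lt_le_trans nd.
  by rewrite ler_wpM2r ?cabs_ge0.
apply: hausdorff0_bigcup => n; apply: hausdorff0_bigcup => i.
apply: (@hausdorff0_lipschitz _ n.+1%:R _ Y g) nullY => //.
  by move=> x [[/XY]].
move=> x y [[_ exp_x] xi] [_ yi]; apply: exp_x; apply: cellP.
by rewrite yi.
Qed.

Lemma HD_le s A : 0 <= s -> hausdorff s A = 0%E -> HD A <= s.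
Proof. by move=> s0 null; apply: ge_inf; [exists 0 => x []|]. Qed.

Lemma HD_ge s t A : 0 <= t -> hausdorff t A = 0%E ->
  (forall x, 0 <= x -> x < s -> hausdorff x A <> 0%E) -> s <= HD A.
Proof.
move=> t0 null not_null; apply: lb_le_inf; first by exists t.
by move=> x [x0 nullx]; rewrite leNgt; apply/negP => xs; exact: (not_null x).
Qed.

Lemma HD_mono t A B : 0 <= t -> hausdorff t B = 0%E -> A `<=` B -> HD A <= HD B.
Proof.
move=> t0 nullB AB; apply: lb_le_inf; first by exists t.
by move=> x [x0 nullx]; exact: (HD_le x0 (hausdorff0_sub AB nullx)).
Qed.

Lemma HD_ge0 A : 0 <= HD A.
Proof.
rewrite /HD; set S := [set s | _].
have [->|/set0P [x Sx]] := eqVneq S set0; first by rewrite inf0.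
by apply: lb_le_inf; [exists x|move=> y []].
Qed.

End Hausdorff.

(** * Upper bound *)

Lemma finite_set_bounded (R : realType) (T : choiceType) (A : set T) (u : T -> R) :
  finite_set A -> exists B, forall a, A a -> u a <= B.
Proof.
move=> finA; exists (\sum_(a <- fset_set A) `|u a|) => a Aa.
rewrite (big_rem a) /=; last by rewrite in_fset_set//; exact: mem_set.
by rewrite (le_trans (ler_norm _))// lerDl sumr_ge0.
Qed.

Section KUPoles.
Variable R : realType.
Local Notation C := (R[i]).

Record KU_poles (f : C -> option C) (P : set C) (M : nat) (beta K r : R) : Prop := KUPoles {
  KU_meromorphic : meromorphic f;
  KU_sub_poles : P `<=` poles f;
  KU_cofinite : finite_set (poles f `\` P);
  KU_radius_gt0 : 0 < r;
  KU_disjoint : forall a1 a2, poles f a1 -> poles f a2 -> a1 <> a2 ->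
    cball a1 r `&` cball a2 r = set0;
  KU_beta_ge0 : 0 <= beta;
  KU_mult : forall a, P a -> (1 <= mult f a <= M)%N;
  KU_const_ge1 : 1 <= K;
  KU_growth : forall a, P a -> pole_growth f a (mult f a) (cabs a `^ (- beta)) K r }.

Variables (f : C -> option C) (P : set C) (M : nat) (beta K r : R).
Hypothesis ku : KU_poles f P M beta K r.

Let merf : meromorphic f. Proof. exact: KU_meromorphic ku. Qed.
Let r0 : 0 < r. Proof. exact: KU_radius_gt0 ku. Qed.
Let K1 : 1 <= K. Proof. exact: KU_const_ge1 ku. Qed.

Lemma KU_isolated a z : f a = None -> cabs (z - a) < r -> z != a -> f z <> None.
Proof.
move=> fa za zna fz; have disjoint : cball a r `&` cball z r = set0.
  by apply: (KU_disjoint ku) => //; apply/eqP; rewrite eq_sym.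
have : (cball a r `&` cball z r) z by split=> //; exact: cball_center.
by rewrite disjoint.
Qed.

Lemma KU_scale_gt0 a : P a -> 0 < cabs a `^ (- beta).
Proof.
move: r0 => r_gt0 Pa; rewrite lt_def powR_ge0 andbT; apply/eqP => scale0.
have [d [d0 large]] := pole_large merf 0 (KU_sub_poles ku Pa).
have [h [h0 hd hr]] := exists_pos_le2 d0 r_gt0.
pose z : C := a + (h / 2)%:C%C.
have za : cabs (z - a) = h / 2 by rewrite /z addrAC subrr add0r cabs_real ger0_norm//; lra.
have zna : z != a by rewrite -cabs_subr_gt0 za; lra.
have [|_ + _ _] := KU_growth ku Pa (z := z) _ zna; first by lra.
have [|_] := large z _ zna; first by lra.
by rewrite scale0 mul0r mulr0 ltNge => /negP.
Qed.

Lemma KU_scale_le1 a : 1 <= cabs a -> cabs a `^ (- beta) <= 1.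
Proof. by move=> a1; rewrite -(powRr0 (cabs a)) ler_powR// oppr_le0 (KU_beta_ge0 ku). Qed.

Lemma KU_pole_model a : P a -> pole_model f a (mult f a) M (cabs a `^ (- beta)) K r.
Proof.
move=> Pa; have fa := KU_sub_poles ku Pa; split=> //.
- by move=> z; exact: KU_isolated.
- exact: (KU_mult ku Pa).
- exact: KU_scale_gt0.
- exact: (KU_growth ku Pa).
Qed.

Definition regular_disc a (s L : R) := [/\ 0 < s <= r / 2,
  (forall z, cabs (z - a) = s -> cabs (fv f z) <= L) &
  (forall z, cabs (z - a) < s -> z != a -> cderiv (fv f) z != 0)].

Lemma regular_disc_le a s L L' : L <= L' -> regular_disc a s L -> regular_disc a s L'.
Proof. by move=> LL' [s_itv circle f'_neq0]; split=> // z /circle/le_trans; exact. Qed.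

Lemma KU_regular_disc a : f a = None -> exists sL : R * R, regular_disc a sL.1 sL.2.
Proof.
move: r0 => r_gt0 fa; have [d [d0 f'_neq0]] := cderiv_neq0_near_pole merf fa.
have [|s [s0 sd sr]] := @exists_pos_le2 R d (r / 2) d0; first by lra.
have [z zs|L fL] := fv_bounded_on_circle merf (a := a) s0.
  by apply: (KU_isolated fa); [lra|rewrite -cabs_subr_gt0 zs].
exists (s, L); split=> /= [|//|z zs]; first by rewrite s0.
by apply: f'_neq0; exact: lt_le_trans sd.
Qed.

Lemma KU_half_disc a : P a -> 1 <= cabs a -> regular_disc a (r / 2) (K * (1 + 2 / r) ^+ M).
Proof.
move: r0 => r_gt0 Pa a1; have model := KU_pole_model Pa; split=> [|z zr|z zr zna].
- by lra.
- exact: (pole_circle_le model (KU_scale_le1 a1) zr).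
by apply: (pole_cderiv_neq0 model) zna; lra.
Qed.

Lemma KU_regular_discs : exists (rad : C -> R) (L : R), 1 <= L /\
  forall a, f a = None -> regular_disc a (rad a) L.
Proof.
have /choice[disc discP] : forall a, exists sL : R * R, f a = None -> regular_disc a sL.1 sL.2.
  by move=> a; have [/KU_regular_disc[sL]|] := pselect (f a = None); [exists sL|exists (0, 0)].
pose good a := P a /\ 1 <= cabs a.
have fin_bad : finite_set [set a | f a = None /\ ~ good a].
  apply: (@sub_finite_set _ _ ((poles f `\` P) `|` [set a | f a = None /\ cabs a <= 1])).
    move=> a [fa bad]; have [Pa|] := pselect (P a); last by left.
    by right; split=> //; rewrite leNgt; apply/negP => /ltW a1; exact: bad.
  by rewrite finite_setU; split; [exact: (KU_cofinite ku)|exact: poles_in_disc_finite].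
have [L discL] := finite_set_bounded (fun a => (disc a).2) fin_bad.
exists (fun a => if `[< good a >] then r / 2 else (disc a).1).
exists (Num.max 1 (Num.max L (K * (1 + 2 / r) ^+ M))); split; first by rewrite le_max lexx.
move=> a fa; case: asboolP => [[Pa a1]|bad].
  by apply: regular_disc_le (KU_half_disc Pa a1); rewrite !le_max lexx !orbT.
by apply: regular_disc_le (discP a fa); rewrite !le_max discL ?orbT.
Qed.

(* 16 K^3 makes the inverse branches below contract by 1/2. *)
Record deep_level (lev : R) : Prop := DeepLevel {
  deep_large : [/\ 1 + K <= lev, 2 + r <= lev - r / 2 & 16 * K ^+ 3 <= lev - r / 2];
  deep_good : far_poles f (lev - r / 2) `<=` P;
  deep_near_pole : forall z, lev - 1 < cabs (fv f z) -> f z <> None ->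
    exists a, [/\ f a = None, cabs (z - a) < r / 2 & cderiv (fv f) z != 0] }.

Lemma deep_level_near : transcendental f -> ~ inf_asymptotic_value f ->
  exists lev0, forall lev, lev0 <= lev -> deep_level lev.
Proof.
move: r0 K1 => r_gt0 K_ge1 tranf noinf; have [rad [L [L1 discs]]] := KU_regular_discs.
have [B BP] := finite_set_bounded (@cabs R) (KU_cofinite ku).
exists (1 + K + (2 + r + r) + 16 * K ^+ 3 + (L + 1) + (`|B| + 1)) => lev lev_ge.
have K3 : 0 <= K ^+ 3 by rewrite exprn_ge0//; lra.
have B0 := ler_norm B; have B0' := normr_ge0 B.
split=> [|a [fa a_far]|z z_large fz]; first by split; lra.
  by apply: contrapT => nPa; have := BP a (conj fa nPa); lra.
have L0 : 0 < L by lra.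
have circles a : f a = None -> 0 < rad a /\
    forall z, cabs (z - a) = rad a -> f z <> None /\ cabs (fv f z) <= L.
  move=> fa; have [/andP[rad0 rad_le] circle _] := discs a fa; split=> // v v_rad.
  split; last exact: circle.
  by apply: (KU_isolated fa); [lra|rewrite -cabs_subr_gt0 v_rad].
have [|a [fa za]] := superlevel_near_pole merf tranf noinf L0 circles (z := z).
  by right; lra.
have [/andP[_ rad_le] _ f'_neq0] := discs a fa.
exists a; split=> //; first by lra.
by apply: f'_neq0 => //; apply/eqP => zE; apply: fz; rewrite zE.
Qed.

Definition small_shifts (c : nat -> C) := forall n, (0 < n)%N -> cabs (c n) < 1.

Definition escaping_orbit (c : nat -> C) k lev (w : nat -> C) :=
  forall j, f (w j) = Some (w j.+1 - c (k + j).+1) /\ lev < cabs (w j).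

Definition escaping_near c k lev a : set C :=
  [set y | cabs (y - a) < r / 2 /\ exists w, w 0%N = y /\ escaping_orbit c k lev w].

Local Notation beta_M := (- (beta / M%:R)).

(* With x = |a| and y = |a'|, the left side is the Lipschitz constant of an inverse
   branch of f from the disc at a' to the disc at a. *)
Lemma branch_const_le (m : nat) (x y : R) : (0 < m <= M)%N -> 1 <= x -> 1 <= y ->
  2 * K ^+ 2 / (y / 2) * (K * x `^ (- beta) / (y / 2)) `^ m%:R^-1 <=
  8 * K ^+ 3 * (x `^ beta_M * y `^ (- (1 + M%:R^-1))).
Proof.
move: K1 (KU_beta_ge0 ku) => K_ge1 beta0 /andP[m0 mM] x1 y1; have K0 : 0 < K by lra.
have M0 : (0 < M)%N by exact: leq_trans mM.
have y0 : 0 < y by lra.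
have scale0 : 0 < x `^ (- beta) by rewrite powR_gt0//; lra.
have scale1 : x `^ (- beta) <= 1 by rewrite -(powRr0 x) ler_powR// oppr_le0.
pose z := x `^ (- beta) / y; have z0 : 0 < z by rewrite divr_gt0.
have z1 : z <= 1 by rewrite ler_pdivrMr// mul1r; lra.
have -> : K * x `^ (- beta) / (y / 2) = (2 * K) * z by rewrite /z; field; rewrite gt_eqF.
have K2 : 0 <= 2 * K by lra.
rewrite (powRM _ K2 (ltW z0)).
have z_root : z `^ m%:R^-1 <= z `^ M%:R^-1.
  by apply: ger_powR; rewrite ?z0// lef_pV2 ?posrE ?ltr0n// ler_nat.
have zE : z `^ M%:R^-1 = x `^ beta_M * y `^ (- M%:R^-1).
  rewrite /z powRM ?invr_ge0 ?powR_ge0 ?(ltW y0)// -powRrM mulNr.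
  by rewrite -(@powR_inv1 _ y) ?(ltW y0)// -powRrM mulN1r.
have -> : y `^ (- (1 + M%:R^-1)) = y^-1 * y `^ (- M%:R^-1).
  by rewrite opprD powRD ?powR_inv1 ?(ltW y0)//; apply/implyP => _; rewrite gt_eqF.
have -> : 8 * K ^+ 3 * (x `^ beta_M * (y^-1 * y `^ (- M%:R^-1))) =
    2 * K ^+ 2 / (y / 2) * ((2 * K) * z `^ M%:R^-1).
  by rewrite zE; field; rewrite gt_eqF.
rewrite ler_wpM2l ?divr_ge0 ?mulr_ge0 ?exprn_ge0 ?(ltW K0) ?(ltW y0)//.
by apply: ler_pM; rewrite ?powR_ge0// root_le_self//; lra.
Qed.

Section DeepLevel.
Variables (lev : R) (c : nat -> C).
Hypothesis deep : deep_level lev.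
Hypothesis small_c : small_shifts c.

Local Notation far := (far_poles f (lev - r / 2)).

Let levels : [/\ 1 + K <= lev, 2 + r <= lev - r / 2 & 16 * K ^+ 3 <= lev - r / 2].
Proof. exact: deep_large deep. Qed.

Let far_P a : far a -> P a. Proof. exact: deep_good deep a. Qed.

Let far_ge1 a : far a -> 1 <= cabs a.
Proof. by move=> [_ a_far]; have [_ ? _] := levels; have := r0; lra. Qed.

Lemma near_far_pole z w k : f z = Some (w - c k.+1) -> lev < cabs w -> exists a,
  [/\ f a = None, cabs (z - a) < r / 2 & cderiv (fv f) z != 0].
Proof.
move=> fz w_large; apply: (deep_near_pole deep); last by rewrite fz.
rewrite (fv_some fz); have := small_c (ltn0Sn k).
by have := cabsB_ge w (c k.+1); lra.
Qed.

Lemma escaping_orbit_start k w : escaping_orbit c k lev w ->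
  exists2 a, far a & escaping_near c k lev a (w 0%N).
Proof.
move=> worb; have [f0 w0] := worb 0%N; have [f1 w1] := worb 1%N.
have [a [fa wa _]] := near_far_pole f0 w1.
exists a; last by split=> //; exists w.
by split=> //; have := cabsB_ge (w 0%N) a; lra.
Qed.

Lemma escaping_orbit_shift k w : escaping_orbit c k lev w ->
  escaping_orbit c k.+1 lev (fun j => w j.+1).
Proof. by move=> worb j; have := worb j.+1; rewrite addnS addSn. Qed.

Lemma escaping_near_next k a y : escaping_near c k lev a y ->
  exists2 a', far a' & escaping_near c k.+1 lev a' (fv f y + c k.+1).
Proof.
move=> [_ [w [<- worb]]]; have [f0 _] := worb 0%N; rewrite addn0 in f0.
by rewrite (fv_some f0) subrK; exact: (escaping_orbit_start (escaping_orbit_shift worb)).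
Qed.

Lemma escaping_near_regular k a y : far a -> escaping_near c k lev a y ->
  [/\ y != a, cabs (y - a) < r & K <= cabs (fv f y)].
Proof.
move=> [fa _] [ya [w [w0 worb]]]; have [f0 _] := worb 0%N; have [_ w1] := worb 1%N.
rewrite w0 addn0 in f0; have := r0; have [? _ _] := levels => r_gt0.
split; first by apply/eqP => yE; move: f0; rewrite yE fa.
  by lra.
by rewrite (fv_some f0); have := small_c (ltn0Sn k); have := cabsB_ge (w 1%N) (c k.+1); lra.
Qed.

Lemma escaping_near_layer k a a' y : far a -> far a' -> escaping_near c k lev a y ->
  escaping_near c k.+1 lev a' (fv f y + c k.+1) -> pole_layer f a r (cabs a' / 2) y.
Proof.
move=> far_a [_ a'_far] y_near [image_near _].
have [yna yr _] := escaping_near_regular far_a y_near; have [_ ? _] := levels.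
have := cabs_distD (fv f y + c k.+1) (fv f y) a'.
rewrite opprD addrA subrr add0r cabsN => dist_a'; have ck := small_c (ltn0Sn k).
have := cabsB_ge (fv f y) a'; have := cabsB_ge a' (fv f y).
by rewrite (cabs_distC a'); split=> //; lra.
Qed.

Lemma escaping_near_dist k a y : far a -> escaping_near c k lev a y ->
  cabs (y - a) <= cabs a `^ beta_M.
Proof.
move=> far_a y_near; have [yna yr Ky] := escaping_near_regular far_a y_near.
have Pa := far_P far_a; have /andP[m0 mM] := KU_mult ku Pa.
have K0 : 0 < K by exact: lt_le_trans ltr01 K1.
have [_] := pole_dist_le (KU_pole_model Pa) yr yna K0 Ky.
move=> /le_trans; apply; rewrite mulrAC divff ?gt_eqF// mul1r -powRrM mulNr.
rewrite ler_powR ?far_ge1// lerN2 ler_wpM2l ?(KU_beta_ge0 ku)//.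
by rewrite lef_pV2 ?posrE ?ltr0n// ?ler_nat// (leq_trans m0).
Qed.

Variable t : R.
Hypothesis t0 : 0 < t.

Local Notation weight a := (cabs a `^ (t * beta_M)).
Local Notation tau := (t * (beta + M%:R + 1) / M%:R).
Local Notation branches := (pole_cell_count K M * pole_cell_count K M)%N.

Let far_branch_const a a' : R := 8 * K ^+ 3 * (cabs a `^ beta_M * cabs a' `^ (- (1 + M%:R^-1))).

Let K3_ge0 : 0 <= 8 * K ^+ 3. Proof. by rewrite mulr_ge0// exprn_ge0// (le_trans ler01). Qed.

Let far_branch_const_ge0 a a' : 0 <= far_branch_const a a'.
Proof. by rewrite !mulr_ge0 ?powR_ge0 ?exprn_ge0// (le_trans ler01). Qed.

Let far_branch_const_le a a' : far a -> far a' -> far_branch_const a a' <= 2^-1.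
Proof.
move=> /far_ge1 a1 far_a'; have a'1 := far_ge1 far_a'; have [_ a'_far] := far_a'.
have a'0 : 0 < cabs a' by lra.
apply: (@le_trans _ _ (8 * K ^+ 3 * (cabs a')^-1)); last first.
  by rewrite ler_pdivrMr//; have [_ _ ?] := levels; lra.
rewrite /far_branch_const ler_wpM2l// -[leRHS]mul1r; apply: ler_pM; rewrite ?powR_ge0//.
  by rewrite -[leRHS](powRr0 (cabs a)) ler_powR// oppr_le0 divr_ge0 ?(KU_beta_ge0 ku).
by rewrite -[leRHS](@powR_inv1 _ (cabs a')) ?cabs_ge0// ler_powR// lerN2 lerDl invr_ge0.
Qed.

Let far_branch_const_powR a a' : (0 < M)%N -> far a' ->
  far_branch_const a a' `^ t * weight a' = (8 * K ^+ 3) `^ t * weight a * cabs a' `^ (- tau).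
Proof.
move=> M0 /far_ge1 a'1; have MR : (M%:R : R) != 0 by rewrite pnatr_eq0 -lt0n.
have -> : cabs a' `^ (- tau) = cabs a' `^ (- (1 + M%:R^-1) * t) * weight a'.
  rewrite -powRD; last by apply/implyP => _; rewrite gt_eqF//; lra.
  by congr (_ `^ _); field.
rewrite /far_branch_const (powRM t K3_ge0 (mulr_ge0 (powR_ge0 _ _) (powR_ge0 _ _))).
by rewrite (powRM t (powR_ge0 _ _) (powR_ge0 _ _)) -!powRrM [beta_M * t]mulrC; ring.
Qed.

Lemma escaping_near_cover0 k a : far a ->
  hcover t 2 (escaping_near c k lev a) (2 `^ t * weight a)%:E.
Proof.
move=> far_a; have scale1 : cabs a `^ beta_M <= 1.
  rewrite -[leRHS](powRr0 (cabs a)) ler_powR ?far_ge1//.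
  by rewrite oppr_le0 divr_ge0 ?(KU_beta_ge0 ku).
have [nonempty|/set0P/negP/negPn/eqP ->] := pselect (escaping_near c k lev a !=set0); last first.
  by apply: hcover_sub (hcover_set0 t _) => //; rewrite lee_fin mulr_ge0 ?powR_ge0.
have diam0 : 0 <= 2 * cabs a `^ beta_M by rewrite mulr_ge0 ?powR_ge0.
have := hcover_single nonempty (ltW t0) diam0; rewrite powRM ?powR_ge0// -powRrM [_ * t]mulrC.
move=> cover; apply: hcover_sub (cover _) => //; first by lra.
move=> x y /(escaping_near_dist far_a) xa /(escaping_near_dist far_a) ya.
by have := cabs_distD a x y; rewrite (cabs_distC a y); lra.
Qed.

Lemma escaping_near_branch_cover k a a' d q : far a -> far a' -> 0 <= d -> 0 <= q ->
  hcover t d (escaping_near c k.+1 lev a') (q * weight a')%:E ->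
  hcover t (2^-1 * d)
    [set y | escaping_near c k lev a y /\ escaping_near c k.+1 lev a' (fv f y + c k.+1)]
    (branches%:R * (far_branch_const a a' `^ t * (q * weight a')))%:E.
Proof.
move=> far_a far_a' d0 q0 cover; have Pa := far_P far_a; have model := KU_pole_model Pa.
have a'0 : 0 < cabs a' / 2 by rewrite divr_gt0// (lt_le_trans ltr01)// far_ge1.
have [cell [cellN cell_dist]] := pole_cells model a'0.
apply: (@hcover_cells _ _ _ _ cell) => [|y [y_near image_near]|i].
- by rewrite !mulr_ge0 ?powR_ge0.
- by apply: cellN; exact: (escaping_near_layer far_a far_a' y_near).
rewrite EFinM; pose branch := [set y | (escaping_near c k lev a y /\
  escaping_near c k.+1 lev a' (fv f y + c k.+1)) /\ cell y = i].
have expanding x y : branch x -> branch y -> cabs (x - y) <=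
    far_branch_const a a' * cabs (fv f x + c k.+1 - (fv f y + c k.+1)).
  move=> [[x_near x_image] xi] [[y_near y_image] yi].
  have x_layer := escaping_near_layer far_a far_a' x_near x_image.
  have y_layer := escaping_near_layer far_a far_a' y_near y_image.
  have [xna _ x_large _] := x_layer; have xr : cabs (x - a) <= r / 2 by case: x_near => /ltW.
  have -> : fv f x + c k.+1 - (fv f y + c k.+1) = fv f x - fv f y by ring.
  have := pole_inverse_lipschitz model xna xr a'0 x_large (cell_dist x y x_layer y_layer _).
  rewrite xi yi => /(_ erefl)/le_trans; apply; rewrite ler_wpM2r ?cabs_ge0//.
  by apply: branch_const_le; rewrite ?(KU_mult ku Pa) ?far_ge1.
have := hcover_lipschitz (ltW t0) (far_branch_const_ge0 a a') d0 _ expanding cover.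
move=> /(_ _)cover_branch; apply: hcover_sub (cover_branch _) => //.
  by rewrite ler_wpM2r// far_branch_const_le.
by move=> y [[]].
Qed.

Variable e : R.
Hypothesis far_sum : (\esum_(a in far) (cabs a `^ (- tau))%:E <= e%:E)%E.
Hypothesis e_small : branches%:R * (8 * K ^+ 3) `^ t * e <= 2^-1.

Lemma escaping_near_cover_step k a d q : far a -> 0 <= d -> 0 <= q ->
  (forall a', far a' -> hcover t d (escaping_near c k.+1 lev a') (q * weight a')%:E) ->
  hcover t (2^-1 * d) (escaping_near c k lev a) (2^-1 * q * weight a)%:E.
Proof.
move=> far_a d0 q0 cover; have Pa := far_P far_a.
have M0 : (0 < M)%N by have /andP[m0] := KU_mult ku Pa; exact: leq_trans.
pose coef := branches%:R * (8 * K ^+ 3) `^ t * (q * weight a).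
have coef0 : 0 <= coef by rewrite !mulr_ge0 ?powR_ge0.
have := @hcover_countable R _ far t (2^-1 * d) (fun a' => [set y | escaping_near c k lev a y /\
  escaping_near c k.+1 lev a' (fv f y + c k.+1)]) (fun a' => coef%:E * (cabs a' `^ (- tau))%:E)%E
  (far_poles_countable merf _).
move=> /(_ _ _)cover_far; apply: hcover_sub (cover_far _ _) => //.
- by move=> y y_near; have [a' far_a' image] := escaping_near_next y_near; exists a'.
- apply: le_trans (ge0_esumZl_le _ coef0 _) _ => [a'|]; first by rewrite lee_fin powR_ge0.
  apply: le_trans (lee_wpmul2l _ far_sum) _; first by rewrite lee_fin.
  rewrite -EFinM lee_fin /coef.
  have -> : branches%:R * (8 * K ^+ 3) `^ t * (q * weight a) * e =
    branches%:R * (8 * K ^+ 3) `^ t * e * (q * weight a) by ring.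
  by rewrite -[leRHS]mulrA ler_wpM2r// mulr_ge0 ?powR_ge0.
- by move=> a'; rewrite -EFinM lee_fin mulr_ge0 ?powR_ge0.
move=> a' far_a'; have := escaping_near_branch_cover far_a far_a' d0 q0 (cover a' far_a').
have -> : branches%:R * (far_branch_const a a' `^ t * (q * weight a')) =
    branches%:R * q * (far_branch_const a a' `^ t * weight a') by ring.
rewrite far_branch_const_powR// -EFinM.
by have -> : branches%:R * q * ((8 * K ^+ 3) `^ t * weight a * cabs a' `^ (- tau)) =
  coef * cabs a' `^ (- tau) by rewrite /coef; ring.
Qed.

Lemma escaping_near_cover n k a : far a ->
  hcover t (2^-1 ^+ n * 2) (escaping_near c k lev a) (2^-1 ^+ n * 2 `^ t * weight a)%:E.
Proof.
elim: n k a => [|n IH] k a far_a; first by rewrite expr0 !mul1r; exact: escaping_near_cover0.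
rewrite exprS -!mulrA; have := @escaping_near_cover_step k a (2^-1 ^+ n * 2) (2^-1 ^+ n * 2 `^ t).
rewrite -!mulrA; apply=> //; rewrite ?mulr_ge0 ?exprn_ge0 ?powR_ge0//.
by move=> a'; exact: IH.
Qed.

Lemma escaping_near_null k a : far a -> hausdorff t (escaping_near c k lev a) = 0%E.
Proof.
move=> far_a; apply/hausdorff0P => d v d0 v0.
have [n1 diam_small] := exists_half_powers_lt 2 d0.
have [n2 sum_small] := exists_half_powers_lt (2 `^ t * weight a) v0.
apply: hcover_sub (escaping_near_cover (maxn n1 n2) k far_a) => //.
  by rewrite exprVn mulrC ltW// diam_small// leq_maxl.
by rewrite lee_fin exprVn -mulrA mulrC ltW// sum_small// leq_maxr.
Qed.

End DeepLevel.

Lemma escaping_partP S c lev z : escaping_part S f c lev z -> exists w,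
  [/\ f z = Some (w 0%N - c 1%N), escaping_orbit c 1 lev w & lev < cabs (w 0%N)].
Proof.
move=> [_ escapes]; have /choice[w wP] : forall n, exists w,
    (0 < n)%N -> Fit f c n z = Some w /\ lev < cabs w.
  by move=> [|n]; [exists 0|have [w] := escapes n.+1 isT; exists w].
have step n u : Fit f c n z = Some u -> f u = Some (w n.+1 - c n.+1).
  move=> Fn; have [+ _] := wP n.+1 isT; rewrite /= Fn /fn.
  by case: (f u) => //= v [<-]; rewrite addrK.
exists (fun j => w j.+1); split=> [|j|]; [exact: step| |by have [] := wP 1%N isT].
by have [Fj wj] := wP j.+1 isT; split=> //; rewrite add1n; exact: step.
Qed.

Lemma escaping_part_null rho t : transcendental f -> ~ inf_asymptotic_value f ->
  has_order f rho -> 0 < rho -> rho * M%:R / (beta + M%:R + 1) < t ->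
  exists lev0, forall lev, lev0 <= lev -> forall c, small_shifts c -> forall S,
    hausdorff t (escaping_part S f c lev) = 0%E.
Proof.
move=> tranf noinf ho rho0 t_gt; have beta0 := KU_beta_ge0 ku.
have den0 : 0 < beta + M%:R + 1 by have := ler0n R M; lra.
have t0 : 0 < t by apply: le_lt_trans t_gt; rewrite divr_ge0 ?mulr_ge0// ltW.
have [lev1 deep1] := deep_level_near tranf noinf.
suff [lev2 null2] : exists lev2, forall lev, lev2 <= lev -> deep_level lev -> forall c,
    small_shifts c -> forall a, far_poles f (lev - r / 2) a ->
    hausdorff t (escaping_near c 1 lev a) = 0%E.
  exists (Num.max lev1 lev2) => lev; rewrite ge_max => /andP[/deep1 deep lev_ge] c small_c S.
  have := hausdorff0_countable (far_poles_countable merf _) (null2 _ lev_ge deep _ small_c).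
  apply: (@hausdorff0_locally_expanding _ _ _ _ (fun z => fv f z + c 1%N) (ltW t0)).
    move=> z /escaping_partP[w [fz worb _]]; rewrite (fv_some fz) subrK.
    by have [a far_a] := escaping_orbit_start deep small_c worb; exists a.
  move=> z /escaping_partP[w [fz worb w0]].
  have [a [_ _ f'_neq0]] := near_far_pole deep small_c fz w0.
  have [|s [s0 reg]] := meromorphic_regular merf (z := z); first by rewrite fz.
  have [|d [L [d0 L0 expanding]]] := cderiv_neq0_expanding s0 _ f'_neq0.
    by move=> v /reg[].
  exists d, L; split=> // x y xd yd; have := expanding x y xd yd.
  by have -> : fv f x + c 1%N - (fv f y + c 1%N) = fv f x - fv f y by ring.
have [M0|M0] := posnP M.
  by exists 0 => lev _ deep c _ a /(deep_good deep)/(KU_mult ku); rewrite M0; case: (mult f a).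
pose tau := t * (beta + M%:R + 1) / M%:R.
have tau_gt : rho < tau by rewrite ltr_pdivlMr ?ltr0n// -ltr_pdivrMr.
pose q := (pole_cell_count K M * pole_cell_count K M)%N%:R * (8 * K ^+ 3) `^ t.
have q0 : 0 <= q by rewrite mulr_ge0 ?powR_ge0.
have e0 : 0 < (2 * (q + 1))^-1 by rewrite invr_gt0; lra.
have qe : q * (2 * (q + 1))^-1 <= 2^-1.
  by rewrite ler_pdivrMr ?mulrA ?mulVf ?mul1r//; lra.
have [lev2 [_ sum_small]] := far_poles_sum_small merf ho rho0 tau_gt e0.
exists (lev2 + r / 2) => lev lev_ge deep c small_c a.
apply: (escaping_near_null deep small_c t0 _ qe).
by apply: sum_small; lra.
Qed.

End KUPoles.

(** * Product measures on words *)

Section TreeCover.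
Variables (R : realType) (T : eqType) (A : seq T) (p : T -> R) (W : nat -> seq T).
Hypothesis uniqA : uniq A.
Hypothesis p_ge0 : forall a, a \in A -> 0 <= p a.
Hypothesis p_sum1 : \sum_(a <- A) p a = 1.
Hypothesis WA : forall i, {subset W i <= A}.
Implicit Types s : seq T.

Let wt s : R := \prod_(a <- s) p a.

Let wt_ge0 s : {subset s <= A} -> 0 <= wt s.
Proof. by move=> sA; rewrite /wt big_seq; apply: prodr_ge0 => a /sA; exact: p_ge0. Qed.

Let below s i : \bar R := (if prefix s (W i) then wt (W i) else 0)%:E.

Let below_ge0 s i : (0 <= below s i)%E.
Proof. by rewrite lee_fin; case: ifP => // _; exact: wt_ge0. Qed.

Let mass_below s := (\sum_(0 <= i <oo) below s i)%E.

Let wt_le_mass_below s i : W i = s -> ((wt s)%:E <= mass_below s)%E.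
Proof.
move=> Ws; rewrite /mass_below (@nneseriesD1 _ (below s) i xpredT)//.
by rewrite {1}/below Ws prefix_refl leeDl// nneseries_ge0.
Qed.

Let below_children s i : W i != s -> below s i = (\sum_(a <- A) below (rcons s a) i)%E.
Proof.
move=> Ws; have [/prefixP[u WE]|not_below] := boolP (prefix s (W i)); last first.
  rewrite /below (negbTE not_below) big1_seq// => a _; case: ifP => // below_a.
  by rewrite (prefix_trans (prefix_rcons s a) below_a) in not_below.
case: u WE => [|b u] WE; first by rewrite WE cats0 eqxx in Ws.
have bA : b \in A by apply: (@WA i); rewrite WE mem_cat mem_head orbT.
have child a : prefix (rcons s a) (W i) = (a == b).
  by rewrite WE -cats1 prefix_catr// eqxx /= prefix0s andbT.
rewrite (bigD1_seq b)//= big1_seq ?adde0 => [|a /andP[ab _]].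
  by rewrite /below child eqxx WE prefix_prefix.
by rewrite /below child (negbTE ab).
Qed.

Let mass_below_children s : (forall i, W i != s) ->
  mass_below s = (\sum_(a <- A) mass_below (rcons s a))%E.
Proof.
move=> Ws; rewrite /mass_below -nneseries_sum; last by move=> *; exact: below_ge0.
by apply: eq_eseriesr => i _; exact: below_children.
Qed.

Let wt_children s : wt s = \sum_(a <- A) wt (rcons s a).
Proof. by under eq_bigr do rewrite /wt big_rcons /=; rewrite -mulr_sumr p_sum1 mulr1. Qed.

Let light_child s : (mass_below s < (wt s)%:E)%E ->
  exists2 a, a \in A & (mass_below (rcons s a) < (wt (rcons s a))%:E)%E.
Proof.
move=> light; apply: contrapT => heavy_children.
have heavy a : a \in A -> ((wt (rcons s a))%:E <= mass_below (rcons s a))%E.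
  by move=> aA; rewrite leNgt; apply/negP => lt; apply: heavy_children; exists a.
move: (light); apply/negP; rewrite -leNgt mass_below_children => [|i].
  rewrite wt_children -sumEFin big_seq [leRHS]big_seq.
  by apply: lee_sum => a; exact: heavy.
by apply/eqP => /wt_le_mass_below; rewrite leNgt light.
Qed.

(* Walk down the tree keeping the mass of the words below the current vertex smaller
   than the weight of that vertex. *)
Lemma tree_cover : (\sum_(0 <= i <oo) (wt (W i))%:E < 1)%E ->
  exists w : nat -> T, (forall n, w n \in A) /\ forall i, W i <> mkseq w (size (W i)).
Proof.
move=> lt1; have light0 : (mass_below [::] < (wt [::])%:E)%E.
  rewrite /wt big_nil; apply: le_lt_trans lt1.
  by apply: lee_nneseries => [i _ _|i _]; rewrite ?below_ge0// /below prefix0s.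
have [|s [s0 sP]] := @nat_dependent_choice (seq T)
    (fun _ s => (mass_below s < (wt s)%:E)%E) (fun _ s s' => exists2 a, a \in A & s' = rcons s a)
    [::] light0.
  by move=> _ s /light_child[a aA light]; exists (rcons s a); split=> //; exists a.
have /choice[w wP] : forall n, exists a, a \in A /\ s n.+1 = rcons (s n) a.
  by move=> n; have [_ [a aA sE]] := sP n; exists a.
have sE n : s n = mkseq w n.
  by elim: n => // n IH; have [_ ->] := wP n; rewrite IH mkseqS.
exists w; split=> [n|i WE]; first by have [] := wP n.
have [+ _] := sP (size (W i)); apply/negP; rewrite -leNgt sE -WE.
exact: wt_le_mass_below.
Qed.

End TreeCover.

(** * Coded orbits *)

Section GeometricCauchy.
Variable R : realType.

Lemma le0_half_powers (x D : R) : (forall j, x <= D / 2 ^+ j) -> x <= 0.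
Proof.
move=> x_le; rewrite leNgt; apply/negP => x0.
have [n /(_ n (leqnn n))] := exists_half_powers_lt D x0.
by have := x_le n; lra.
Qed.

Lemma geometric_cauchy (v : nat -> R) (d : R) : 0 <= d ->
  (forall j, `|v j.+1 - v j| <= d / 2 ^+ j) ->
  exists x, forall j, `|x - v j| <= 2 * d / 2 ^+ j.
Proof.
move=> d0 v_cauchy; pose e j : R := 2 * d / 2 ^+ j.
have e_half j : d / 2 ^+ j = e j.+1 by rewrite /e exprS; field; rewrite expf_neq0.
have eS j : e j = 2 * e j.+1 by rewrite /e exprS; field; rewrite expf_neq0.
have e0 j : 0 <= e j by rewrite /e divr_ge0 ?mulr_ge0 ?exprn_ge0.
have [||x xP] := @nested_segments_point _ (fun j => v j - e j) (fun j => 2 * e j).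
- by move=> j; have := e0 j; lra.
- by move=> j; have := v_cauchy j; rewrite e_half ler_norml; have := eS j; lra.
by exists x => j; have := xP j; rewrite -/(e j) ler_norml; lra.
Qed.

Lemma geometric_cauchyC (u : nat -> R[i]) (d : R) : 0 <= d ->
  (forall j, cabs (u j.+1 - u j) <= d / 2 ^+ j) ->
  exists x, forall j, cabs (x - u j) <= 4 * d / 2 ^+ j.
Proof.
move=> d0 u_cauchy.
have [|p pP] := @geometric_cauchy (fun j => complex.Re (u j)) d d0.
  by move=> j; apply: le_trans (u_cauchy j); rewrite -cReB; exact: Re_le_cabs.
have [|q qP] := @geometric_cauchy (fun j => complex.Im (u j)) d d0.
  by move=> j; apply: le_trans (u_cauchy j); rewrite -cImB; exact: Im_le_cabs.
exists (p +i* q)%C => j; apply: (le_trans (cabs_le_ReIm _)).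
have -> : 4 * d / 2 ^+ j = 2 * d / 2 ^+ j + 2 * d / 2 ^+ j.
  by rewrite -!mulrDl; congr (_ * _ / _); ring.
by rewrite cReB cImB lerD.
Qed.

End GeometricCauchy.

Section CodedOrbit.
Variable R : realType.
Local Notation C := (R[i]).
Variables (f : C -> option C) (c om : nat -> C) (phi : nat -> C -> C) (dl : R).
Hypothesis dl0 : 0 < dl.
Hypothesis om_pole : forall k, f (om k) = None.
Hypothesis phiP : forall k y, cabs (y - om k.+1) < 2 * dl ->
  cabs (phi k y - om k) < dl /\ f (phi k y) = Some (y - c k.+1).
Hypothesis phi_contracting : forall k y y', cabs (y - om k.+1) < 2 * dl ->
  cabs (y' - om k.+1) < 2 * dl -> cabs (phi k y - phi k y') <= cabs (y - y') / 2.
Hypothesis phi_open : forall k V, copen V -> V `<=` cball (om k.+1) (2 * dl) ->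
  copen (phi k @` V).

Let om_in k : cabs (om k - om k) < 2 * dl.
Proof. by rewrite subrr cabs0 mulr_gt0. Qed.

(* pullback j k = phi_k o phi_(k+1) o ... o phi_(k+j-1) *)
Fixpoint pullback j k y := if j is j'.+1 then phi k (pullback j' k.+1 y) else y.

Lemma pullback_in j k y : cabs (y - om (j + k)) < 2 * dl ->
  cabs (pullback j k y - om k) < 2 * dl.
Proof.
elim: j k => [|j IH] k //= y_in; have [|in_dl _] := @phiP k (pullback j k.+1 y).
  by apply: IH; rewrite addnS.
by have := dl0; lra.
Qed.

Lemma pullback_contracting j k y y' : cabs (y - om (j + k)) < 2 * dl ->
  cabs (y' - om (j + k)) < 2 * dl ->
  cabs (pullback j k y - pullback j k y') <= cabs (y - y') / 2 ^+ j.
Proof.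
elim: j k => [|j IH] k /= y_in y'_in; first by rewrite expr0 divr1.
rewrite addSnnS in y_in y'_in.
apply: (le_trans (phi_contracting (pullback_in y_in) (pullback_in y'_in))).
by rewrite exprSr invfM mulrA ler_pM2r ?invr_gt0//; exact: IH.
Qed.

Lemma pullback_open j k V : copen V -> V `<=` cball (om (j + k)) (2 * dl) ->
  copen (pullback j k @` V).
Proof.
elim: j k V => [|j IH] k V oV Vs; first by rewrite image_id.
have -> : pullback j.+1 k @` V = phi k @` (pullback j k.+1 @` V) by rewrite image_comp.
apply: phi_open; first by apply: IH => //; rewrite addnS.
by move=> _ [y Vy <-]; apply: pullback_in; rewrite addnS; exact: Vs.
Qed.

Lemma pullbackSr j k y : pullback j.+1 k y = pullback j k (phi (j + k) y).
Proof. by elim: j k => // j IH k; have := IH k.+1; rewrite addnS /= => ->. Qed.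

Lemma pullback_Fit i j y : (i <= j)%N -> cabs (y - om j) < 2 * dl ->
  Fit f c i (pullback j 0 y) = Some (pullback (j - i) i y).
Proof.
elim: i => [|i IH] ij y_in; first by rewrite subn0.
rewrite /= IH//; last exact: ltnW.
have -> : (j - i = (j - i.+1).+1)%N by rewrite subnSK.
rewrite /= /fn; have [|_ ->] := @phiP i (pullback (j - i.+1) i.+1 y).
  by apply: pullback_in; rewrite subnK.
by rewrite /= subrK.
Qed.

Lemma pullback_limit : exists x, forall k j,
  cabs (x k - pullback j k (om (j + k))) <= 4 * dl / 2 ^+ j.
Proof.
have /choice[x limit] : forall k, exists z, forall j,
    cabs (z - pullback j k (om (j + k))) <= 4 * dl / 2 ^+ j; last by exists x.
move=> k; apply: (geometric_cauchyC (ltW dl0)) => j; rewrite pullbackSr.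
have [phi_in _] := phiP (om_in (j + k).+1); have := dl0 => dl_gt0.
apply: (le_trans (@pullback_contracting j k _ _ _ (om_in _))); first by lra.
by rewrite ler_pM2r ?invr_gt0 ?exprn_gt0// ltW.
Qed.

Lemma pullback_fixed_orbit : exists x, forall k,
  cabs (x k - om k) < 2 * dl /\ x k = phi k (x k.+1).
Proof.
have := dl0 => dl_gt0; have [x limit] := pullback_limit.
have halve (y : R) j : y / 2 ^+ j.+1 = y / 2 ^+ j / 2 by rewrite exprSr invfM mulrA.
have x_in k : cabs (x k - om k) < 2 * dl.
  suff : cabs (x k - om k) - dl <= 0 by lra.
  apply: (@le0_half_powers _ _ (2 * dl)) => j.
  have [phi_in _] := @phiP k _ (@pullback_in j k.+1 (om (j + k.+1)%N) (om_in _)).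
  have := limit k j.+1; rewrite addSnnS halve /= => x_near.
  by have := cabs_distD (phi k (pullback j k.+1 (om (j + k.+1)))) (x k) (om k); lra.
exists x => k; split=> //; apply/eqP; rewrite -subr_eq0 -cabs_eq0 eq_le cabs_ge0 andbT.
apply: (@le0_half_powers _ _ (4 * dl)) => j; pose u := pullback j k.+1 (om (j + k.+1)%N).
have u_in : cabs (u - om k.+1) < 2 * dl by apply: pullback_in; exact: om_in.
have := phi_contracting u_in (x_in k.+1); rewrite (cabs_distC u) => contracted.
have := limit k.+1 j; rewrite -/u => x_next.
have := limit k j.+1; rewrite addSnnS halve -[pullback _ _ _]/(phi k u) => x_near.
have := cabs_distD (phi k u) (x k) (phi k (x k.+1)).
by move: contracted x_next x_near; clearbody u; lra.
Qed.

Variable x : nat -> C.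
Hypothesis x_in2 : forall k, cabs (x k - om k) < 2 * dl.
Hypothesis xE : forall k, x k = phi k (x k.+1).

Lemma coded_orbit_step k : cabs (x k - om k) < dl /\ f (x k) = Some (x k.+1 - c k.+1).
Proof. by rewrite [x k]xE; exact: phiP. Qed.

Lemma coded_orbit_Fit k : Fit f c k (x 0%N) = Some (x k).
Proof. by elim: k => //= k ->; rewrite /fn (coded_orbit_step k).2 /= subrK. Qed.

Lemma coded_orbit_pullback n k : x k = pullback n k (x (n + k)%N).
Proof. by elim: n k => //= n IH k; rewrite {1}xE IH addnS. Qed.

Lemma coded_orbit_univalent n : univ_pullback f c (x 0%N) n dl.
Proof.
have in2 y : cabs (y - x n) < dl -> cabs (y - om n) < 2 * dl.
  by have [x_in _] := coded_orbit_step n; have := cabs_distD (x n) y (om n); lra.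
have Fit_pullback y : cabs (y - x n) < dl -> Fit f c n (pullback n 0 y) = Some y.
  by move=> /in2 y_in; rewrite pullback_Fit// subnn.
exists (pullback n 0 @` cball (x n) dl); split.
- by apply: pullback_open; [exact: cball_open|move=> y /in2; rewrite addn0].
- exists (x n); first exact: cball_center.
  by have := coded_orbit_pullback n 0; rewrite addn0.
- by move=> _ [y /in2 y_in <-] k kn; rewrite pullback_Fit.
- by move=> _ _ /set_mem[y yb <-] /set_mem[y' yb' <-]; rewrite !Fit_pullback//= => ->.
rewrite coded_orbit_Fit /=; apply/seteqP; split.
  by move=> _ [_ [y yb <-] <-]; rewrite Fit_pullback.
by move=> y yb; exists (pullback n 0 y); [exists y|rewrite Fit_pullback].
Qed.

Lemma coded_orbit_julia : julia f c (x 0%N).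
Proof.
move=> [r [r0 [defined _]]]; have [n /(_ n (leqnn n)) dl_small] := exists_half_powers_lt dl r0.
have om_in0 : cabs (om n - om (n + 0)) < 2 * dl by rewrite addn0.
have x_in0 : cabs (x n - om (n + 0)) < 2 * dl by rewrite addn0.
apply: (defined (pullback n 0 (om n)) _ n.+1).
  have := pullback_contracting om_in0 x_in0; have := coded_orbit_pullback n 0.
  rewrite addn0 /cball /= => <- /le_lt_trans; apply; apply: le_lt_trans dl_small.
  by rewrite ler_pM2r ?invr_gt0 ?exprn_gt0// cabs_distC ltW//; exact: (coded_orbit_step n).1.
by rewrite /= pullback_Fit// subnn /= /fn om_pole.
Qed.

Lemma coded_orbit_radial : radial_julia f c (x 0%N).
Proof.
split; first exact: coded_orbit_julia.
split=> [n|]; first by rewrite coded_orbit_Fit.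
by exists dl; split=> // n; exists n; split=> //; exact: coded_orbit_univalent.
Qed.

End CodedOrbit.

Section CantorMass.
Variables (R : realType) (T : eqType).
Local Notation C := (R[i]).

Lemma seq_bound_lt1 (A : seq T) (p : T -> R) : (forall a, a \in A -> p a < 1) ->
  exists q, [/\ 0 <= q, q < 1 & forall a, a \in A -> p a <= q].
Proof.
elim: A => [|b A IH] p_lt1; first by exists 0.
have [|q [q0 q1 p_le]] := IH; first by move=> a aA; apply: p_lt1; rewrite inE aA orbT.
exists (Num.max q (p b)); split; first by rewrite le_max q0.
  by rewrite gt_max q1 p_lt1// mem_head.
by move=> a; rewrite inE => /predU1P[->|/p_le le_q]; rewrite le_max ?lexx ?orbT// le_q.
Qed.

Lemma prod_le_expr (p : T -> R) q (s : seq T) :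
  (forall a, a \in s -> 0 <= p a <= q) -> \prod_(a <- s) p a <= q ^+ size s.
Proof.
move=> p_le; rewrite -iter_mulr_1 -count_predT -big_const_seq big_seq [leRHS]big_seq.
exact: ler_prod.
Qed.

Lemma prodr_powR (g : T -> R) s (l : seq T) : (forall a, a \in l -> 0 <= g a) ->
  \prod_(a <- l) g a `^ s = (\prod_(a <- l) g a) `^ s.
Proof.
elim: l => [|b l IH] g0; first by rewrite !big_nil powR1.
have gl0 a : a \in l -> 0 <= g a by move=> al; apply: g0; rewrite inE al orbT.
rewrite !big_cons IH// powRM//; first by apply: g0; rewrite mem_head.
by rewrite big_seq; apply: prodr_ge0.
Qed.

Variables (A : seq T) (g : T -> R) (s c1 : R) (X : (nat -> T) -> C).
Hypothesis uniqA : uniq A.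
Hypothesis s0 : 0 <= s.
Hypothesis g_gt0 : forall a, a \in A -> 0 < g a.
Hypothesis sum_ge1 : 1 <= \sum_(a <- A) g a `^ s.
Hypothesis size_gt1 : (1 < size A)%N.
Hypothesis c1_gt0 : 0 < c1.

Let coded (w : nat -> T) := forall n, w n \in A.

Hypothesis separated : forall w t n, coded w -> coded t ->
  (forall k, (k < n)%N -> w k = t k) -> w n <> t n ->
  c1 * \prod_(a <- mkseq w n) g a <= cabs (X w - X t).

Let p a : R := g a `^ s / \sum_(b <- A) g b `^ s.
Let mu (l : seq T) := \prod_(a <- l) p a.

Let sum_gt0 : 0 < \sum_(a <- A) g a `^ s. Proof. exact: lt_le_trans ltr01 sum_ge1. Qed.

Let p_gt0 a : a \in A -> 0 < p a.
Proof. by move=> aA; rewrite divr_gt0// powR_gt0// g_gt0. Qed.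

Let p_sum1 : \sum_(a <- A) p a = 1.
Proof. by rewrite /p -mulr_suml mulfV// gt_eqF. Qed.

Let p_lt1 a : a \in A -> p a < 1.
Proof.
move=> aA; rewrite -p_sum1 (bigD1_seq a)//= ltrDl.
have [b [bA ba]] : exists b, b \in A /\ b != a.
  apply: contrapT => /forallNP only_a; move: size_gt1; apply/negP; rewrite -leqNgt.
  rewrite -[1%N]/(size [:: a]) uniq_leq_size// => b bA; rewrite inE.
  by apply/negPn/negP => ba; apply: (only_a b).
rewrite -big_filter (bigD1_seq b) ?mem_filter ?ba ?filter_uniq//=.
rewrite ltr_pwDl ?p_gt0// big_seq_cond; apply: sumr_ge0 => d /andP[].
by rewrite mem_filter => /andP[_ /p_gt0/ltW].
Qed.

Let mkseq_sub w n : coded w -> {subset mkseq w n <= A}.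
Proof. by move=> wA a /mapP[k _ ->]. Qed.

Let mu_small (e : R) : 0 < e -> exists N, forall w, coded w -> mu (mkseq w N) <= e.
Proof.
move=> e0; have [q [q0 q1 p_le]] := seq_bound_lt1 p_lt1.
have q_norm : `|q| < 1 by rewrite ger0_norm.
have /cvgr_lt/(_ _ e0)[N _ /(_ N (leqnn N))/ltW qN] := cvg_expr q_norm.
exists N => w wA; apply: le_trans qN; rewrite -{2}(size_mkseq w N).
apply: prod_le_expr => a /(mkseq_sub wA) aA.
by rewrite (ltW (p_gt0 aA)) p_le.
Qed.

Let first_branching (U : set C) w0 w : coded w0 -> coded w -> U (X w) -> w <> w0 ->
  exists n t, [/\ coded t, U (X t), t n <> w0 n &
    forall v, coded v -> U (X v) -> mkseq v n = mkseq w0 n].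
Proof.
move=> w0A wA Uw ww0.
pose branches n := `[< exists t, [/\ coded t, U (X t) & t n <> w0 n] >].
have ex_branching : exists n, branches n.
  apply: contrapT => /forallNP none; apply: ww0; apply/funext => n.
  by apply: contrapT => wn; apply: (none n); apply/asboolP; exists w.
have [n /asboolP[t [tA Ut tn]] nmin] := ex_minnP ex_branching.
exists n, t; split=> // v vA Uv; apply/eq_in_map => k; rewrite mem_iota add0n => /andP[_ kn].
apply: contrapT => vk; have /nmin : branches k by apply/asboolP; exists v.
by rewrite leqNgt kn.
Qed.

Let mu_le_hterm (U : set C) n w t : (cdiam U <= 1%:E)%E -> coded w -> coded t ->
  U (X w) -> U (X t) -> mkseq w n = mkseq t n -> w n <> t n ->
  ((mu (mkseq w n))%:E <= (c1 `^ (- s))%:E * hterm s U)%E.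
Proof.
move=> Ud wA tA Uw Ut agree wtn; have [diamE diam0] := cdiam_fin Uw Ud.
have gw a : a \in mkseq w n -> 0 <= g a by move=> /(mkseq_sub wA)/g_gt0/ltW.
have prod0 : 0 <= \prod_(a <- mkseq w n) g a by rewrite big_seq; apply: prodr_ge0.
have prod_le : c1 * \prod_(a <- mkseq w n) g a <= fine (cdiam U).
  rewrite -lee_fin -diamE; apply: le_trans (cdiam_ge Uw Ut); rewrite lee_fin.
  apply: separated => // k kn; have := congr1 (nth (w 0%N) ^~ k) agree.
  by rewrite !nth_mkseq.
rewrite (htermE _ Uw) -EFinM lee_fin (@le_trans _ _ ((\prod_(a <- mkseq w n) g a) `^ s))//.
  rewrite -prodr_powR// /mu [leLHS]big_seq [leRHS]big_seq.
  apply: ler_prod => a /(mkseq_sub wA) aA; rewrite (ltW (p_gt0 aA)) /p /=.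
  by rewrite ler_pdivrMr// ler_peMr// powR_ge0.
rewrite powRN mulrC ler_pdivlMr ?powR_gt0// -powRM// ?(ltW c1_gt0)//.
by apply: ge0_ler_powR => //; rewrite ?nnegrE 1?mulrC// mulr_ge0// ltW.
Qed.

(* A set meeting two coded points has diameter at least the product of the g along
   their common prefix, so it carries little mass; a set meeting at most one coded
   point lies in an arbitrarily light cylinder. *)
Let covering_word (U : set C) (e : R) : (cdiam U <= 1%:E)%E -> 0 < e ->
  exists W : seq T, [/\ {subset W <= A},
    forall w, coded w -> U (X w) -> W = mkseq w (size W) &
    ((mu W)%:E <= (c1 `^ (- s))%:E * hterm s U + e%:E)%E].
Proof.
move=> Ud e0; have [N mu_le] := mu_small e0.
have hterm0 : (0 <= (c1 `^ (- s))%:E * hterm s U)%E.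
  by rewrite mule_ge0 ?hterm_ge0// lee_fin powR_ge0.
have [a0 a0A] : exists a, a \in A.
  by case: (A) size_gt1 => // a ? _; exists a; rewrite mem_head.
have [[w0 [w0A Uw0]]|no_point] := pselect (exists w, coded w /\ U (X w)); last first.
  exists (mkseq (fun=> a0) N); split; first exact: mkseq_sub.
    by move=> w wA Uw; case: no_point; exists w.
  by rewrite -[leLHS]add0e leeD// lee_fin mu_le.
have [[w [wA Uw ww0]]|one_point] := pselect (exists w, [/\ coded w, U (X w) & w <> w0]).
  have [n [t [tA Ut tn agree]]] := first_branching w0A wA Uw ww0.
  exists (mkseq w0 n); split; first exact: mkseq_sub.
    by move=> v vA Uv; rewrite size_mkseq agree.
  rewrite -[leLHS]adde0 leeD ?lee_fin ?(ltW e0)//.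
  by apply: (mu_le_hterm Ud w0A tA) => //; [rewrite (agree t)|move=> /esym].
exists (mkseq w0 N); split; first exact: mkseq_sub.
  move=> v vA Uv; rewrite size_mkseq (_ : v = w0)//.
  by apply: contrapT => vw0; apply: one_point; exists v.
by rewrite -[leLHS]add0e leeD// lee_fin mu_le.
Qed.

Lemma cantor_hausdorff_neq0 (E : set C) :
  (forall w, (forall n, w n \in A) -> E (X w)) -> hausdorff s E <> 0%E.
Proof.
move=> XE /hausdorff0P cover.
have c1s : 0 < c1 `^ s by rewrite powR_gt0.
have [|U [EU Ud U_sum]] := cover 1 (c1 `^ s / 4) ltr01; first by rewrite divr_gt0.
have e0 i : 0 < 2^-1 / (2 ^ i.+1)%:R :> R by rewrite divr_gt0// ltr0n expn_gt0.
have /choice[W WP] := fun i => covering_word (Ud i) (e0 i).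
have WA i : {subset W i <= A} by have [] := WP i.
have cs0 : (0 <= (c1 `^ (- s))%:E)%E by rewrite lee_fin powR_ge0.
have [| |w [wA W_avoid]] := @tree_cover R T A p W uniqA _ p_sum1 WA.
- by move=> a /p_gt0/ltW.
- apply: (@le_lt_trans _ _ (4^-1 + 2^-1)%:E); last by rewrite lte_fin; lra.
  apply: (@le_trans _ _ (\sum_(0 <= i <oo) ((c1 `^ (- s))%:E * hterm s (U i) +
      (2^-1 / (2 ^ i.+1)%:R)%:E))%E).
    apply: lee_nneseries => [i _ _|i _]; last by have [] := WP i.
    by rewrite lee_fin big_seq; apply: prodr_ge0 => a /WA/p_gt0/ltW.
  apply: (le_trans (epsilon_trick xpredT _ _)) => [i|//|]; first by rewrite mule_ge0 ?hterm_ge0.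
  rewrite EFinD leeD2r// nneseriesZl; last by move=> i _; exact: hterm_ge0.
  apply: (le_trans (lee_wpmul2l cs0 U_sum)).
  by rewrite -EFinM lee_fin powRN mulrA mulVf ?mul1r// gt_eqF.
have [i _ Uw] := EU _ (XE w wA).
by apply: (W_avoid i); have [_ prefix_w _] := WP i; exact: prefix_w.
Qed.

End CantorMass.

(** * Lower bound *)

Section CodedPoints.
Variable R : realType.
Local Notation C := (R[i]).

Lemma copen_translate (V : set C) (u : C) : copen V -> copen ((fun y => y - u) @` V).
Proof.
move=> oV _ [y Vy <-]; have [d [d0 dV]] := oV _ Vy; exists d; split=> // z zd.
exists (z + u); last by rewrite addrK.
by apply: dV; move: zd; rewrite /cball /=; congr (cabs _ < _); ring.
Qed.

Variables (f : C -> option C) (P : set C) (M : nat) (beta K r : R).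
Hypothesis ku : KU_poles f P M beta K r.

Let r0 : 0 < r. Proof. exact: KU_radius_gt0 ku. Qed.
Let K1 : 1 <= K. Proof. exact: KU_const_ge1 ku. Qed.
Let K0 : 0 < K. Proof. exact: lt_le_trans ltr01 K1. Qed.

Lemma KU_inverse_branch : exists A0 : R, forall (a b u : C), P a ->
  A0 <= cabs a -> A0 <= cabs b -> cabs u < 1 -> exists phi : C -> C,
   [/\ (forall y, cabs (y - b) < 2 * (r / 4) ->
          cabs (phi y - a) < r / 4 /\ f (phi y) = Some (y - u)),
       (forall y y', cabs (y - b) < 2 * (r / 4) -> cabs (y' - b) < 2 * (r / 4) ->
          cabs (phi y - phi y') <= cabs (y - y') / 2) &
       (forall V, copen V -> V `<=` cball b (2 * (r / 4)) -> copen (phi @` V))].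
Proof.
have := r0 => r_gt0; have eta0 := affine_ratio_gt0 M K1.
have [|d [d0 d1 d8]] := @exists_pos_le2 R 1 (r / 8) ltr01; first by lra.
have value0 : 0 < pole_value_bound K M r by exact: pole_value_bound_gt0.
have K20 : 0 < 4 * K ^+ 2 by rewrite mulr_gt0// exprn_gt0.
have close0 : 0 < K / d ^+ M by rewrite divr_gt0// exprn_gt0.
pose ratio := affine_ratio K M / (4 * K ^+ 2).
have ratio0 : 0 < ratio by rewrite divr_gt0.
have disc0 : 0 < 2 * (r / 4) / ratio by rewrite divr_gt0//; lra.
exists (3 + pole_value_bound K M r + 4 * K ^+ 2 + K / d ^+ M + 2 * (r / 4) / ratio).
move=> a b u Pa a_large b_large u1; have w_large := cabsB_ge b u.
have scale1 : cabs a `^ (- beta) <= 1 by apply: (KU_scale_le1 ku); lra.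
have [|||||phi [phiP phi_contr phi_open]] := pole_univalent_branch (w := b - u)
    (D := 2 * (r / 4)) (d := d) (KU_pole_model ku Pa) scale1; [lra|lra|by rewrite d0| | |].
- by rewrite -ltr_pdivrMr ?exprn_gt0//; lra.
- by rewrite [leRHS]mulrC -ler_pdivrMr// -/ratio; move: disc0; clearbody ratio; lra.
have shift y : cabs (y - b) = cabs (y - u - (b - u)) by congr cabs; ring.
exists (fun y => phi (y - u)); split=> [y|y y'|V oV Vb].
- by rewrite shift => /phiP[phi_near _ fE]; split=> //; lra.
- rewrite !shift => yb y'b; apply: le_trans (phi_contr _ _ yb y'b) _.
  by have -> : y - u - (y' - u) = y - y' by ring.
rewrite -(image_comp (fun y => y - u) phi); apply: phi_open; first exact: copen_translate.
by move=> _ [y /Vb yb <-]; rewrite /cball /= -shift.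
Qed.

Definition coded_by (c om x : nat -> C) := forall k,
  cabs (x k - om k) < r / 4 /\ f (x k) = Some (x k.+1 - c k.+1).

Lemma coded_point : exists A0 : R, forall c, small_shifts c -> forall om,
  (forall k, P (om k) /\ A0 <= cabs (om k)) -> exists x, [/\ coded_by c om x,
    (forall k, Fit f c k (x 0%N) = Some (x k)) & radial_julia f c (x 0%N)].
Proof.
have r4 : 0 < r / 4 by rewrite divr_gt0.
have [A0 branch] := KU_inverse_branch; exists A0 => c small_c om omP.
have /choice[phi phiP] := fun k => branch (om k) (om k.+1) (c k.+1) (omP k).1 (omP k).2
  (omP k.+1).2 (small_c k.+1 isT).
have phi_step k := let: And3 step _ _ := phiP k in step.
have phi_contr k := let: And3 _ contr _ := phiP k in contr.
have phi_open k := let: And3 _ _ opn := phiP k in opn.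
have [x xP] := pullback_fixed_orbit r4 phi_step phi_contr.
have om_pole k : f (om k) = None by exact: (KU_sub_poles ku (omP k).1).
have x_in k : cabs (x k - om k) < 2 * (r / 4) by have [] := xP k.
have xE k : x k = phi k (x k.+1) by have [] := xP k.
exists x; split=> [k|k|]; first exact: (coded_orbit_step phi_step x_in xE).
  exact: (coded_orbit_Fit phi_step x_in xE).
exact: (coded_orbit_radial r4 om_pole phi_step phi_contr phi_open x_in xE).
Qed.

Variable m : nat.
Hypothesis m0 : (0 < m)%N.

Let inv_m_le1 : m%:R^-1 <= 1 :> R. Proof. by rewrite invf_le1 ?ltr0n// ler1n. Qed.

Local Notation gam := (1 + m%:R^-1).

Definition code_weight (a : C) : R :=
  (4 * K * pole_lipschitz_const K M)^-1 * cabs a `^ (- ((beta + m%:R + 1) / m%:R)).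

Lemma code_weight_ge0 a : 0 <= code_weight a.
Proof.
rewrite mulr_ge0 ?powR_ge0// invr_ge0 !mulr_ge0 ?(ltW K0)// ltW//.
exact: pole_lipschitz_const_gt0.
Qed.

Lemma code_weight_gt0 a : 0 < cabs a -> 0 < code_weight a.
Proof.
by move=> a0; rewrite mulr_gt0 ?powR_gt0// invr_gt0 !mulr_gt0// pole_lipschitz_const_gt0.
Qed.

Lemma lipschitz_root_le (x W : R) : 0 < x -> 1 <= W ->
  (2 * W) * (K * (2 * W) / x `^ (- beta)) `^ m%:R^-1 <= 4 * K * W `^ gam * x `^ (beta / m%:R).
Proof.
move: K1 => K_ge1 x0 W1; have K_gt0 := K0; have W0 : 0 < W by lra.
rewrite powRN invrK.
have -> : K * (2 * W) * x `^ beta = (2 * K) * W * x `^ beta by ring.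
rewrite powRM ?powR_ge0//; last by rewrite mulr_ge0 ?mulr_ge0// ltW.
rewrite powRM ?(ltW W0)//; last by rewrite mulr_ge0// ltW.
rewrite -powRrM powRD; last by rewrite gt_eqF.
rewrite powRr1 ?(ltW W0)//.
have K_root : (2 * K) `^ m%:R^-1 <= 2 * K by apply: root_le_self => //; lra.
have -> : 2 * W * ((2 * K) `^ m%:R^-1 * W `^ m%:R^-1 * x `^ (beta / m%:R)) =
  2 * W * (2 * K) `^ m%:R^-1 * W `^ m%:R^-1 * x `^ (beta / m%:R) by ring.
have -> : 4 * K * (W * W `^ m%:R^-1) * x `^ (beta / m%:R) =
  2 * W * (2 * K) * W `^ m%:R^-1 * x `^ (beta / m%:R) by ring.
by rewrite ler_wpM2r ?powR_ge0// ler_wpM2r ?powR_ge0// ler_wpM2l//; lra.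
Qed.

Lemma coded_lipschitz a x y W : P a -> mult f a = m -> 0 < cabs a -> x != a ->
  cabs (x - a) <= r / 2 -> 1 <= W -> cabs (fv f x) <= 2 * W -> cabs (fv f y) <= 2 * W ->
  cabs (fv f x - fv f y) * code_weight a <= W `^ gam * cabs a `^ (- gam) * cabs (x - y).
Proof.
move=> Pa am a0 xa xr W1 xW yW; have K_gt0 := K0.
have L0 := pole_lipschitz_const_gt0 M K1.
have W20 : 0 < 2 * W by lra.
have := pole_lipschitz (KU_pole_model ku Pa) xa xr W20 xW yW; rewrite am => lipschitz.
apply: (le_trans (ler_wpM2r (code_weight_ge0 a) lipschitz)).
rewrite -[pole_lipschitz_const _ _ * _ * _]mulrA.
apply: (@le_trans _ _ (pole_lipschitz_const K M *
    (4 * K * W `^ gam * cabs a `^ (beta / m%:R)) * cabs (x - y) * code_weight a)).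
  rewrite ler_wpM2r ?code_weight_ge0// ler_wpM2r ?cabs_ge0//.
  by rewrite ler_wpM2l ?(ltW L0)// lipschitz_root_le.
rewrite /code_weight; have mR : m%:R != 0 :> R by rewrite pnatr_eq0 -lt0n.
have -> : - ((beta + m%:R + 1) / m%:R) = - (beta / m%:R) + - gam by field.
rewrite (@powRD _ (cabs a)); last by rewrite (gt_eqF a0) implybT.
rewrite [cabs a `^ (- (beta / m%:R))]powRN.
have b0 : cabs a `^ (beta / m%:R) != 0 by rewrite gt_eqF// powR_gt0.
by rewrite le_eqVlt; apply/orP; left; apply/eqP; field; rewrite b0 !gt_eqF.
Qed.

Variable Amax : R.

Definition letter (a : C) := [/\ P a, mult f a = m, 1 + r / 4 <= cabs a & cabs a <= Amax].

Let sep := r / (2 * Amax ^+ 2).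

Lemma coded_neq c om x k : (forall j, letter (om j)) -> coded_by c om x -> x k != om k.
Proof.
move=> omP xP; apply/eqP => xE; have [_] := xP k; rewrite xE.
by have [/(KU_sub_poles ku) -> _ _ _] := omP k.
Qed.

Lemma coded_separated c om ta x y k : (forall j, letter (om j)) -> (forall j, letter (ta j)) ->
  coded_by c om x -> coded_by c ta y -> om k <> ta k -> r / 2 <= cabs (x k - y k).
Proof.
move=> omP taP xP yP ot; have [/(KU_sub_poles ku) om_pole _ _ _] := omP k.
have [/(KU_sub_poles ku) ta_pole _ _ _] := taP k.
have [x_om _] := xP k; have [y_ta _] := yP k.
have : r <= cabs (ta k - om k).
  rewrite leNgt; apply/negP => close; apply: (KU_isolated ku om_pole close) => //.
  by apply/eqP => /esym.
have := cabs_distD (y k) (ta k) (om k); have := cabs_distD (x k) (y k) (om k).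
by rewrite (cabs_distC (ta k) (y k)) (cabs_distC (y k) (x k)); lra.
Qed.

Lemma coded_value_le c om x W : small_shifts c -> (forall j, letter (om j)) ->
  coded_by c om x -> cabs (om 1%N) <= W -> cabs (fv f (x 0%N)) <= 2 * W.
Proof.
move=> small_c omP xP omW; have [x0_om fx0] := xP 0%N; have [x1_om _] := xP 1%N.
have [_ _ om_ge _] := omP 1%N; have c1 := small_c 1%N isT.
rewrite (fv_some fx0); have := cabsB_le (x 1%N) (c 1%N).
by have := cabs_distD (om 1%N) (x 1%N) 0; rewrite !subr0; lra.
Qed.

Lemma coded_dist_step c om ta x y W : small_shifts c -> (forall j, letter (om j)) ->
  (forall j, letter (ta j)) -> coded_by c om x -> coded_by c ta y -> om 0%N = ta 0%N ->
  1 <= W -> cabs (om 1%N) <= W -> cabs (ta 1%N) <= W ->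
  cabs (om 0%N) `^ gam * code_weight (om 0%N) * (cabs (x 1%N - y 1%N) / W `^ gam) <=
  cabs (x 0%N - y 0%N).
Proof.
move=> small_c omP taP xP yP ot W1 omW taW; have := r0 => r_gt0.
have [Pa am om_ge _] := omP 0%N; have [x_om fx] := xP 0%N; have [_ fy] := yP 0%N.
have om0 : 0 < cabs (om 0%N) by lra.
have x_near : cabs (x 0%N - om 0%N) <= r / 2 by lra.
have := coded_lipschitz Pa am om0 (coded_neq 0 omP xP) x_near W1
  (coded_value_le small_c omP xP omW) (coded_value_le small_c taP yP taW).
have -> : fv f (x 0%N) - fv f (y 0%N) = x 1%N - y 1%N.
  by rewrite (fv_some fx) (fv_some fy); ring.
rewrite powRN => lipschitz; have Wg : 0 < W `^ gam by rewrite powR_gt0//; lra.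
have omg : 0 < cabs (om 0%N) `^ gam by rewrite powR_gt0.
have -> : cabs (om 0%N) `^ gam * code_weight (om 0%N) * (cabs (x 1%N - y 1%N) / W `^ gam) =
  (cabs (x 1%N - y 1%N) * code_weight (om 0%N)) * (cabs (om 0%N) `^ gam / W `^ gam) by ring.
apply: (le_trans (ler_wpM2r _ lipschitz)); first by rewrite divr_ge0// ltW.
by rewrite le_eqVlt; apply/orP; left; apply/eqP; field; rewrite !gt_eqF.
Qed.

Let sep_powR_le : 1 <= Amax -> sep * Amax `^ gam <= r / 2.
Proof.
move=> A1; have A2 : 0 < Amax ^+ 2 by rewrite exprn_gt0//; lra.
have -> : sep * Amax `^ gam = r / 2 * (Amax `^ gam / Amax ^+ 2).
  by rewrite /sep; field; rewrite gt_eqF//; lra.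
rewrite ler_piMr ?divr_ge0 ?(ltW r0)// ler_pdivrMr// mul1r.
by rewrite -powR_mulrn ?ler_powR//; have := inv_m_le1; lra.
Qed.

(* The factor |om 0|^(1+1/m) makes the induction on the common prefix go through. *)
Lemma coded_dist_deep n c om ta x y : small_shifts c -> (forall j, letter (om j)) ->
  (forall j, letter (ta j)) -> coded_by c om x -> coded_by c ta y ->
  (forall k, (k < n.+1)%N -> om k = ta k) -> om n.+1 <> ta n.+1 ->
  sep * cabs (om 0%N) `^ gam * \prod_(a <- mkseq om n.+1) code_weight a <= cabs (x 0%N - y 0%N).
Proof.
have := r0 => r_gt0.
elim: n c om ta x y => [|n IH] c om ta x y small_c omP taP xP yP agree differ.
all: have ot : om 0%N = ta 0%N by exact: agree.
all: have [_ _ om1_ge om1_le] := omP 1%N; have [_ _ _ ta1_le] := taP 1%N.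
all: have wt0 : 0 <= cabs (om 0%N) `^ gam * code_weight (om 0%N)
  by rewrite mulr_ge0 ?powR_ge0 ?code_weight_ge0.
  have A1 : 1 <= Amax by lra.
  apply: le_trans (coded_dist_step small_c omP taP xP yP ot A1 om1_le ta1_le).
  rewrite /mkseq /= big_seq1.
  have -> : sep * cabs (om 0%N) `^ gam * code_weight (om 0%N) =
    cabs (om 0%N) `^ gam * code_weight (om 0%N) * sep by ring.
  rewrite ler_wpM2l//.
  rewrite ler_pdivlMr ?powR_gt0 ?(lt_le_trans ltr01)//.
  exact: le_trans (sep_powR_le A1) (coded_separated omP taP xP yP differ).
have om1 : 1 <= cabs (om 1%N) by lra.
have ta_om : cabs (ta 1%N) <= cabs (om 1%N) by rewrite -agree.
have := IH (fun k => c k.+1) (fun k => om k.+1) (fun k => ta k.+1)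
  (fun k => x k.+1) (fun k => y k.+1).
move=> {}IH; apply: le_trans (coded_dist_step small_c omP taP xP yP ot om1 (lexx _) ta_om).
have -> : mkseq om n.+2 = om 0%N :: mkseq (fun k => om k.+1) n.+1.
  by rewrite /mkseq /= -[1%N]addn0 -[2%N]addn1 !iotaDl -!map_comp.
rewrite big_cons; set prod := \prod_(a <- _) _.
have -> : sep * cabs (om 0%N) `^ gam * (code_weight (om 0%N) * prod) =
  cabs (om 0%N) `^ gam * code_weight (om 0%N) * (sep * prod) by ring.
rewrite ler_wpM2l// ler_pdivlMr ?powR_gt0 ?(lt_le_trans ltr01)// mulrAC.
by apply: IH => // k ?; [exact: small_c|exact: agree].
Qed.

Lemma coded_dist n c om ta x y : small_shifts c -> (forall j, letter (om j)) ->
  (forall j, letter (ta j)) -> coded_by c om x -> coded_by c ta y ->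
  (forall k, (k < n)%N -> om k = ta k) -> om n <> ta n ->
  sep * \prod_(a <- mkseq om n) code_weight a <= cabs (x 0%N - y 0%N).
Proof.
have := r0 => r_gt0; move=> small_c omP taP xP yP; have [_ _ om_ge om_le] := omP 0%N.
have A1 : 1 <= Amax by lra.
have sep0 : 0 < sep by rewrite divr_gt0// mulr_gt0// exprn_gt0//; lra.
case: n => [_ differ|n agree differ].
  rewrite /mkseq /= big_nil mulr1; apply: le_trans (coded_separated omP taP xP yP differ).
  apply: le_trans (sep_powR_le A1); rewrite ler_peMr ?(ltW sep0)//.
  by rewrite -[leLHS](powRr0 Amax) ler_powR// addr_ge0.
apply: le_trans (coded_dist_deep small_c omP taP xP yP agree differ).
apply: ler_wpM2r; first by apply: prodr_ge0 => a _; exact: code_weight_ge0.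
by rewrite ler_peMr ?(ltW sep0)// -[leLHS](powRr0 (cabs (om 0%N))) ler_powR ?addr_ge0//; lra.
Qed.

End CodedPoints.

Lemma esum_pinfty_seq (R : realType) (T : choiceType) (S F : set T) (u : T -> R) (v : R) :
  (forall a, 0 <= u a) -> (\esum_(a in S) (u a)%:E = +oo)%E -> finite_set F ->
  exists A : seq T, [/\ uniq A, forall a, a \in A -> S a /\ ~ F a &
    v < \sum_(a <- A) u a].
Proof.
move=> u0 Soo finF; have u0E a : (0 <= (u a)%:E)%E by rewrite lee_fin.
have finSF : finite_set (S `&` F) by apply: sub_finite_set finF => x [].
have SCF : (\esum_(a in S `&` ~` F) (u a)%:E = +oo)%E.
  have := Soo; rewrite (esumID F)// (esum_fset finSF)// fsbig_finite// sumEFin.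
  by case: (\esum_(i in _) _)%E.
have [A [[finA AS] A_large]] : exists A, fsets (S `&` ~` F) A /\
    (v%:E < \sum_(x \in A) (u x)%:E)%E.
  apply: contrapT => /forallNP small.
  suff : (\esum_(a in S `&` ~` F) (u a)%:E <= v%:E)%E by rewrite SCF.
  apply: ge_ereal_sup => _ [A fA <-]; rewrite leNgt; apply/negP => A_large.
  by apply: (small A).
exists (fset_set A); split; first exact: fset_uniq.
  by move=> a; rewrite in_fset_set// inE => /AS[].
by move: A_large; rewrite fsbig_finite// sumEFin lte_fin.
Qed.

Section RadialLowerBound.
Variable R : realType.
Local Notation C := (R[i]).
Variables (f : C -> option C) (P : set C) (M : nat) (beta K r : R).
Hypothesis ku : KU_poles f P M beta K r.
Variables (rho : R) (m : nat).
Hypothesis m0 : (0 < m)%N.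
Hypothesis class_diverges : forall t, t < rho ->
  (\esum_(a in [set a | f a = None /\ mult f a = m]) (cabs a `^ (- t))%:E = +oo)%E.

Lemma heavy_alphabet t B v : t < rho -> exists A : seq C, [/\ uniq A,
  forall a, a \in A -> [/\ P a, mult f a = m & B <= cabs a] &
  v < \sum_(a <- A) cabs a `^ (- t)].
Proof.
move=> t_rho; pose F := (poles f `\` P) `|` [set a | f a = None /\ cabs a <= B].
have finF : finite_set F.
  rewrite finite_setU; split; first exact: (KU_cofinite ku).
  exact: (poles_in_disc_finite (KU_meromorphic ku)).
have [A [uA AP A_heavy]] := esum_pinfty_seq v (fun a => powR_ge0 _ _)
  (class_diverges t_rho) finF.
exists A; split=> // a /AP[[fa am] nFa]; split=> //.
  by apply: contrapT => nPa; apply: nFa; left.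
by rewrite leNgt; apply/negP => /ltW aB; apply: nFa; right.
Qed.

Lemma coded_alphabet_neq0 : exists A0 : R, forall c s lev Amax (A : seq C),
  small_shifts c -> 0 <= s -> uniq A -> (1 < size A)%N ->
  (forall a, a \in A -> [/\ letter f P r m Amax a, A0 <= cabs a & lev + r / 4 <= cabs a]) ->
  1 <= \sum_(a <- A) code_weight M beta K m a `^ s ->
  hausdorff s (escaping_part (radial_julia f c) f c lev) <> 0%E.
Proof.
have := KU_radius_gt0 ku => r0; have [A0 points] := coded_point ku; exists A0.
move=> c s lev Amax A small_c s0 uA size_gt1 AP sum_ge1.
have /choice[X XP] : forall w : nat -> C, exists x : nat -> C, (forall n, w n \in A) ->
    [/\ coded_by f r c w x, (forall j, Fit f c j (x 0%N) = Some (x j)) &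
     radial_julia f c (x 0%N)].
  move=> w; have [wA|not_code] := pselect (forall n, w n \in A); last by exists w.
  have [|x xP] := points c small_c w; last by exists x.
  by move=> n; have [[Pa _ _ _] ? _] := AP _ (wA n).
have [a0 a0A] : exists a, a \in A by case: (A) size_gt1 => // a ? _; exists a; rewrite mem_head.
have A1 : 1 <= Amax by have [[_ _ a_ge a_le] _ _] := AP a0 a0A; lra.
have weight_gt0 a : a \in A -> 0 < code_weight M beta K m a.
  by move=> /AP[[_ _ a_ge _] _ _]; apply: (code_weight_gt0 ku); lra.
have sep0 : 0 < r / (2 * Amax ^+ 2) by rewrite divr_gt0// mulr_gt0// exprn_gt0//; lra.
have letters (w : nat -> C) : (forall n, w n \in A) -> forall n, letter f P r m Amax (w n).
  by move=> wA n; have [] := AP _ (wA n).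
apply: (cantor_hausdorff_neq0 (X := fun w => X w 0%N) uA s0 weight_gt0 sum_ge1 size_gt1 sep0).
  move=> w t n wA tA agree differ; have [wX _ _] := XP w wA; have [tX _ _] := XP t tA.
  exact: (coded_dist ku m0 small_c (letters w wA) (letters t tA) wX tX agree differ).
move=> w wA; have [wX XF Xradial] := XP w wA; split=> // n _.
exists (X w n); split; first exact: XF.
have [X_near _] := wX n; have [_ _ w_large] := AP _ (wA n).
by have := cabsB_ge (w n) (w n - X w n); rewrite subKr (cabs_distC (w n)); lra.
Qed.

Lemma radial_escaping_neq0 c s lev : small_shifts c -> 0 <= s ->
  s < rho * m%:R / (beta + m%:R + 1) ->
  hausdorff s (escaping_part (radial_julia f c) f c lev) <> 0%E.
Proof.
have := KU_radius_gt0 ku => r0; have := KU_beta_ge0 ku => beta0 small_c s0 s_lt.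
have mR : 0 < m%:R :> R by rewrite ltr0n.
pose t := s * ((beta + m%:R + 1) / m%:R).
have t_rho : t < rho by rewrite /t mulrA ltr_pdivrMr//; move: s_lt; rewrite ltr_pdivlMr//; lra.
have t0 : 0 <= t by rewrite mulr_ge0// divr_ge0//; lra.
pose k := (4 * K * pole_lipschitz_const K M)^-1.
have k0 : 0 < k.
  rewrite invr_gt0 !mulr_gt0 ?(lt_le_trans ltr01 (KU_const_ge1 ku))//.
  exact: pole_lipschitz_const_gt0 (KU_const_ge1 ku).
have ks0 : 0 < (k `^ s)^-1 by rewrite invr_gt0 powR_gt0.
have [A0 alphabet_neq0] := coded_alphabet_neq0.
pose B := Num.max A0 (Num.max (1 + r / 4) (lev + r / 4)).
have [A [uA AP A_heavy]] := heavy_alphabet B ((k `^ s)^-1 + 1) t_rho.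
have AB a : a \in A -> [/\ A0 <= cabs a, 1 + r / 4 <= cabs a & lev + r / 4 <= cabs a].
  by move=> /AP[_ _]; rewrite !ge_max => /and3P[].
apply: (alphabet_neq0 c s lev (\sum_(a <- A) cabs a) A) => // [|a aA|].
- have : \sum_(a <- A) cabs a `^ (- t) <= (size A)%:R.
    rewrite -sum1_size natr_sum big_seq [leRHS]big_seq; apply: ler_sum => a /AB[_ a1 _].
    by rewrite -[leRHS](powRr0 (cabs a)); apply: ler_powR; [lra|rewrite oppr_le0].
  by rewrite -(@ltr_nat R); lra.
- have [Pa am _] := AP a aA; have [? ? ?] := AB a aA; split=> //; split=> //.
  by rewrite (bigD1_seq a)//= lerDl sumr_ge0// => *; exact: cabs_ge0.
rewrite (eq_bigr (fun a => k `^ s * cabs a `^ (- t))) => [|a _].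
  by rewrite -mulr_sumr mulrC -ler_pdivrMr ?powR_gt0// mul1r; lra.
rewrite /code_weight powRM ?powR_ge0 ?(ltW k0)// -powRrM; congr (_ * _ `^ _).
by rewrite /t; ring.
Qed.

End RadialLowerBound.

Section EscapingDimension.
Variables (R : realType) (f : R[i] -> option R[i]) (c : nat -> R[i]) (t lev0 : R).
Hypothesis t0 : 0 <= t.
Hypothesis null : forall S lev, lev0 <= lev -> hausdorff t (escaping_part S f c lev) = 0%E.

Lemma cvg_nonincreasing_ge0 (g : R -> R) (x0 : R) :
  (forall x y, x0 <= x -> x <= y -> g y <= g x) -> (forall x, 0 <= g x) ->
  cvg (g x @[x --> +oo]).
Proof.
move=> mono g0; pose h x := - g (Num.max x0 x).
have h_mono : {homo h : x y / x <= y}.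
  move=> x y xy; rewrite /h lerN2; apply: mono; first by rewrite le_max lexx.
  by rewrite ge_max !le_max lexx xy orbT.
have h_bound : has_ubound (range h) by exists 0 => _ [x _ <-]; rewrite oppr_le0.
have h_cvg := nondecreasing_cvgr h_mono h_bound.
apply/cvg_ex; exists (- sup (range h)); apply: cvg_trans (cvgN h_cvg).
apply: near_eq_cvg; near=> x; rewrite /h /= opprK max_r; first by [].
by near: x; apply: nbhs_pinfty_ge; exact: num_real.
Unshelve. all: by end_near. Qed.

Lemma escaping_part_anti S lev lev' : lev <= lev' ->
  escaping_part S f c lev' `<=` escaping_part S f c lev.
Proof.
move=> le_lev z [Sz escapes]; split=> // n n0; have [w [-> w_large]] := escapes n n0.
by exists w; split=> //; exact: le_lt_trans w_large.
Qed.

Lemma HD_escaping_cvg S : cvg (HD (escaping_part S f c lev) @[lev --> +oo]).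
Proof.
apply: (@cvg_nonincreasing_ge0 _ lev0) => [lev lev' lev_ge le_lev|lev]; last exact: HD_ge0.
exact: HD_mono t0 (null _ lev_ge) (escaping_part_anti le_lev).
Qed.

Lemma EHD_le_ED : EHD f c <= ED f c.
Proof.
apply: ler_lim; [exact: HD_escaping_cvg|exact: HD_escaping_cvg|].
near=> lev; apply: (HD_mono t0 (null _ _)) => [|z [[Jz _] escapes]//].
by near: lev; apply: nbhs_pinfty_ge; exact: num_real.
Unshelve. all: by end_near. Qed.

Lemma EHD_ge s :
  (forall x lev, 0 <= x -> x < s ->
     hausdorff x (escaping_part (radial_julia f c) f c lev) <> 0%E) -> s <= EHD f c.
Proof.
move=> not_null; apply: limr_ge; first exact: HD_escaping_cvg.
near=> lev; apply: (HD_ge t0 (null _ _)) => [|x x0 xs]; last exact: not_null.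
by near: lev; apply: nbhs_pinfty_ge; exact: num_real.
Unshelve. all: by end_near. Qed.

Lemma ED_le s : (forall e, 0 < e -> exists lev1, forall lev, lev1 <= lev ->
  HD (escaping_part (julia f c) f c lev) <= s + e) -> ED f c <= s.
Proof.
move=> HD_small; apply/ler_addgt0Pr => e /HD_small[lev1 HD_le_e].
apply: limr_le; first exact: HD_escaping_cvg.
near=> lev; apply: HD_le_e.
by near: lev; apply: nbhs_pinfty_ge; exact: num_real.
Unshelve. all: by end_near. Qed.

End EscapingDimension.

Theorem theorem6p4 (R : realType) (f0 : R[i] -> option R[i]) (rho : R)
    (Pstar : set R[i]) (Rstar Rdag : R) (M : nat) (beta : R) :
  (* f0 : C -> C^ transcendental meromorphic of finite order rho > 0 *)
  meromorphic f0 -> transcendental f0 -> has_order f0 rho -> 0 < rho ->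
  (* (KU1) infinity is not an asymptotic value of f0 *)
  ~ inf_asymptotic_value f0 ->
  (* (KU2) *)
  Pstar `<=` poles f0 -> finite_set (poles f0 `\` Pstar) -> 0 < Rstar ->
  (forall a, Pstar a -> ((2 * Rstar)%:E < dist_to (sing_vals f0) a)%E) ->
  (* (KU3) *)
  0 < Rdag ->
  (forall a1 a2, poles f0 a1 -> poles f0 a2 -> a1 <> a2 ->
     cball a1 Rdag `&` cball a2 Rdag = set0) ->
  (* (KU4) *)
  0 <= beta ->
  (forall a, Pstar a -> (1 <= mult f0 a <= M)%N) ->
  (exists K : R, 1 <= K /\
     forall a z, Pstar a -> cball a Rdag z -> z != a ->
       [/\ K^-1 * (cabs a `^ (- beta) / cabs (z - a) ^+ mult f0 a) <= cabs (fv f0 z),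
           cabs (fv f0 z) <= K * (cabs a `^ (- beta) / cabs (z - a) ^+ mult f0 a),
           K^-1 * ((mult f0 a)%:R * cabs a `^ (- beta) / cabs (z - a) ^+ (mult f0 a).+1)
             <= cabs (cderiv (fv f0) z) &
           cabs (cderiv (fv f0) z)
             <= K * ((mult f0 a)%:R * cabs a `^ (- beta) / cabs (z - a) ^+ (mult f0 a).+1)]) ->
  exists eps : R, 0 < eps /\
    forall c : nat -> R[i], (forall n, (0 < n)%N -> cabs (c n) < eps) ->
      [/\ (forall Ms : nat, is_Mstar f0 rho M Ms ->
             rho * Ms%:R / (beta + Ms%:R + 1) <= EHD f0 c),
          EHD f0 c <= ED f0 c &
          ED f0 c <= rho * M%:R / (beta + M%:R + 1)].
Proof.
move=> merf tranf ho rho0 noinf Pp finP _ _ Rdag0 sep beta0 mM [K [K1 est]].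
have ku : KU_poles f0 Pstar M beta K Rdag.
  by split=> // a Pa z; exact: est.
have null := escaping_part_null ku tranf noinf ho rho0.
have den0 n : 0 < beta + n%:R + 1 by have := ler0n R n; lra.
set T := rho * M%:R / (beta + M%:R + 1) in null *.
have T0 : 0 <= T by rewrite divr_ge0 ?mulr_ge0 ?(ltW rho0) ?(ltW (den0 M)).
have [|lev1 null1] := null (T + 1); first by lra.
exists 1; split; first exact: ltr01.
move=> c small_c; have T1 : 0 <= T + 1 by lra.
have nullc S lev : lev1 <= lev -> hausdorff (T + 1) (escaping_part S f0 c lev) = 0%E.
  by move=> lev_ge; exact: null1.
split=> [Ms [/andP[Ms0 _] [_ diverges] _]||].
- apply: (EHD_ge T1 nullc) => s lev s0 s_lt.
  exact: (radial_escaping_neq0 ku Ms0 diverges small_c s0 s_lt).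
- exact: (EHD_le_ED T1 nullc).
apply: (ED_le T1 nullc) => e e0; have [|lev2 null2] := null (T + e); first by lra.
by exists lev2 => lev lev_ge; apply: HD_le; [lra|exact: null2].
Qed.
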